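(* Let $f:\mathbb{R}^d\to\mathbb{R}^d$ be globally Lipschitz continuous. Let $$\mathcal{F}_{\mathrm{aff}}(f)=\{x\mapsto S f(Wx+b) : S,W\in\mathbb{R}^{d\times d},\ b\in\mathbb{R}^d\},$$ $$\mathcal{F}_{\mathrm{diag}}(f)=\{x\mapsto D f(\Lambda x+b) : D,\Lambda\in\mathbb{R}^{d\times d}\text{ diagonal},\ b\in\mathbb{R}^d\}.$$ 1) If $f$ is nonlinear, then $\mathcal{F}_{\mathrm{aff}}(f)$ achieves the UAP and the UIP. 2) If $f$ is fully coordinate nonlinear, then $\mathcal{F}_{\mathrm{diag}}(f)$ achieves the UAP and the UIP.
   Context: For a Lipschitz vector field $v:\mathbb{R}^d\to\mathbb{R}^d$ and $\tau\ge 0$, the flow map $\phi_v^\tau$ sends $x_0$ to $x(\tau)$, where $\dot x(t)=v(x(t))$, $x(0)=x_0$. For a set (control family) $\mathcal{F}$ of vector fields, $$\mathcal{H}(\mathcal{F})=\{\phi_{f_n}^{\tau_n}\circ\cdots\circ\phi_{f_1}^{\tau_1} : f_i\in\mathcal{F},\ \tau_i\ge 0,\ n\in\mathbb{N}\}.$$ Nonlinearity: a scalar continuous function is nonlinear if it is not affine. $f=(f_1,\dots,f_d)$ is nonlinear if at least one component $f_i$ is nonlinear. A component $f_i\in C(\mathbb{R}^d)$ is coordinate nonlinear if for every standard basis vector $e_j$, $j=1,\dots,d$, there is $b_{ij}\in\mathbb{R}^d$ such that $t\mapsto f_i(te_j+b_{ij})$ is a nonlinear function on $\mathbb{R}$.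 $f$ is fully coordinate nonlinear if all its components are coordinate nonlinear. UAP: $\mathcal{F}$ achieves the UAP if for every compact $\Omega\subset\mathbb{R}^d$, every $g\in\mathrm{Diff}_0(\mathbb{R}^d)$ (the orientation-preserving diffeomorphisms of $\mathbb{R}^d$) and every $\varepsilon>0$ there is $h\in\mathcal{H}(\mathcal{F})$ with $\|g(x)-h(x)\|\le\varepsilon$ for all $x\in\Omega$. UIP: $\mathcal{F}$ achieves the UIP if $\mathcal{H}(\mathcal{F})$ has the UIP, i.e. for every positive integer $N$ and all data $(x_1,y_1),\dots,(x_N,y_N)\in\mathbb{R}^d\times\mathbb{R}^d$ with $x_i\ne x_j$ and $y_i\neq y_j$ for all $i\ne j$, there exists $\varphi\in\mathcal{H}(\mathcal{F})$ with $\varphi(x_i)=y_i$ for $i=1,\dots,N$. Convention when $d=1$: only data with $x_1<\cdots<x_N$ and $y_1<\cdots<y_N$ are considered. *)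

(* Defs.v *)
From mathcomp Require Import all_boot all_order all_algebra.
From mathcomp Require Import all_classical all_reals all_analysis.

Set Implicit Arguments.
Unset Strict Implicit.
Unset Printing Implicit Defensive.

Import Order.TTheory GRing.Theory Num.Theory.
Import numFieldNormedType.Exports.

Local Open Scope classical_set_scope.
Local Open Scope ring_scope.

(* R^d is 'rV[R]_d with its library norm (the sup norm). Since vectors are
   rows, the matrix-vector product A x is written x *m A^T. *)

(* phi is the time-tau flow map of v.  For Lipschitz v the solution x exists on
   all of R and is unique, so phi is then uniquely determined. *)
Definition is_flow_map (R : realType) (d : nat) (v : 'rV[R]_d -> 'rV[R]_d)
    (tau : R) (phi : 'rV[R]_d -> 'rV[R]_d) : Prop :=
  forall x0 : 'rV[R]_d, exists x : R -> 'rV[R]_d,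
    [/\ x 0 = x0,
        forall t : R, is_derive t 1 x (v (x t)) &
        phi x0 = x tau].

(* The empty composition (the identity) is included; it is also the time-0 flow
   map of any Lipschitz field. *)
Inductive flow_hypothesis (R : realType) (d : nat)
    (F : set ('rV[R]_d -> 'rV[R]_d)) : ('rV[R]_d -> 'rV[R]_d) -> Prop :=
  | flow_hypothesis_id : flow_hypothesis F id
  | flow_hypothesis_comp (f : 'rV[R]_d -> 'rV[R]_d) (tau : R)
      (phi h : 'rV[R]_d -> 'rV[R]_d) :
      F f -> 0 <= tau -> is_flow_map f tau phi ->
      flow_hypothesis F h -> flow_hypothesis F (phi \o h).

Definition affine_fun (R : realType) (V : lmodType R) (u : V -> R) : Prop :=
  exists (l : {scalar V}) (c : R), forall x : V, u x = l x + c.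

Definition nonlinear_fun (R : realType) (V : lmodType R) (u : V -> R) : Prop :=
  ~ affine_fun u.

Definition component (R : realType) (d : nat) (f : 'rV[R]_d -> 'rV[R]_d)
    (i : 'I_d) : 'rV[R]_d -> R :=
  fun x => f x 0 i.

Definition nonlinear_field (R : realType) (d : nat)
    (f : 'rV[R]_d -> 'rV[R]_d) : Prop :=
  exists i : 'I_d, nonlinear_fun (component f i).

Definition coordinate_nonlinear (R : realType) (d : nat)
    (u : 'rV[R]_d -> R) : Prop :=
  forall j : 'I_d, exists b : 'rV[R]_d,
    nonlinear_fun (fun t : R^o => u (t *: delta_mx 0 j + b)).

Definition fully_coordinate_nonlinear (R : realType) (d : nat)
    (f : 'rV[R]_d -> 'rV[R]_d) : Prop :=
  forall i : 'I_d, coordinate_nonlinear (component f i).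

Definition F_aff (R : realType) (d : nat) (f : 'rV[R]_d -> 'rV[R]_d) :
    set ('rV[R]_d -> 'rV[R]_d) :=
  [set g | exists (S W : 'M[R]_d) (b : 'rV[R]_d),
     g = fun x => f (x *m W^T + b) *m S^T].

Definition F_diag (R : realType) (d : nat) (f : 'rV[R]_d -> 'rV[R]_d) :
    set ('rV[R]_d -> 'rV[R]_d) :=
  [set g | exists (D L : 'M[R]_d) (b : 'rV[R]_d),
     [/\ is_diag_mx D, is_diag_mx L &
         g = fun x => f (x *m L^T + b) *m D^T]].

Definition C1_map (R : realType) (d : nat)
    (g : 'rV[R]_d -> 'rV[R]_d) : Prop :=
  (forall x : 'rV[R]_d, differentiable g x) /\ continuous (jacobian g).

(* Diff_0(R^d), for diffeomorphisms of class C^1 *)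
Definition orientation_preserving_diffeo (R : realType) (d : nat)
    (g : 'rV[R]_d -> 'rV[R]_d) : Prop :=
  [/\ C1_map g,
      exists g' : 'rV[R]_d -> 'rV[R]_d,
        [/\ C1_map g', cancel g g' & cancel g' g] &
      forall x : 'rV[R]_d, 0 < \det (jacobian g x)].

Definition UAP (R : realType) (d : nat)
    (F : set ('rV[R]_d -> 'rV[R]_d)) : Prop :=
  forall (Omega : set 'rV[R]_d) (g : 'rV[R]_d -> 'rV[R]_d) (eps : R),
    compact Omega -> orientation_preserving_diffeo g -> 0 < eps ->
    exists h : 'rV[R]_d -> 'rV[R]_d,
      flow_hypothesis F h /\ (forall x, Omega x -> `|g x - h x| <= eps).

(* Pairwise distinct points; in dimension 1, listed in increasing order. *)
Definition admissible_points (R : realType) (d N : nat)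
    (x : 'I_N -> 'rV[R]_d) : Prop :=
  injective x /\
  (d = 1%N -> forall (i j : 'I_N) (k : 'I_d), (i < j)%N -> x i 0 k < x j 0 k).

Definition interpolates_all (R : realType) (d : nat)
    (H : set ('rV[R]_d -> 'rV[R]_d)) : Prop :=
  forall (N : nat) (x y : 'I_N -> 'rV[R]_d), (0 < N)%N ->
    admissible_points x -> admissible_points y ->
    exists phi : 'rV[R]_d -> 'rV[R]_d, H phi /\ (forall i, phi (x i) = y i).

Definition UIP (R : realType) (d : nat)
    (F : set ('rV[R]_d -> 'rV[R]_d)) : Prop :=
  interpolates_all (flow_hypothesis F).

(* Main.v *)
Require Import Defs.
From HB Require Import structures.
From mathcomp Require Import all_boot all_order all_algebra.
From mathcomp Require Import all_classical all_reals all_analysis.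
From mathcomp Require Import ring lra.

(** Both families contain, for all coordinates i and j, fields of the form
    x |-> c s(w x_j + b) e_i with a fixed globally Lipschitz, non-affine
    s : R -> R depending on (i, j) and arbitrary reals c, w, b: for the affine
    family, restrict a non-affine component of f to a line on which it is not
    affine; for the diagonal family, restrict component i of f to a suitable
    line parallel to e_j.  A family with this property is called [ridge_rich]
    below, and both conclusions hold for every such family.

    The one-variable tool is that translates and dilates of s interpolate
    arbitrary values at finitely many distinct points ([ridge_interp]).  A linear
    relation between the numbers s(w t_k + b), valid for all w and b, can be
    thinned out one term at a time by moving (w, b) along a line that keeps one
    argument fixed; what remains says that iterated differences of s vanish, and
    a Lipschitz function with that property is affine.

    On the line, let N points in increasing order move under the flows of the
    fields s(w x + b).  By interpolation N of these fields span all directions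
    in R^N, so the composition of their flows is, as a function of the N times,
    strictly differentiable at 0 with invertible derivative; the contraction
    principle makes orbits open ([local_controllability]), and since the increasing
    N-tuples form a convex set there is only one orbit ([ridge_flows_interp]).
    Flows on the line are increasing maps, so exact interpolation on a fine grid
    is also uniform approximation of any increasing map.

    In dimension at least 2, fields with j <> i have as flows the shears
    x |-> x + g(x_j) e_i, and g can be prescribed at finitely many points.
    Interpolation of N points is then combinatorial: shears make the first
    coordinates distinct, then number the points by their second coordinate,
    then clear the other coordinates ([linked_normal_form]).

    For approximation, call a map approximable if it is a limit, uniformly on
    balls, of elements of the hypothesis space; such maps are closed under
    composition and locally uniform limits.  They contain the increasing maps of one
    coordinate, and the shears with Lipschitz profile: composing s with an
    increasing map turns s into a step function, and steps add up to any
    profile.  Next come the maps x |-> x + q(x) e_k with q small and supported in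
    a slab of x_k ([approximable_perturbation]), by induction on the number of
    coordinates on which q depends.  A map close to the identity is a product of d
    such maps, one for each coordinate, and an invertible linear map with positive
    determinant is a product of transvections and positive dilations.  Finally,
    for a diffeomorphism g with Jacobian J at 0, the isotopy
    g_t(x) = ((g(t x) - g(0)) / t) J^-1 from g_0 = id writes g as an affine map
    after a product of maps close to the identity, since g_s g_t^-1 is close to
    the identity in the Lipschitz sense when s is close to t
    ([approximable_normalized]). *)

Set Implicit Arguments.
Unset Strict Implicit.
Unset Printing Implicit Defensive.

Import Order.TTheory GRing.Theory Num.Theory.
Import numFieldNormedType.Exports.

Local Open Scope classical_set_scope.
Local Open Scope ring_scope.

(** * Functions killed by iterated differences *)

Definition lip (R : realType) (V W : normedModType R) (K : R) (f : V -> W) :=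
  forall x y, `|f x - f y| <= K * `|x - y|.

Lemma lip_pos (R : realType) (V W : normedModType R) (K : R) (f : V -> W) :
  lip K f -> exists2 k : R, 0 < k & lip k f.
Proof.
move=> H; exists (`|K| + 1); first by rewrite ltr_wpDl.
move=> x y; rewrite (le_trans (H x y))// ler_wpM2r// (le_trans (ler_norm _))//.
by rewrite lerDl.
Qed.

Section Differences.
Variable R : realType.
Implicit Types (u : R -> R) (h x : R).

Definition diff_op h u : R -> R := fun x => u (x + h) - u x.

Fixpoint diff_killed (n : nat) u : Prop :=
  if n is m.+1 then forall h, diff_killed m (diff_op h u) else forall x, u x = 0.

Lemma bounded_multiples (a M : R) : (forall n : nat, `|a *+ n| <= M) -> a = 0.
Proof.
move=> H; apply/eqP; apply: contraT => a0.
have M0 : 0 <= M by apply: le_trans (H 0%N).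
have a0' : 0 < `|a| by rewrite normr_gt0.
have := archi_boundP (divr_ge0 M0 (ltW a0')).
set n := Num.bound _ => Hn; have := H n.
rewrite normrMn -mulr_natr leNgt => /negP[].
by rewrite mulrC -ltr_pdivrMr.
Qed.

(** If a bounded u has differences of constant value c along a step h, then
    u(x + j h) - u(x) = j c stays bounded, so c = 0; this lowers the order of
    the differences down to 1. *)
Lemma diff_killed_bounded n u (M : R) : diff_killed n u ->
  (forall x, `|u x| <= M) -> forall h x, u (x + h) = u x.
Proof.
elim: n u M => [|n IH] u M /=; first by move=> H _ h x; rewrite !H.
move=> H uM h x; apply/eqP; rewrite -subr_eq0; apply/eqP.
have dM y : `|diff_op h u y| <= M + M.
  by rewrite /diff_op (le_trans (ler_normB _ _))// lerD.
have inv := IH _ _ (H h) dM.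
have it (j : nat) : u (x + h *+ j) - u x = (diff_op h u x) *+ j.
  elim: j => [|j IHj]; first by rewrite !mulr0n addr0 subrr.
  rewrite [in RHS]mulrSr -IHj -(inv (h *+ j) x) /diff_op mulrSr addrA; ring.
apply: (@bounded_multiples _ (M + M)) => j; rewrite -[X in `|X *+ _|]/(diff_op h u x).
by rewrite -it (le_trans (ler_normB _ _))// lerD.
Qed.

Lemma diff_killed_diff n u h : diff_killed n u -> diff_killed n (diff_op h u).
Proof.
elim: n u h => [|n IH] u h /=; first by move=> H x; rewrite /diff_op !H subrr.
by move=> H h'; apply: IH; apply: H.
Qed.

Lemma diff_killedZ n u (c : R) : c != 0 -> diff_killed n (fun x => c * u x) ->
  diff_killed n u.
Proof.
move=> c0; elim: n u => [|n IH] u /=.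
  by move=> H x; apply/eqP; have /eqP := H x; rewrite mulf_eq0 (negbTE c0).
move=> H h; apply: IH; move: (H h); congr diff_killed.
by apply/funext => x; rewrite /diff_op; ring.
Qed.

(** The defect E(x) = k(x) - x k(1) is additive and vanishes on the integers,
    hence is determined by fractional parts and bounded; a bounded additive
    function is 0. *)
Lemma additive_lip_linear (k : R -> R) (K : R) :
  (forall x y, k (x + y) = k x + k y) -> (forall x, `|k x| <= K * `|x|) ->
  forall x, k x = x * k 1.
Proof.
move=> kD kK x; apply/eqP; rewrite -subr_eq0; apply/eqP.
pose E y := k y - y * k 1; rewrite -/(E x).
have ED y z : E (y + z) = E y + E z by rewrite /E kD; ring.
have E0 : E 0 = 0 by have := ED 0 0; rewrite addr0 => H; lra.
have EMn y n : E (y *+ n) = E y *+ n.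
  elim: n => [|n IH]; first by rewrite !mulr0n.
  by rewrite !mulrS ED IH.
have EN y : E (- y) = - E y by have := ED y (- y); rewrite subrr E0 => H; lra.
have E1 : E 1 = 0 by rewrite /E mul1r subrr.
have Eint (m : int) : E m%:~R = 0.
  by case: m => n; rewrite ?NegzE ?mulrNz ?EN -pmulrn EMn E1 mul0rn ?oppr0.
have Kge y : 0 <= K * `|y| := le_trans (normr_ge0 _) (kK y).
have K0 : 0 <= K by have := Kge 1; rewrite normr1 mulr1.
have EM y : `|E y| <= K + `|k 1|.
  have -> : E y = E (y - (Num.floor y)%:~R) by rewrite ED EN Eint oppr0 addr0.
  set z := y - _; have z1 : `|z| <= 1.
    have /andP[h1 h2] := mem_rg1_floor y.
    by rewrite /z ger0_norm ?subr_ge0// lerBlDr addrC ltW// intrD1.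
  rewrite /E (le_trans (ler_normB _ _))// lerD//.
    by rewrite (le_trans (kK z))// -[leRHS]mulr1 ler_wpM2l.
  by rewrite normrM -[leRHS]mul1r ler_wpM2r.
apply: (@bounded_multiples _ (K + `|k 1|)) => n.
by rewrite -EMn EM.
Qed.

(** A first difference of a Lipschitz function is bounded, so
    [diff_killed_bounded] makes it constant: s - s(0) is additive. *)
Lemma lip_diff_killed_affine n (s : R -> R) (K : R) :
  (forall x y, `|s x - s y| <= K * `|x - y|) -> diff_killed n s ->
  exists a, forall x, s x = x * a + s 0.
Proof.
move=> sK kn.
have inv h x y : diff_op h s x = diff_op h s y.
  have H := @diff_killed_bounded n (diff_op h s) (K * `|h|).
  rewrite -(H _ _ (y - x) x); first by rewrite addrC subrK.
    exact: diff_killed_diff.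
  by move=> z; rewrite /diff_op (le_trans (sK _ _))// addrAC subrr add0r.
exists (s 1 - s 0) => x.
have := @additive_lip_linear (fun x => s x - s 0) K.
move=> /(_ _ _ x)/= <-; first by rewrite subrK.
  move=> {}x y; have := inv y x 0; rewrite /diff_op add0r => H.
  by rewrite -[s (x + y)](subrK (s x)) H; ring.
by move=> {}x; rewrite (le_trans (sK _ _))// subr0.
Qed.

(** Elimination of the terms of a relation.  Replacing (w, b) by
    (w + a, b - a t_m) moves the argument of the k-th term by a (t_k - t_m): the
    term m is unchanged and disappears in the difference of the two relations,
    while every other term is replaced by a difference.  The functions u_k vary
    with k so that the induction can go through. *)
Lemma ridge_sum_killed (I : eqType) (t : I -> R) (ks : seq I) k0 (u : I -> R -> R) :
  (forall m, m \in ks -> t k0 != t m) ->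
  (forall w b, u k0 (w * t k0 + b) + \sum_(k <- ks) u k (w * t k + b) = 0) ->
  diff_killed (size ks) (u k0).
Proof.
elim: ks u => [|m ks IH] u tk H /=.
  by move=> x; have := H 0 x; rewrite big_nil addr0 mul0r add0r.
move=> h; pose s := h / (t k0 - t m).
have tkm : t k0 - t m != 0 by rewrite subr_eq0 tk// mem_head.
have -> : h = s * (t k0 - t m) by rewrite divfK.
apply: (IH (fun k => diff_op (s * (t k - t m)) (u k))).
  by move=> k kk; apply: tk; rewrite inE kk orbT.
move=> w b; have H1 := H (w + s) (b - s * t m); have H2 := H w b.
rewrite !big_cons in H1 H2.
have E k : (w + s) * t k + (b - s * t m) = w * t k + b + s * (t k - t m) by ring.
have S : \sum_(k <- ks) diff_op (s * (t k - t m)) (u k) (w * t k + b) =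
  \sum_(k <- ks) u k ((w + s) * t k + (b - s * t m)) -
  \sum_(k <- ks) u k (w * t k + b).
  by rewrite -sumrB; apply: eq_bigr => k _; rewrite /diff_op E.
rewrite {}S; rewrite /diff_op -E.
rewrite [X in _ + (u m X + _)]E subrr mulr0 addr0 in H1.
set S1 := \sum_(_ <- _) _ in H1 *; set S2 := \sum_(_ <- _) _ in H2 *.
lra.
Qed.

End Differences.

(** * Interpolation by translates and dilates of one function *)

Definition nonaffine (R : realType) (s : R -> R) :=
  ~ exists a c, forall x, s x = x * a + c.

Section Interpolation.
Variables (R : realType) (s : R -> R) (K : R).
Hypothesis s_lip : lip K s.
Hypothesis s_na : nonaffine s.

(** A vector c orthogonal to all samples of s would make s, up to a nonzero
    factor c_k0, killed by N - 1 differences, hence affine. *)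
Lemma ridge_separates N (t : 'I_N -> R) (c : 'cV[R]_N) : injective t ->
  c != 0 -> exists w b, \sum_k s (w * t k + b) * c k 0 != 0.
Proof.
move=> tI c0; apply: contrapT => Hn; apply: s_na.
have [k0 ck0] : exists k, c k 0 != 0.
  apply: contrapT => H; move/eqP: c0; apply; apply/matrixP => k j.
  rewrite ord1 mxE; apply/eqP; apply: contraT => ck; case: H; by exists k.
have H w b : \sum_k s (w * t k + b) * c k 0 = 0.
  by apply/eqP; apply: contraT => h; case: Hn; exists w, b.
have kk : diff_killed (size (rem k0 (index_enum 'I_N))) (fun x => c k0 0 * s x).
  apply: (@ridge_sum_killed _ _ t (rem k0 (index_enum 'I_N)) k0
            (fun k x => c k 0 * s x)).
    move=> m; rewrite mem_rem_uniq ?index_enum_uniq// inE => /andP[/eqP mk _].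
    by apply/eqP => /tI /esym.
  move=> w b; rewrite -[RHS](H w b) [RHS](big_rem k0) ?mem_index_enum//= mulrC.
  by congr (_ + _); apply: eq_bigr => k _; rewrite mulrC.
have [a Ha] := lip_diff_killed_affine s_lip (diff_killedZ ck0 kk).
by exists a, (s 0).
Qed.

(** Rows are added one at a time: as long as the rank is below N, some c <> 0 is
    orthogonal to all rows, and [ridge_separates] gives a sample of s outside
    the span of the rows. *)
Lemma ridge_matrix N (t : 'I_N -> R) : injective t ->
  exists w b : 'I_N -> R, \matrix_(i, k) s (w i * t k + b i) \in unitmx.
Proof.
move=> tI.
suff H r : (r <= N)%N -> exists w b : 'I_r -> R,
    row_free (\matrix_(i < r, k < N) s (w i * t k + b i)).
  by have [w [b]] := H N (leqnn N); exists w, b; rewrite -row_free_unit.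
elim: r => [_|r IH rN].
  exists (fun=> 0), (fun=> 0); rewrite /row_free; set A := \matrix_(_, _) _.
  by rewrite -leqn0 rank_leq_row.
have [w [b]] := IH (ltnW rN); set A := \matrix_(_, _) _ => Afree.
have Ac : exists2 c : 'cV[R]_N, c != 0 & A *m c = 0.
  have : cokermx A != 0.
    rewrite -mxrank_eq0 mxrank_coker (eqP Afree); by rewrite -lt0n subn_gt0.
  move=> /eqP H; have [j Hj] : exists j, col j (cokermx A) != 0.
    apply: contrapT => Hn; apply: H; apply/matrixP => i j; rewrite [RHS]mxE.
    apply/eqP; apply: contraT => h; case: Hn; exists j.
    apply: contra_neq h => /matrixP/(_ i 0).
    by rewrite [LHS]mxE [RHS]mxE.
  by exists (col j (cokermx A)) => //; rewrite colE mulmxA mulmx_coker mul0mx.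
have [c c0 cA] := Ac.
have [w1 [b1 Hw]] := ridge_separates tI c0.
pose ext (f : 'I_r -> R) x (i : 'I_(1 + r)) := 
  match fintype.split i with inl _ => x | inr j => f j end.
exists (ext w w1), (ext b b1).
pose v : 'rV[R]_N := \row_k s (w1 * t k + b1).
have -> : (\matrix_(i < r.+1, k < N) s (ext w w1 i * t k + ext b b1 i)) = col_mx v A.
  apply/matrixP => i k; rewrite mxE /ext [RHS]mxE.
  by case: (fintype.split (i : 'I_(1 + r))) => j /=; rewrite mxE.
have vA : ~~ (v <= A)%MS.
  apply/negP => /submxP[D vD]; move/negP: Hw; apply.
  have : v *m c = 0 by rewrite vD -mulmxA cA mulmx0.
  move=> /matrixP/(_ 0 0); rewrite [RHS]mxE mxE => H; apply/eqP.
  by rewrite -[RHS]H; apply: eq_bigr => k _; rewrite mxE.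
rewrite /row_free; apply/eqP/anti_leq; rewrite rank_leq_row/=.
have : (A < v + A)%MS.
  rewrite ltmxE addsmxSr/=; apply: contra vA; apply: submx_trans; exact: addsmxSl.
by rewrite ltmxErank => /andP[_]; rewrite (eqP Afree) addsmxE.
Qed.

Lemma ridge_interp (ts : seq R) (G : R -> R) : exists n (c w b : 'I_n -> R),
  forall x, x \in ts -> \sum_i c i * s (w i * x + b i) = G x.
Proof.
pose us := undup ts; pose t (i : 'I_(size us)) := us`_i.
have tI : injective t.
  by move=> i j /eqP; rewrite nth_uniq ?undup_uniq// => /eqP/val_inj.
have [w [b Au]] := ridge_matrix tI; set A := \matrix_(_, _) _ in Au.
pose c := (\row_k G (t k)) *m invmx A.
exists (size us), (fun i => c 0 i), w, b => x; rewrite -mem_undup => xus.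
have xi : (index x us < size us)%N by rewrite index_mem.
pose k := Ordinal xi; have <- : t k = x by rewrite /t nth_index.
have : (c *m A) 0 k = G (t k) by rewrite /c mulmxKV// mxE.
by rewrite mxE => <-; apply: eq_bigr => i _; rewrite !mxE.
Qed.

End Interpolation.

(** * Calculus on the real line *)

Section Calculus.
Variable R : realType.
Implicit Types f g : R -> R.

Definition has_derivative f (df : R -> R) := forall t : R, is_derive t 1 f (df t).

Lemma has_derivative_continuous f df : has_derivative f df -> continuous f.
Proof.
move=> H t; apply: differentiable_continuous; apply/derivable1_diffP.
by case: (H t).
Qed.

Lemma has_derivative_mvt f df a b : has_derivative f df ->
  exists c, Num.min a b <= c <= Num.max a b /\ f b - f a = df c * (b - a).
Proof.
move=> H; have C := has_derivative_continuous H.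
wlog ab : a b / a <= b.
  move=> W; have [ab|ab] := orP (le_total a b); first by apply: W.
  have [c [cab E]] := W _ _ ab; exists c; split; first by rewrite minC maxC.
  by rewrite -opprB E; ring.
have [|c] := MVT_segment ab (fun x _ => H x); first exact: continuous_subspaceT.
by rewrite in_itv/= => cab E; exists c; split; rewrite ?(min_l ab)?(max_r ab).
Qed.

Lemma has_derivative_mono f df a b : has_derivative f df ->
  (forall t, a <= t <= b -> 0 <= df t) -> a <= b -> f a <= f b.
Proof.
move=> H H0 ab; have [c [cab E]] := has_derivative_mvt a b H.
rewrite (min_l ab) (max_r ab) in cab.
by rewrite -subr_ge0 E mulr_ge0 ?H0// subr_ge0.
Qed.

Lemma has_derivative_bound f df a b M : has_derivative f df ->
  (forall t, Num.min a b <= t <= Num.max a b -> `|df t| <= M) ->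
  `|f b - f a| <= M * `|b - a|.
Proof.
move=> H HM; have [c [cab ->]] := has_derivative_mvt a b H.
by rewrite normrM ler_wpM2r// HM.
Qed.

Lemma has_derivativeN f df : has_derivative f df ->
  has_derivative (fun t => f (- t)) (fun t => - df (- t)).
Proof.
move=> H t; have H1 := H (- t).
have := @is_derive1_comp R f -%R t _ _ H1 _; move=> /(_ (-1)).
by rewrite mulrN1; apply.
Qed.

Lemma between_le (a b c r : R) : `|a| <= r -> `|b| <= r ->
  Num.min a b <= c <= Num.max a b -> `|c| <= r.
Proof.
rewrite !ler_norml => /andP[a1 a2] /andP[b1 b2] /andP[]; rewrite ge_min le_max.
by move=> /orP[c1|c1] /orP[c2|c2]; apply/andP; split; lra.
Qed.

(** On [-n, n] the integral from -n, normalized at 0, is a primitive; these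
    functions extend one another as n grows. *)
Lemma primitive_exists f : continuous f ->
  exists F, F 0 = 0 /\ has_derivative F f.
Proof.
move=> cf; pose mu := @lebesgue_measure R.
have intf a b : mu.-integrable `[a, b] (EFin \o f).
  apply: continuous_compact_integrable; first exact: segment_compact.
  exact: continuous_subspaceT.
pose I (a x : R) : R := (\int[mu]_(t in `[a, x]) f t)%R.
pose G (n : nat) x := I (- n%:R) x - I (- n%:R) 0.
have GE (n m : nat) (x : R) : (n <= m)%N -> - n%:R <= x -> G n x = G m x.
  move=> nm nx; have nm' : - m%:R <= - n%:R :> R by rewrite lerN2 ler_nat.
  have E (p : nat) y : (n <= p)%N -> - n%:R <= y -> I (- p%:R) y =
      I (- p%:R) (- n%:R) + (\int[mu]_(t in `](- n%:R)%R, y]) f t)%R.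
    move=> np ny; have np' : - p%:R <= - n%:R :> R by rewrite lerN2 ler_nat.
    rewrite -(@Rintegral_itvB R f (BLeft (- p%:R)) (BRight y) (- n%:R)).
    - by rewrite /I; ring.
    - exact: intf.
    - by rewrite bnd_simp.
    - by rewrite bnd_simp.
  have n0 : - n%:R <= 0 :> R by rewrite oppr_le0.
  rewrite /G (E n x)// (E n 0)// (E m x)// (E m 0)//.
  set i1 := I _ _; set i2 := I _ _; set i3 := Rintegral _ _ _.
  set i4 := Rintegral _ _ _; ring.
have dG (n : nat) (x : R) : `|x| < n%:R -> is_derive x 1 (G n) (f x).
  rewrite ltr_norml => /andP[nx xn].
  have [|D E] := @continuous_FTC1_closed R f (- n%:R) x n%:R xn _ nx (cf x).
    exact: intf.
  have D1 : is_derive x 1 (I (- n%:R)) (f x).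
    by apply: DeriveDef; [exact: D|rewrite -derive1E; exact: E].
  have := @is_deriveB _ _ _ (I (- n%:R)) (cst (I (- n%:R) 0)) x 1 _ _ D1 _.
  by move=> /(_ 0 (is_derive_cst _ _ _)); rewrite subr0.
pose F x := G (Num.bound `|x|) x.
exists F; split; first by rewrite /F /G subrr.
move=> x; pose n := (Num.bound `|x|).+1.
have xn : `|x| < n%:R.
  by rewrite (lt_trans (archi_boundP (normr_ge0 x)))// ltr_nat.
apply: (near_eq_is_derive _ (dG n x xn)).
near=> y.
have yn : `|y| < n%:R.
  near: y; apply: (@cvgr_lt _ _ _ _ _ `|x|) => //.
  by apply: cvg_norm; exact: cvg_id.
have By := archi_boundP (normr_ge0 y).
rewrite /F; have [h|/ltnW h] := leqP n (Num.bound `|y|).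
- by apply: GE => //; move: yn; rewrite ltr_norml => /andP[/ltW].
- apply/esym/GE => //; move: By; rewrite ltr_norml => /andP[/ltW//].
Unshelve. all: by end_near. Qed.

Lemma is_derive_expM (a t : R) :
  is_derive t 1 (fun t => expR (a * t)) (a * expR (a * t)).
Proof.
have H : is_derive t 1 (fun t : R => a * t) a.
  have := @is_deriveZ _ _ _ id a t 1 _ (is_derive_id _ _).
  by rewrite /GRing.scale/= mulr1.
have := @is_derive1_comp R expR (fun t => a * t) t _ _ (is_derive_expR _) H.
by rewrite mulrC.
Qed.

Lemma is_derive_sqr f (t d : R) : is_derive t 1 f d ->
  is_derive t 1 (fun t => f t ^+ 2) (2 * f t * d).
Proof.
move=> D; have := is_deriveM D D; set d1 := (X in is_derive _ _ _ X) => H.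
have <- // : d1 = 2 * f t * d by rewrite /d1 /GRing.scale/=; ring.
Qed.

(** The weight exp(a |t|) is reproduced by integration with a gain 1 / a.  This is
    what makes Picard iteration converge on all of R at once. *)
Lemma exp_integral_bound f df (M a : R) : has_derivative f df -> f 0 = 0 ->
  0 < a -> (forall t, `|df t| <= M * expR (a * `|t|)) ->
  forall t, `|f t| <= M / a * expR (a * `|t|).
Proof.
move=> H f0 a0 HM.
have M0 : 0 <= M.
  by have := HM 0; rewrite normr0 mulr0 expR0 mulr1; apply: le_trans.
suff K g dg : has_derivative g dg -> g 0 = 0 ->
    (forall t, `|dg t| <= M * expR (a * `|t|)) ->
    forall t, 0 <= t -> `|g t| <= M / a * expR (a * t).
  move=> t; have [t0|/ltW t0] := leP 0 t.
    by rewrite (ger0_norm t0); exact: (K f df).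
  have := K _ _ (has_derivativeN H) _ _ (- t); rewrite opprK oppr0 (ler0_norm t0).
  apply => //; last by rewrite oppr_ge0.
  by move=> s; rewrite normrN (le_trans (HM _))// normrN.
move=> Hg g0 HM' t t0.
have key (e : R) : `|e| = 1 -> e * g t <= M / a * expR (a * t).
  move=> e1.
  have Hh : has_derivative (fun s => M / a * expR (a * s) - e * g s)
     (fun s => M * expR (a * s) - e * dg s).
    move=> s; have D1 := @is_deriveZ _ _ _ _ (M / a) s 1 _ (is_derive_expM a s).
    have D2 := @is_deriveZ _ _ _ _ e s 1 _ (Hg s).
    have := @is_deriveB _ _ _ _ _ s 1 _ _ D1 D2.
    by rewrite /GRing.scale/= mulrA divfK// gt_eqF.
  have := has_derivative_mono Hh _ t0.
  rewrite g0 !mulr0 subr0 expR0 mulr1 => /(_ _)/(le_trans (divr_ge0 M0 (ltW a0))).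
  rewrite subr_ge0; apply => s /andP[s0 _]; rewrite subr_ge0.
  rewrite (le_trans (ler_norm _))// normrM e1 mul1r (le_trans (HM' _))//.
  by rewrite (ger0_norm s0).
rewrite ler_norml; apply/andP; split; last first.
  by have := key 1; rewrite normr1 mul1r; apply.
by rewrite lerNl; have := key (-1); rewrite normrN1 mulN1r; apply.
Qed.

End Calculus.

(** * Flows of Lipschitz fields on the line *)

Section Picard.
Variable R : realType.
Implicit Types (v : R -> R) (K : R).

Lemma le_of_geometric (a b C : R) : (forall n, a <= b + C / 2 ^+ n) -> a <= b.
Proof.
move=> H; rewrite leNgt; apply/negP => ba.
have C0 : 0 < C.
  rewrite ltNge; apply/negP => C0; have := H 0%N; rewrite expr0 divr1; lra.
have ab0 : 0 < a - b by rewrite subr_gt0.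
have := archi_boundP (divr_ge0 (ltW C0) (ltW ab0)).
set n := Num.bound _ => Hn; have := H n; rewrite -lerBlDl.
have n2 : n%:R <= 2 ^+ n :> R by rewrite -natrX ler_nat ltnW// ltn_expl.
have := lt_le_trans Hn n2; rewrite ltr_pdivrMr// mulrC -ltr_pdivrMr ?exprn_gt0//.
by move=> h1 h2; have := lt_le_trans h1 h2; rewrite ltxx.
Qed.

(** The intervals centred at u_n with radius 2 B / 2^n are nested, so the
    supremum of their left ends lies in all of them. *)
Lemma geometric_limit (u : nat -> R) (B : R) :
  (forall n, `|u n.+1 - u n| <= B / 2 ^+ n) ->
  exists l, forall n, `|u n - l| <= 2 * B / 2 ^+ n.
Proof.
move=> H; pose lo n := u n - 2 * B / 2 ^+ n; pose hi n := u n + 2 * B / 2 ^+ n.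
have E n : 2 * B / 2 ^+ n.+1 = B / 2 ^+ n.
  by rewrite exprS; field; rewrite expf_neq0.
(* The left ends increase and the right ends decrease. *)
have loS n : lo n <= lo n.+1.
  have := H n; rewrite /lo E ler_norml => /andP[h1 h2]; rewrite -mulrA; lra.
have hiS n : hi n.+1 <= hi n.
  have := H n; rewrite /hi E ler_norml => /andP[h1 h2]; rewrite -mulrA; lra.
have lom m n : (m <= n)%N -> lo m <= lo n.
  move=> /subnK <-; elim: (n - m)%N => // k IH; rewrite addSn.
  exact: le_trans IH (loS _).
have him m n : (m <= n)%N -> hi n <= hi m.
  move=> /subnK <-; elim: (n - m)%N => // k IH; rewrite addSn.
  exact: le_trans (hiS _) IH.
have B0 : 0 <= B by have := H 0%N; rewrite expr0 divr1; apply: le_trans.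
have loh n : lo n <= hi n.
  have : 0 <= 2 * B / 2 ^+ n by rewrite divr_ge0// ?exprn_ge0// mulr_ge0.
  rewrite /lo /hi; lra.
have lohi m n : lo m <= hi n.
  rewrite (le_trans (lom _ _ (leq_maxl m n)))// (le_trans (loh _))//.
  exact: him (leq_maxr m n).
pose S := range lo.
have hS : has_sup S.
  by split; [exists (lo 0%N); exists 0%N|exists (hi 0%N) => _ [n _ <-]].
exists (sup S) => n.
have h1 : lo n <= sup S by apply: ub_le_sup; [exact: (proj2 hS)|exists n].
have h2 : sup S <= hi n by apply: ge_sup; [exact: (proj1 hS)|move=> _ [m _ <-]].
rewrite ler_norml; move: h1 h2; rewrite /lo /hi => h1 h2; apply/andP; split; lra.
Qed.

Lemma is_derive_quadratic (f : R -> R) (t d L : R) :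
  (forall h, `|h| <= 1 -> `|f (t + h) - f t - h * d| <= L * h ^+ 2) ->
  is_derive t 1 f d.
Proof.
move=> H.
have L0 : 0 <= L.
  by have := H 1; rewrite normr1 lexx expr1n mulr1 => /(_ isT); apply: le_trans.
have L1 : 0 < L + 1 by lra.
have C : (fun h => h^-1 *: (f (h *: (1 : R) + t) - f t)) @ 0^' --> d.
  apply/cvgrPdist_le => /= e e0; near=> h.
  have h0 : h != 0 by near: h; exact: nbhs_dnbhs_neq.
  have h1 : `|h| <= 1.
    near: h; apply: dnbhs0_le; exact: ltr01.
  have h2 : L * `|h| <= e.
    have : `|h| <= e / (L + 1).
      by near: h; apply: dnbhs0_le; exact: divr_gt0.
    rewrite ler_pdivlMr// => h2.
    rewrite (le_trans _ h2)// mulrC ler_wpM2l//; lra.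
  have := H h h1.
  rewrite /GRing.scale/= mulr1 [h + t]addrC => Hh.
  rewrite distrC; have -> : h^-1 * (f (t + h) - f t) - d =
     h^-1 * (f (t + h) - f t - h * d) by field.
  rewrite normrM normfV ler_pdivrMl ?normr_gt0// (le_trans Hh)//.
  rewrite -[h ^+ 2]ger0_norm ?sqr_ge0// normrX expr2 mulrA mulrC.
  by rewrite ler_wpM2l.
apply: DeriveDef; first by apply/cvg_ex; exists d.
exact: cvg_lim.
Unshelve. all: by end_near. Qed.

Lemma lip_continuous v K : lip K v -> continuous v.
Proof.
move=> H x; apply/cvgrPdist_le => /= e e0; near=> y.
rewrite (le_trans (H _ _))//.
have : `|x - y| <= e / (`|K| + 1).
  near: y; apply/nbhs_ballP; exists (e / (`|K| + 1)) => /=.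
    by rewrite divr_gt0// ltr_wpDl.
  by move=> z; rewrite /ball/= => /ltW.
rewrite ler_pdivlMr ?ltr_wpDl// => h; rewrite (le_trans _ h)// mulrC ler_wpM2l//.
by rewrite (le_trans (ler_norm _))// lerDl.
Unshelve. all: by end_near. Qed.

(** Picard iterates satisfy |X_{n+1} - X_n| <= B(t) / 2^n with
    B(t) proportional to exp(2 k |t|).  The limit is differentiated without
    exchanging limits and integrals: each iterate satisfies the quadratic estimate
    of [is_derive_quadratic] up to an error that tends to 0, with one constant
    for all n. *)
Lemma picard v K (x0 : R) : lip K v ->
  exists x, x 0 = x0 /\ has_derivative x (fun t => v (x t)).
Proof.
move=> vK0.
have [k k0 vK] := lip_pos vK0.
have cv := lip_continuous vK0.
have /choice[P HP] : forall f : {f : R -> R | continuous f},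
    exists F, F 0 = 0 /\ has_derivative F (sval f).
  by case=> f cf; exact: primitive_exists.
have [X [X0 XS cX]] : exists X : nat -> R -> R, [/\ forall t, X 0%N t = x0,
    forall n, X n.+1 0 = x0 /\ has_derivative (X n.+1) (fun t => v (X n t)) &
    forall n, continuous (X n)].
  have cS (f : {f : R -> R | continuous f}) : continuous (fun t => v (sval f t)).
    by move=> t; apply: continuous_comp; [exact: (svalP f)|exact: cv].
  have step (f : {f : R -> R | continuous f}) : exists g : {f : R -> R | continuous f},
    sval g 0 = x0 /\ has_derivative (sval g) (fun t => v (sval f t)).
    have [F0 FD] := HP (exist _ _ (cS f)).
    set F := P _ in F0 FD.
    have D : has_derivative (fun t => x0 + F t) (fun t => v (sval f t)).
      move=> t; have := @is_deriveD _ _ _ (cst x0) F t 1 _ _ (is_derive_cst _ _ _) (FD t).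
      by rewrite add0r.
    by exists (exist _ _ (has_derivative_continuous D)); rewrite /= F0 addr0.
  have [g Hg] := choice step.
  pose f0 : {f : R -> R | continuous f} := exist _ (cst x0) (@cst_continuous _ _ _).
  exists (fun n => sval (iter n g f0)); split => // n; last exact: (svalP (iter n g f0)).
  by have := Hg (iter n g f0).
pose a := 2 * k; have a0 : 0 < a by rewrite mulr_gt0.
pose B (t : R) : R := `|v x0| / a * expR (a * `|t|).
have B0 (t : R) : 0 <= B t by rewrite mulr_ge0 ?expR_ge0// divr_ge0// ltW.
have B2 t : 0 <= 2 * B t by move: (B0 t); lra.
have Xd n t : `|X n.+1 t - X n t| <= B t / 2 ^+ n.
  elim: n t => [|n IH] t.
    rewrite expr0 divr1 X0 /B.
    have [X10 X1D] := XS 0%N.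
    have D : has_derivative (fun t => X 1%N t - x0) (fun t => v (X 0%N t)).
      move=> s; have := @is_deriveB _ _ _ (X 1%N) (cst x0) s 1 _ _ (X1D s) (is_derive_cst _ _ _).
      by rewrite subr0.
    apply: (exp_integral_bound D) => //; first by rewrite X10 subrr.
    by move=> s; rewrite X0 ler_peMr// -expR0 ler_expR mulr_ge0// ltW.
  have [X20 X2D] := XS n.+1; have [X10 X1D] := XS n.
  have D : has_derivative (fun t => X n.+2 t - X n.+1 t)
      (fun t => v (X n.+1 t) - v (X n t)).
    by move=> s; have := @is_deriveB _ _ _ (X n.+2) (X n.+1) s 1 _ _ (X2D s) (X1D s).
  pose M := k * (`|v x0| / a / 2 ^+ n).
  have := exp_integral_bound D _ a0 _ t (M := M).
  move=> H; apply: le_trans (H _ _) _; first by rewrite X20 X10 subrr.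
    move=> s; rewrite (le_trans (vK _ _))// /M -mulrA ler_pM2l//.
    by rewrite (le_trans (IH s))// /B mulrAC.
  rewrite le_eqVlt; apply/orP; left; apply/eqP; rewrite /M /B /a exprS; field.
  by rewrite expf_neq0// gt_eqF.
have /choice[x Hx] : forall t, exists l, forall n, `|X n t - l| <= 2 * B t / 2 ^+ n.
  by move=> t; apply: geometric_limit => n; exact: Xd.
exists x; split.
  have Xn0 n : X n 0 = x0 by case: n => [|n]; [exact: X0|exact: (XS n).1].
  apply/eqP; rewrite eq_sym -subr_eq0 -normr_le0.
  apply: (@le_of_geometric _ _ (2 * B 0)) => n.
  by rewrite add0r -(Xn0 n).
move=> t; pose r : R := `|t| + 1; pose L : R := `|v x0| + k * (4 * B r).
have Br s : `|s| <= r -> B s <= B r.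
  move=> sr; rewrite /B ler_wpM2l ?divr_ge0 ?(ltW a0)// ler_expR ler_pM2l//.
  by rewrite [leRHS]ger0_norm// addr_ge0.
have vL n s : `|s| <= r -> `|v (X n s)| <= L.
  move=> sr; have -> : v (X n s) = v x0 + (v (X n s) - v x0) by ring.
  rewrite (le_trans (ler_normD _ _))// lerD2l (le_trans (vK _ _))// ler_pM2l//.
  have -> : X n s - x0 = (X n s - x s) - (X 0%N s - x s) by rewrite X0; ring.
  rewrite (le_trans (ler_normB _ _))//.
  have h1 : `|X n s - x s| <= 2 * B s.
    rewrite (le_trans (Hx _ _))// ler_pdivrMr ?exprn_gt0// ler_peMr ?B2//.
    by rewrite exprn_ege1// ler1n.
  have h0 : `|X 0%N s - x s| <= 2 * B s by have := Hx s 0%N; rewrite expr0 divr1.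
  have := Br s sr; lra.
have L0 : 0 <= L by apply: le_trans (vL 0%N 0 _); rewrite ?normr0 ?addr_ge0.
have tr : `|t| <= r by rewrite lerDl.
apply: (@is_derive_quadratic _ _ _ (k * L)) => h h1.
have thr : `|t + h| <= r by rewrite (le_trans (ler_normD _ _))// lerD2l.
have key n : `|X n.+2 (t + h) - X n.+2 t - h * v (X n.+1 t)| <= k * L * h ^+ 2.
  have [_ X2D] := XS n.+1; have [_ X1D] := XS n.
  have [c [cb ->]] := has_derivative_mvt t (t + h) X2D.
  have cr := between_le tr thr cb.
  have -> : v (X n.+1 c) * (t + h - t) - h * v (X n.+1 t) =
     h * (v (X n.+1 c) - v (X n.+1 t)) by ring.
  have ch : `|c - t| <= `|h|.
    move: cb; rewrite ge_min le_max => /andP[/orP[c1|c1] /orP[c2|c2]].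
    - have -> : c = t by apply/eqP; rewrite eq_le c1 c2.
      by rewrite subrr normr0.
    - rewrite ger0_norm ?subr_ge0// (le_trans _ (ler_norm _))//; lra.
    - rewrite ler0_norm ?subr_le0// -[leRHS]normrN (le_trans _ (ler_norm _))//; lra.
    - have -> : c - t = h by lra.
      by [].
  have X1L : `|X n.+1 c - X n.+1 t| <= L * `|h|.
    rewrite (le_trans (has_derivative_bound (a := t) (b := c) (M := L) X1D _))//.
      by move=> s sb; apply: vL; exact: between_le tr cr sb.
    by rewrite ler_wpM2l.
  rewrite normrM -[h ^+ 2]ger0_norm ?sqr_ge0// normrX expr2.
  rewrite (le_trans (ler_wpM2l _ (vK _ _)))// (le_trans (ler_wpM2l _ (ler_wpM2l _ X1L)))//.
    by rewrite ltW.
  rewrite le_eqVlt; apply/orP; left; apply/eqP; ring.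
pose C := 2 * B (t + h) + 2 * B t + k * (2 * B t).
apply: (@le_of_geometric _ _ C) => n.
have e m : (n <= m)%N -> (2 : R) ^- m <= 2 ^- n.
  move=> nm; rewrite lef_pV2 ?posrE ?exprn_gt0//; apply: ler_weXn2l => //.
  by rewrite ler1n.
have e2 := e n.+2 (leq_trans (leqnSn _) (leqnSn _)).
have e1 := e n.+1 (leqnSn _).
have b1 : `|X n.+2 (t + h) - x (t + h)| <= 2 * B (t + h) / 2 ^+ n.
  by rewrite (le_trans (Hx _ _))// ler_wpM2l.
have b2 : `|X n.+2 t - x t| <= 2 * B t / 2 ^+ n.
  by rewrite (le_trans (Hx _ _))// ler_wpM2l.
have b3 : `|h * (v (X n.+1 t) - v (x t))| <= k * (2 * B t) / 2 ^+ n.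
  rewrite normrM (le_trans (ler_wpM2r _ h1))// mul1r (le_trans (vK _ _))//.
  by rewrite -mulrA ler_pM2l// (le_trans (Hx _ _))// ler_wpM2l.
have -> : x (t + h) - x t - h * v (x t) =
  (X n.+2 (t + h) - X n.+2 t - h * v (X n.+1 t)) - (X n.+2 (t + h) - x (t + h))
   + (X n.+2 t - x t) + h * (v (X n.+1 t) - v (x t)) by ring.
rewrite (le_trans (ler_normD _ _))// (le_trans (lerD (ler_normD _ _) (lexx _)))//.
rewrite (le_trans (lerD (lerD (ler_normB _ _) (lexx _)) (lexx _)))//.
have := key n; have -> : C / 2 ^+ n = 2 * B (t + h) / 2 ^+ n + 2 * B t / 2 ^+ n
  + k * (2 * B t) / 2 ^+ n by rewrite /C !mulrDl.
lra.
Qed.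

Lemma gronwall (E dE : R -> R) (a : R) : has_derivative E dE ->
  (forall t, `|dE t| <= a * E t) -> forall t, E t <= expR (a * `|t|) * E 0.
Proof.
move=> HE HdE t.
suff K g dg : has_derivative g dg -> (forall t, `|dg t| <= a * g t) ->
    forall t, 0 <= t -> g t <= expR (a * t) * g 0.
  have [t0|t0] := orP (le_total 0 t).
    by rewrite (ger0_norm t0); exact: (K E dE).
  have := K _ _ (has_derivativeN HE) _ (- t); rewrite opprK oppr0 (ler0_norm t0).
  apply; last by rewrite oppr_ge0.
  by move=> s; rewrite normrN.
move=> Hg Hdg {}t t0.
have Hh : has_derivative (fun s => - (expR (- a * s) * g s))
   (fun s => expR (- a * s) * (a * g s - dg s)).
  move=> s; have := @is_deriveM _ _ _ _ s 1 _ _ (is_derive_expM (- a) s) (Hg s).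
  move=> /(@is_deriveN _ _ _ _ s 1).
  set d1 := (X in is_derive _ _ _ X) => D.
  have <- // : d1 = expR (- a * s) * (a * g s - dg s).
  by rewrite /d1 /GRing.scale/=; ring.
have := has_derivative_mono Hh _ t0; rewrite mulr0 expR0 mul1r.
have H0 s : 0 <= s <= t -> 0 <= expR (- a * s) * (a * g s - dg s).
  move=> _; rewrite mulr_ge0 ?expR_ge0// subr_ge0.
  exact: le_trans (ler_norm _) (Hdg s).
move=> /(_ H0); rewrite lerN2 mulNr expRN mulrC ler_pdivrMr ?expR_gt0//.
by rewrite mulrC.
Qed.

(** Gronwall is applied to the square of the difference, which, unlike its
    absolute value, is differentiable. *)
Lemma solution_lip v K (x y : R -> R) : lip K v ->
  has_derivative x (fun t => v (x t)) -> has_derivative y (fun t => v (y t)) ->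
  forall t, `|x t - y t| <= expR (K * `|t|) * `|x 0 - y 0|.
Proof.
move=> vK Hx Hy t.
have HE : has_derivative (fun t => (x t - y t) ^+ 2)
    (fun t => 2 * (x t - y t) * (v (x t) - v (y t))).
  move=> s; have D := @is_deriveB _ _ _ x y s 1 _ _ (Hx s) (Hy s).
  exact: is_derive_sqr D.
have := gronwall HE (a := K + K) _ t.
have -> : (K + K) * `|t| = K * `|t| + K * `|t| by ring.
rewrite expRD -expr2 -exprMn => H.
rewrite -(@ler_pXn2r _ 2) ?nnegrE ?mulr_ge0 ?expR_ge0//.
rewrite exprMn !real_normK ?num_real// -exprMn; apply: H => s.
rewrite !normrM ger0_norm// -[(_ - _) ^+ 2]ger0_norm ?sqr_ge0// normrX expr2.
have := ler_wpM2l (normr_ge0 (x s - y s)) (vK (x s) (y s)); lra.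
Qed.

Definition is_flow v (Phi : R -> R -> R) := forall x, Phi 0 x = x /\
  has_derivative (fun t => Phi t x) (fun t => v (Phi t x)).

Lemma flow_exists v K : lip K v -> exists Phi, is_flow v Phi.
Proof.
move=> vK; have /choice[P HP] := fun x0 => picard x0 vK.
by exists (fun t x => P x t) => x.
Qed.

Section Flow.
Variables (v : R -> R) (K : R) (Phi : R -> R -> R).
Hypotheses (vK : lip K v) (HPhi : is_flow v Phi).

Lemma flow0 x : Phi 0 x = x. Proof. by case: (HPhi x). Qed.

Lemma flow_derivative x : has_derivative (fun t => Phi t x) (fun t => v (Phi t x)).
Proof. by case: (HPhi x). Qed.

Lemma flowD s t x : Phi (s + t) x = Phi t (Phi s x).
Proof.
have H : has_derivative (fun t => Phi (s + t) x) (fun t => v (Phi (s + t) x)).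
  move=> u; have D : is_derive u 1 (fun u : R => s + u) 1.
    by have := is_deriveD (is_derive_cst s u 1) (is_derive_id u 1); rewrite add0r.
  have := @is_derive1_comp R (fun t => Phi t x) _ u _ _ (flow_derivative x (s + u)) D.
  by rewrite mulr1.
have := solution_lip vK H (flow_derivative (Phi s x)) t.
by rewrite addr0 flow0 subrr normr0 mulr0 normr_le0 subr_eq0 => /eqP.
Qed.

Lemma flowK t : cancel (Phi t) (Phi (- t)).
Proof. by move=> x; rewrite -flowD subrr flow0. Qed.

(** Two trajectories never meet, so by the intermediate value theorem they
    never exchange their order. *)
Lemma flow_increasing t x y : x < y -> Phi t x < Phi t y.
Proof.
move=> xy; rewrite ltNge; apply/negP => h.
have C : continuous (fun s => Phi s y - Phi s x).
  move=> s; apply: (@continuousB _ _ _ (fun s => Phi s y) (fun s => Phi s x)).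
    exact: (has_derivative_continuous (flow_derivative y)).
  exact: (has_derivative_continuous (flow_derivative x)).
have ivt a b : a <= b -> Num.min (Phi a y - Phi a x) (Phi b y - Phi b x) <= 0 <=
    Num.max (Phi a y - Phi a x) (Phi b y - Phi b x) -> False.
  move=> ab H; have [|c _ /eqP] := @IVT R (fun s => Phi s y - Phi s x) a b 0 ab _ H; first exact: continuous_subspaceT.
  rewrite subr_eq0 => /eqP E; have := congr1 (Phi (- c)) E.
  by rewrite !flowK => yx; rewrite yx ltxx in xy.
have [t0|t0] := orP (le_total 0 t); apply: (ivt _ _ t0); rewrite !flow0 ge_min le_max !subr_le0 !subr_ge0 h.
  by rewrite orbT ltW.
by rewrite (ltW xy) orbT.
Qed.

(** The flow is the identity plus t v to first order: the first and third
    bounds, one for changes of the initial point and one for changes of the time,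
    together give strict differentiability.  The second follows by applying
    Gronwall to (Phi_t x - x)^2 + v(x)^2. *)
Lemma flow_estimates : exists2 C, 0 <= C &
  [/\ forall t x y, `|t| <= 1 ->
        `|Phi t x - Phi t y - (x - y)| <= C * `|t| * `|x - y|,
      forall t x, `|t| <= 1 -> `|Phi t x - x| <= C * `|v x| * `|t| &
      forall r s t x, r <= 1 -> `|s| <= r -> `|t| <= r ->
        `|Phi t x - Phi s x - (t - s) * v x| <= C * `|v x| * r * `|t - s|].
Proof.
have [k k0 vk] := lip_pos vK.
pose e := expR (2 * k + 1).
have e1 : 1 <= e by rewrite -expR0 ler_expR addr_ge0// mulr_ge0// ltW.
pose C1 : R := 1 + k * e.
have C1p : 0 <= C1 by rewrite addr_ge0// mulr_ge0// ?ltW// (lt_le_trans _ e1).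
have vPhi t x : `|t| <= 1 -> `|v (Phi t x)| <= C1 * `|v x|.
  move=> t1.
  have HE : has_derivative (fun t => (Phi t x - x) ^+ 2 + (v x) ^+ 2)
      (fun t => 2 * (Phi t x - x) * v (Phi t x)).
    move=> s; have D : is_derive s 1 (fun t => Phi t x - x) (v (Phi s x)).
      have := is_deriveB (flow_derivative x s) (is_derive_cst x s 1).
      by rewrite subr0.
    have := is_deriveD (is_derive_sqr D) (is_derive_cst (v x ^+ 2) s 1).
    by rewrite addr0.
  have := gronwall HE (a := 2 * k + 1) _ t; rewrite flow0 subrr expr0n add0r.
  move=> /(_ _)/le_trans H.
  have h1 : `|Phi t x - x| <= e * `|v x|.
    rewrite -(@ler_pXn2r _ 2) ?nnegrE ?mulr_ge0 ?expR_ge0// exprMn.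
    rewrite !real_normK ?num_real//.
    apply: (le_trans (y := (Phi t x - x) ^+ 2 + v x ^+ 2)).
      by rewrite lerDl sqr_ge0.
    apply: H.
      move=> s; rewrite !normrM [`|2|]ger0_norm//.
      have h : `|v (Phi s x)| <= `|v x| + k * `|Phi s x - x|.
        have -> : v (Phi s x) = v x + (v (Phi s x) - v x) by ring.
        by rewrite (le_trans (ler_normD _ _))// lerD2l.
      rewrite -(real_normK (num_real (Phi s x - x))) -(real_normK (num_real (v x))).
      have := ler_wpM2l (normr_ge0 (Phi s x - x)) h.
      have := sqr_ge0 (`|Phi s x - x| - `|v x|).
      have := mulr_ge0 (ltW k0) (sqr_ge0 (`|v x|)).
      nra.
    rewrite ler_wpM2r ?sqr_ge0//.
    apply: (le_trans (y := e)).
      rewrite ler_expR -[leRHS]mulr1 ler_wpM2l//.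
      by rewrite addr_ge0// mulr_ge0// ltW.
    by rewrite expr2 ler_peMl// (le_trans _ e1).
  have -> : v (Phi t x) = v x + (v (Phi t x) - v x) by ring.
  rewrite (le_trans (ler_normD _ _))// /C1 mulrDl mul1r lerD2l.
  by rewrite (le_trans (vk _ _))// -mulrA ler_pM2l.
pose C : R := k * expR k + C1 + k * C1.
have kC1 : 0 <= k * C1 by rewrite mulr_ge0// ltW.
have ke : 0 <= k * expR k by rewrite mulr_ge0 ?expR_ge0// ltW.
have P2 t x : `|t| <= 1 -> `|Phi t x - x| <= C1 * `|v x| * `|t|.
  move=> t1.
  have := has_derivative_bound (a := 0) (b := t) (M := C1 * `|v x|) (flow_derivative x).
  rewrite flow0 subr0; apply => s sb; apply: vPhi.
  by apply: between_le t1 sb; rewrite normr0.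
exists C; first by rewrite /C; lra.
split.
- move=> t x y t1.
  have D : has_derivative (fun t => Phi t x - Phi t y)
       (fun t => v (Phi t x) - v (Phi t y)).
    by move=> s; exact: (is_deriveB (flow_derivative x s) (flow_derivative y s)).
  have := has_derivative_bound (a := 0) (b := t) (M := k * expR k * `|x - y|) D.
  rewrite !flow0 subr0 => H; apply: le_trans (H _) _.
    move=> s sb; rewrite (le_trans (vk _ _))// -mulrA ler_pM2l//.
    have s1 : `|s| <= 1 by apply: between_le t1 sb; rewrite normr0.
    have := solution_lip vk (flow_derivative x) (flow_derivative y) s.
    rewrite !flow0 => /le_trans; apply.
    by rewrite ler_wpM2r// ler_expR -[leRHS]mulr1 ler_pM2l.
  rewrite mulrAC ler_wpM2r// ler_wpM2r// /C; lra.
- move=> t x t1; rewrite (le_trans (P2 _ _ t1))// ler_wpM2r// ler_wpM2r// /C; lra.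
- move=> r s t x r1 sr tr.
  have D : has_derivative (fun t => Phi t x - t * v x) (fun t => v (Phi t x) - v x).
    move=> u; have := is_deriveB (flow_derivative x u)
      (@is_deriveM _ _ id (cst (v x)) u 1 _ _ (is_derive_id _ _) (is_derive_cst _ _ _)).
    by rewrite /GRing.scale/= mulr0 add0r mulr1.
  have := has_derivative_bound (a := s) (b := t) (M := k * (C1 * `|v x| * r)) D.
  have -> : Phi t x - t * v x - (Phi s x - s * v x) = Phi t x - Phi s x - (t - s) * v x.
    by ring.
  move=> H; apply: le_trans (H _) _.
    move=> u ub; have ur := between_le sr tr ub.
    rewrite (le_trans (vk _ _))// ler_pM2l// (le_trans (P2 _ _ (le_trans ur r1)))//.
    by rewrite ler_wpM2l// mulr_ge0.
  have r0 : 0 <= r by exact: le_trans sr.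
  have -> : k * (C1 * `|v x| * r) = k * C1 * `|v x| * r by ring.
  rewrite ler_wpM2r// ler_wpM2r// ler_wpM2r// /C; lra.
Qed.

End Flow.
End Picard.

(** * Row vectors *)

HB.instance Definition _ (R : realType) (m n : nat) :=
  Uniform_isComplete.Build 'M[R]_(m, n) cauchy_cvg.

Section RowVectors.
Variable R : realType.

Lemma rv_norm_ge n (x : 'rV[R]_n) k : `|x 0 k| <= `|x|.
Proof. by rewrite [leRHS]mx_normrE (le_bigmax _ _ (0, k)). Qed.

Lemma rv_norm_le n (x : 'rV[R]_n) e : 0 <= e -> (forall k, `|x 0 k| <= e) ->
  `|x| <= e.
Proof.
move=> e0 H; rewrite [leLHS]mx_normrE; apply: bigmax_le => // -[i k] _ /=.
by rewrite ord1.
Qed.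

Lemma rv_dist_ge n (x y : 'rV[R]_n) k : `|x 0 k - y 0 k| <= `|x - y|.
Proof. by have := rv_norm_ge (x - y) k; rewrite !mxE. Qed.

Lemma mulmx_norm n m (z : 'rV[R]_n) (A : 'M[R]_(n, m)) :
  `|z *m A| <= n%:R * `|A| * `|z|.
Proof.
apply: rv_norm_le => [|k]; first by rewrite !mulr_ge0.
rewrite mxE (le_trans (ler_norm_sum _ _ _))//.
apply: (le_trans (y := \sum_(i < n) `|A| * `|z|)).
  apply: ler_sum => i _; rewrite normrM mulrC ler_pM// ?rv_norm_ge//.
  by rewrite [leRHS]mx_normrE (le_bigmax _ _ (i, k)).
by rewrite sumr_const card_ord -[(_ * _) *+ _]mulr_natl mulrA.
Qed.

Lemma banach_fixpoint n (U : set 'rV[R]_n) (G : 'rV[R]_n -> 'rV[R]_n) (q : R) :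
  0 <= q < 1 -> closed U -> U !=set0 -> (forall x, U x -> U (G x)) ->
  (forall x y, U x -> U y -> `|G x - G y| <= q * `|x - y|) ->
  exists2 p, U p & G p = p.
Proof.
move=> /andP[q0 q1] cU U0 GU Gq.
have ctr : is_contraction (mkfun_fun GU).
  by exists (NngNum q0); split=> //= -[x y] [/= Ux Uy]; exact: Gq.
have [p Up pE] := @banach_fixed_point R 'rV[R]_n U (mkfun_fun GU) ctr cU U0.
by exists p.
Qed.

Lemma closed_norm_le n (r : R) : closed [set x : 'rV[R]_n | `|x| <= r].
Proof.
have -> : [set x : 'rV[R]_n | `|x| <= r] = (fun x => `|x|) @^-1` [set y | y <= r] by [].
by apply: closed_comp; [move=> x _; exact: norm_continuous|exact: closed_le].
Qed.

End RowVectors.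

(** * Interpolation on the line by flows *)

Section Controllability.
Variable R : realType.
Implicit Types (s : R -> R).

Fixpoint flow_chain (Phi : nat -> R -> R -> R) (t : nat -> R) n x :=
  if n is m.+1 then Phi m (t m) (flow_chain Phi t m x) else x.

Lemma flow_chain0 (v : nat -> R -> R) Phi t : (forall i, is_flow (v i) (Phi i)) ->
  (forall i, t i = 0) -> forall n x, flow_chain Phi t n x = x.
Proof.
by move=> HPhi t0; elim=> [//|n IH] x /=; rewrite IH t0 (flow0 (HPhi n)).
Qed.

(** Strict differentiability at 0 of the endpoint as a function of the times
    t_0, ..., t_{n-1}, with partial derivatives v_i(x).  The error carries both
    the radius r and the distance d between the two time vectors, which is what the
    contraction principle needs.  The other two bounds are there for the induction. *)
Lemma flow_chain_strict_diff (v : nat -> R -> R) (K : nat -> R) Phi :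
  (forall i, lip (K i) (v i)) -> (forall i, is_flow (v i) (Phi i)) ->
  forall n x, exists2 C : R, 0 <= C & forall (r d : R) (t s : nat -> R), r <= 1 -> 0 <= r ->
    (forall i, (i < n)%N -> [/\ `|t i| <= r, `|s i| <= r & `|t i - s i| <= d]) ->
    [/\ `|flow_chain Phi t n x - flow_chain Phi s n x
          - \sum_(i < n) (t i - s i) * v i x| <= C * r * d,
        `|flow_chain Phi t n x - flow_chain Phi s n x| <= C * d &
        `|flow_chain Phi t n x - x| <= C * r].
Proof.
move=> vK HPhi; elim=> [|n IH] x.
  exists 0 => // r d t s _ _ _ /=.
  by rewrite big_ord0 !subrr normr0 !mul0r.
have [C C0 HC] := IH x.
have [c c0 [e1 e2 e3]] := flow_estimates (vK n) (HPhi n).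
pose k : R := `|K n|; have k0 : 0 <= k := normr_ge0 _.
have vk y z : `|v n y - v n z| <= k * `|y - z|.
  by rewrite (le_trans (vK n y z))// ler_wpM2r// ler_norm.
pose V : R := `|v n x| + k * C.
have V0 : 0 <= V by rewrite addr_ge0// mulr_ge0.
have cC : 0 <= c * C by rewrite mulr_ge0.
have cV : 0 <= c * V by rewrite mulr_ge0.
have kC : 0 <= k * C by rewrite mulr_ge0.
exists (c * C + C + c * V + k * C + V); first by lra.
move=> r d t s r1 r0 H /=.
have [tr sr tsd] := H n (ltnSn n).
have d0 : 0 <= d by apply: le_trans tsd.
have [A1 A2 A3] := HC r d t s r1 r0 (fun i h => H i (leqW h)).
have [_ _ A4] := HC r r s (fun=> 0) r1 r0 (fun i h =>
   let: And3 _ h2 _ := H i (leqW h) in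
   And3 h2 (eq_ind_r (fun z => z <= r) r0 (normr0 _))
     (eq_ind_r (fun z => `|z| <= r) h2 (subr0 (s i)))).
set a := flow_chain Phi t n x in A1 A2 A3 *.
set b := flow_chain Phi s n x in A1 A2 A4 *.
rewrite big_ord_recr/=; set S := \sum_(_ < _) _ in A1 *.
set tau := t n in tr tsd *; set sig := s n in sr tsd *.
have tr1 := le_trans tr r1; have sr1 := le_trans sr r1.
have Cr : C * r <= C by rewrite ler_piMr.
have vb y : `|y - x| <= C * r -> `|v n y| <= V.
  move=> yx; have -> : v n y = v n x + (v n y - v n x) by ring.
  rewrite (le_trans (ler_normD _ _))// lerD2l (le_trans (vk _ _))//.
  by rewrite ler_wpM2l// (le_trans yx).
have E1 : `|Phi n tau a - Phi n tau b - (a - b)| <= c * C * r * d.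
  rewrite (le_trans (e1 _ _ _ tr1))//.
  have -> : c * C * r * d = c * r * (C * d) by ring.
  by rewrite ler_pM// ?mulr_ge0// ler_wpM2l.
have rd0 : 0 <= r * d by rewrite mulr_ge0.
have E3 : `|Phi n tau b - Phi n sig b - (tau - sig) * v n b| <= c * V * r * d.
  rewrite (le_trans (e3 _ _ _ b r1 sr tr))//.
  by rewrite ler_pM// ?mulr_ge0// ler_wpM2r// ler_wpM2l// vb.
have E4 : `|(tau - sig) * (v n b - v n x)| <= k * C * r * d.
  rewrite normrM mulrC ler_pM// (le_trans (vk _ _))// -mulrA ler_wpM2l//.
have E5 : `|(tau - sig) * v n b| <= V * d.
  by rewrite normrM mulrC ler_pM// vb.
have rd : forall z, 0 <= z -> z * r * d <= z * d.
  by move=> z z0; rewrite ler_wpM2r// ler_piMr.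
split.
- have -> : Phi n tau a - Phi n sig b - (S + (tau - sig) * v n x) =
    (Phi n tau a - Phi n tau b - (a - b)) + (a - b - S) +
    (Phi n tau b - Phi n sig b - (tau - sig) * v n b) +
    (tau - sig) * (v n b - v n x) by ring.
  rewrite (le_trans (ler_normD _ _))//.
  rewrite (le_trans (lerD (ler_normD _ _) (lexx _)))//.
  rewrite (le_trans (lerD (lerD (ler_normD _ _) (lexx _)) (lexx _)))//.
  have := mulr_ge0 V0 rd0.
  set z1 := `|_| in E1 *; set z2 := `|_| in A1 *; set z3 := `|_| in E3 *; set z4 := `|_| in E4 *.
  clearbody z1 z2 z3 z4; nra.
- have -> : Phi n tau a - Phi n sig b =
    (Phi n tau a - Phi n tau b - (a - b)) + (a - b) +
    (Phi n tau b - Phi n sig b - (tau - sig) * v n b) +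
    (tau - sig) * v n b by ring.
  rewrite (le_trans (ler_normD _ _))//.
  rewrite (le_trans (lerD (ler_normD _ _) (lexx _)))//.
  rewrite (le_trans (lerD (lerD (ler_normD _ _) (lexx _)) (lexx _)))//.
  have := mulr_ge0 kC d0; have := rd _ cC; have := rd _ cV.
  set z1 := `|_| in E1 *; set z2 := `|_| in A2 *; set z3 := `|_| in E3 *; set z4 := `|_| in E5 *.
  clearbody z1 z2 z3 z4; lra.
- have -> : Phi n tau a - x = (Phi n tau a - a) + (a - x) by ring.
  rewrite (le_trans (ler_normD _ _))//.
  have h : `|Phi n tau a - a| <= c * V * r.
    by rewrite (le_trans (e2 _ _ tr1))// ler_pM// ?mulr_ge0// ler_wpM2l// vb.
  have := mulr_ge0 kC r0; have := mulr_ge0 V0 r0; have := mulr_ge0 cC r0; lra.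
Qed.

(** Negative times are allowed: they are flows of the opposite field, and they make
    this monoid a group. *)
Inductive ridge_flows s : (R -> R) -> Prop :=
| ridge_flows_id : ridge_flows s id
| ridge_flows_flow w b t Phi h : is_flow (fun x => s (w * x + b)) Phi -> ridge_flows s h ->
    ridge_flows s (Phi t \o h).

Lemma ridge_flows_comp s f g : ridge_flows s f -> ridge_flows s g -> ridge_flows s (f \o g).
Proof. by elim=> [//|w b t Phi h HPhi _ IH Hg]; exact: ridge_flows_flow (IH Hg). Qed.

Section Lipschitz.
Variables (s : R -> R) (K : R).
Hypothesis sK : lip K s.

Lemma ridge_lip w b : lip (K * `|w|) (fun x => s (w * x + b)).
Proof.
move=> x y; rewrite (le_trans (sK _ _))// -mulrA -normrM.
by have -> : w * x + b - (w * y + b) = w * (x - y) by ring.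
Qed.

Lemma ridge_flows_inv h : ridge_flows s h -> exists h', [/\ ridge_flows s h', cancel h h' & cancel h' h].
Proof.
elim=> [|w b t Phi {}h HPhi _ [h' [Hh' hh' h'h]]]; first by exists id; split=> //; exact: ridge_flows_id.
have K1 := flowK (ridge_lip w b) HPhi t.
have K2 : cancel (Phi (- t)) (Phi t).
  by move=> x; have := flowK (ridge_lip w b) HPhi (- t) x; rewrite opprK.
exists (h' \o Phi (- t)); split.
- by apply: ridge_flows_comp => //; exact: (ridge_flows_flow (- t) HPhi (ridge_flows_id s)).
- by move=> x /=; rewrite K1 hh'.
- by move=> x /=; rewrite h'h K2.
Qed.

Lemma ridge_flows_homo_lt h : ridge_flows s h -> {homo h : x y / x < y}.
Proof.
elim=> [//|w b t Phi {}h HPhi _ IH] x y xy /=.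
by apply: (flow_increasing (ridge_lip w b) HPhi); exact: IH.
Qed.

Lemma ridge_flows_homo_le h : ridge_flows s h -> {homo h : x y / x <= y}.
Proof.
move=> Hh x y; rewrite le_eqVlt => /orP[/eqP -> //|xy].
by rewrite ltW// ridge_flows_homo_lt.
Qed.

(** A quantitative inverse function theorem for functions that are strictly
    differentiable at one point only: Newton's map with the derivative frozen at 0
    is a contraction. *)
Lemma local_controllability (s_na : nonaffine s) N (x : 'I_N -> R) : injective x ->
  exists2 rho : R, 0 < rho & forall y, (forall k, `|y k - x k| <= rho) ->
    exists2 h, ridge_flows s h & forall k, h (x k) = y k.
Proof.
move=> xI; have [w [b Au]] := ridge_matrix sK s_na xI.
set A := \matrix_(_, _) _ in Au.
pose ext (f : 'I_N -> R) (i : nat) := oapp f 0 (insub i).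
have extE f (i : 'I_N) : ext f i = f i by rewrite /ext valK.
pose v i z := s (ext w i * z + ext b i).
have vK i : lip (K * `|ext w i|) (v i) by exact: ridge_lip.
have /choice[Phi HPhi] i := flow_exists (vK i).
have /choice[C HC] k : exists C : R, 0 <= C /\ forall (r d : R) (t s : nat -> R), r <= 1 -> 0 <= r ->
    (forall i, (i < N)%N -> [/\ `|t i| <= r, `|s i| <= r & `|t i - s i| <= d]) ->
    [/\ `|flow_chain Phi t N (x k) - flow_chain Phi s N (x k)
          - \sum_(i < N) (t i - s i) * v i (x k)| <= C * r * d,
        `|flow_chain Phi t N (x k) - flow_chain Phi s N (x k)| <= C * d &
        `|flow_chain Phi t N (x k) - x k| <= C * r].
  by have [C C0 H] := flow_chain_strict_diff vK HPhi N (x k); exists C.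
pose D := \sum_k C k.
have CD k : C k <= D.
  by rewrite /D (bigD1 k)//= lerDl; apply: sumr_ge0 => j _; case: (HC j).
have D0 : 0 <= D by apply: sumr_ge0 => j _; case: (HC j).
pose c : R := N%:R * `|invmx A|; have c0 : 0 <= c by rewrite mulr_ge0.
have Hc z : `|z *m invmx A| <= c * `|z| := mulmx_norm z (invmx A).
pose r : R := (1 + 2 * (c * D))^-1.
have cD0 : 0 <= c * D by rewrite mulr_ge0.
have r0 : 0 < r by rewrite invr_gt0; lra.
have r1 : r <= 1 by rewrite invf_le1; lra.
have cDr : c * D * r <= 2^-1.
  by rewrite /r ler_pdivrMr; lra.
pose F (t : 'rV[R]_N) : 'rV[R]_N := \row_k flow_chain Phi (ext (t 0)) N (x k).
have FE t u : `|t| <= r -> `|u| <= r -> `|(t - u) *m A - (F t - F u)| <= D * r * `|t - u|.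
  move=> tr ur; apply: rv_norm_le => [|k]; first by rewrite !mulr_ge0// ltW.
  have [_ Hk] := HC k.
  have [|E _ _] := Hk r `|t - u| (ext (t 0)) (ext (u 0)) r1 (ltW r0).
    move=> i iN; have -> : i = val (Ordinal iN) by []; rewrite !extE; split.
    - exact: le_trans (rv_norm_ge _ _) tr.
    - exact: le_trans (rv_norm_ge _ _) ur.
    - by have := rv_norm_ge (t - u) (Ordinal iN); rewrite !mxE.
  apply: (le_trans (y := C k * r * `|t - u|)); last by rewrite ler_wpM2r// ler_wpM2r// ltW.
  rewrite -normrN; move: E; congr (`|_| <= _); rewrite !mxE opprB; congr (_ - _).
  by apply: eq_bigr => i _; rewrite !extE !mxE /v !extE.
pose rho : R := r / (2 * (c + 1)).
have c1 : 0 < 2 * (c + 1) by lra.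
exists rho; first by rewrite divr_gt0.
move=> y yx; pose Y : 'rV[R]_N := \row_k y k.
(* Newton's map for F t = Y; A is the derivative of F at 0. *)
pose G (t : 'rV[R]_N) := t - (F t - Y) *m invmx A.
have GG t u : `|t| <= r -> `|u| <= r -> `|G t - G u| <= 2^-1 * `|t - u|.
  move=> tr ur; have -> : G t - G u = ((t - u) *m A - (F t - F u)) *m invmx A.
    rewrite mulmxBl mulmxK// /G !mulmxBl.
    set a1 := F t *m _; set a2 := F u *m _; set a3 := Y *m _.
    by apply/matrixP => i j; rewrite !mxE; ring.
  rewrite (le_trans (Hc _))// (le_trans (ler_wpM2l c0 (FE _ _ tr ur)))//.
  by rewrite !mulrA ler_wpM2r.
have F0 : F 0 = \row_k x k.
  apply/matrixP => i k; rewrite !mxE; apply: flow_chain0 HPhi _ _ _ => j.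
  by rewrite /ext; case: insub => //= ?; rewrite mxE.
have [t tr tE] : exists2 t, `|t| <= r & G t = t.
  apply: (@banach_fixpoint _ _ [set t | `|t| <= r] G 2^-1).
  - lra.
  - exact: closed_norm_le.
  - by exists 0; rewrite /= normr0 ltW.
  - move=> t /= tr; have -> : G t = (G t - G 0) + G 0 by rewrite subrK.
    rewrite (le_trans (ler_normD _ _))//.
    have h0 : `|(0 : 'rV[R]_N)| <= r by rewrite normr0 ltW.
    have := GG _ _ tr h0; rewrite subr0 => h1.
    have h2 : `|G 0| <= c * rho.
      rewrite /G sub0r normrN (le_trans (Hc _))// ler_wpM2l//.
      apply: rv_norm_le => [|k]; first by rewrite divr_ge0// ltW.
      by rewrite F0 !mxE distrC.
    have h3 : c * rho <= r / 2.
      rewrite /rho mulrA ler_pdivrMr// ; nra.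
    lra.
  - by move=> t u /= tr ur; exact: GG.
have FY : F t = Y.
  have : (F t - Y) *m invmx A = 0.
    by move: tE; rewrite /G => /eqP; rewrite subr_eq addrC -subr_eq subrr => /eqP.
  move=> /(congr1 (mulmx^~ A)); rewrite mulmxKV// mul0mx => /eqP.
  by rewrite subr_eq0 => /eqP.
exists (flow_chain Phi (ext (t 0)) N); last first.
  by move=> k; move: FY => /matrixP/(_ 0 k); rewrite !mxE.
have : forall m, ridge_flows s (flow_chain Phi (ext (t 0)) m); last exact.
elim=> [|n IH]; first exact: ridge_flows_id.
exact: (ridge_flows_flow _ (HPhi n) IH).
Qed.

End Lipschitz.
End Controllability.

(** Connectedness of [0, 1] for a property whose truth is locally constant. *)
Lemma segment_induction (R : realType) (P : R -> Prop) : P 0 ->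
  (forall c, 0 <= c <= 1 -> exists2 d : R, 0 < d & forall t, 0 <= t <= 1 ->
     `|t - c| <= d -> (P t <-> P c)) -> P 1.
Proof.
move=> P0 H; pose S := [set t | 0 <= t <= 1 /\ P t].
have S0 : S 0 by rewrite /S/= lexx ler01.
have hS : has_sup S by split; [exists 0|exists 1 => t [/andP[_ ?] _]].
pose c := sup S.
have c0 : 0 <= c by apply: ub_le_sup => //; exact: hS.2.
have c1 : c <= 1 by apply: ge_sup; [exact: hS.1|move=> t [/andP[_ ?] _]].
have c01 : 0 <= c <= 1 by rewrite c0 c1.
have [d d0 Hd] := H c c01.
have Pc : P c.
  have [t St ct] := sup_adherent d0 hS.
  have tc : t <= c by apply: ub_le_sup => //; exact: hS.2.
  have [t01 Pt] := St; apply/(Hd t) => //.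
  by rewrite ler0_norm ?subr_le0//; rewrite -/c in ct; lra.
have [c1'|c1'] := leP 1 c.
  by have <- : c = 1 by apply/eqP; rewrite eq_le c1 c1'.
pose t := Num.min 1 (c + d).
have ct : c < t by rewrite /t lt_min c1'/=; lra.
have t1 : t <= 1 by rewrite /t ge_min lexx.
have tcd : t <= c + d by rewrite /t ge_min lexx orbT.
have t01 : 0 <= t <= 1 by rewrite t1 andbT; lra.
have Pt : P t.
  apply/Hd => //; rewrite ger0_norm ?subr_ge0 ?(ltW ct)//; lra.
have : t <= c by apply: ub_le_sup => //; exact: hS.2.
by rewrite leNgt ct.
Qed.

(** The set of times at which the segment from x to y meets the orbit of x is open and
    closed, as all orbits are open by [local_controllability]. *)
Lemma ridge_flows_interp (R : realType) (s : R -> R) (K : R) N (x y : 'I_N -> R) :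
  lip K s -> nonaffine s ->
  (forall i j : 'I_N, (i < j)%N -> x i < x j) ->
  (forall i j : 'I_N, (i < j)%N -> y i < y j) ->
  exists2 h, ridge_flows s h & forall k, h (x k) = y k.
Proof.
move=> sK s_na xi yi.
(* Increasing tuples form a convex set. *)
pose Z (t : R) k := (1 - t) * x k + t * y k.
have Zi t : 0 <= t <= 1 -> injective (Z t).
  move=> /andP[t0 t1].
  have lt (i j : 'I_N) : (i < j)%N -> Z t i < Z t j.
    move=> ij; have hx := xi _ _ ij; have hy := yi _ _ ij; rewrite /Z.
    move: t0; rewrite le_eqVlt => /orP[/eqP <-|t0]; first lra.
    have h1 : t * y i < t * y j by rewrite ltr_pM2l.
    have h2 : (1 - t) * x i <= (1 - t) * x j by rewrite ler_wpM2l ?subr_ge0// ltW.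
    lra.
  move=> i j E; apply/val_inj; case: (ltngtP i j) => // ij.
    by have := lt _ _ ij; rewrite E ltxx.
  by have := lt _ _ ij; rewrite E ltxx.
pose P t := exists2 h, ridge_flows s h & forall k, h (x k) = Z t k.
suff [h Hh E] : P 1 by exists h => // k; rewrite E /Z; ring.
apply: segment_induction.
  by exists id; [exact: ridge_flows_id|move=> k; rewrite /Z; ring].
move=> c c01; have [rho rho0 Hrho] := local_controllability sK s_na (Zi c c01).
pose M : R := \sum_k `|y k - x k| + 1.
have Mk k : `|y k - x k| <= M.
  rewrite /M (bigD1 k)//= -addrA lerDl addr_ge0//.
  by apply: sumr_ge0.
have M0 : 0 < M by rewrite ltr_wpDl//; apply: sumr_ge0.
exists (rho / M); first by rewrite divr_gt0.
move=> t t01; rewrite ler_pdivlMr// => tc.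
have [k|g Hg gE] := Hrho (Z t).
  have -> : Z t k - Z c k = (t - c) * (y k - x k) by rewrite /Z; ring.
  by rewrite normrM (le_trans _ tc)// ler_wpM2l.
have [g' [Hg' gg' _]] := ridge_flows_inv sK Hg.
split=> [[h Hh E]|[h Hh E]].
  exists (g' \o h); first exact: ridge_flows_comp.
  by move=> k /=; rewrite E -gE gg'.
exists (g \o h); first exact: ridge_flows_comp.
by move=> k /=; rewrite E gE.
Qed.

(** * Flows that move one coordinate *)

Section Push.
Variables (R : realType) (d : nat).
Implicit Types (x : 'rV[R]_d) (i j k : 'I_d) (F : set ('rV[R]_d -> 'rV[R]_d)).

(** All the maps below that change a single coordinate have this form. *)
Definition push k (q : 'rV[R]_d -> R) x : 'rV[R]_d := x + q x *: delta_mx 0 k.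

Lemma pushE k q x j : push k q x 0 j = x 0 j + q x *+ (j == k).
Proof. by rewrite /push !mxE eqxx/= mulr_natr eq_sym. Qed.

Lemma push_ne k q x j : j != k -> push k q x 0 j = x 0 j.
Proof. by move=> /negbTE jk; rewrite pushE jk mulr0n addr0. Qed.

Lemma push_eq k q x : push k q x 0 k = x 0 k + q x.
Proof. by rewrite pushE eqxx. Qed.

Lemma push_push k q1 q2 x : push k q1 (push k q2 x) = push k (fun x => q2 x + q1 (push k q2 x)) x.
Proof. by rewrite /push scalerDl addrA. Qed.

Lemma is_derive_along (x0 e : 'rV[R]_d) (c : R -> R) (t dc : R) :
  is_derive t 1 c dc -> is_derive t 1 (fun t => x0 + c t *: e) (dc *: e).
Proof.
move=> [Dc Ec].
have D1 : differentiable c t by apply/derivable1_diffP.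
have D2 : differentiable (fun t => c t *: e) t by exact: differentiableZl.
have H : is_derive t 1 (fun t => c t *: e) (dc *: e).
  apply: DeriveDef; first exact: diff_derivable.
  by rewrite deriveE// diffZl//= -deriveE// Ec.
by have := is_deriveD (is_derive_cst x0 t 1) H; rewrite add0r.
Qed.

Lemma flow_hypothesis_trans F f g : flow_hypothesis F f -> flow_hypothesis F g ->
  flow_hypothesis F (f \o g).
Proof.
move=> Hf Hg; elim: Hf => // v tau phi h Fv tau0 Hphi _ IH.
exact: (flow_hypothesis_comp Fv tau0 Hphi IH).
Qed.

Lemma flow_hypothesis_flow F v phi : F v -> is_flow_map v 1 phi -> flow_hypothesis F phi.
Proof.
move=> Fv Hphi.
exact: (flow_hypothesis_comp Fv ler01 Hphi (flow_hypothesis_id F)).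
Qed.

Definition ridge_fields F i j (s : R -> R) := forall c w b : R,
  F (fun x => (c * s (w * x 0 j + b)) *: delta_mx 0 i).

(** A flow on the line acts on coordinate i alone, as the flow of a field along e_i that
    depends only on x_i. *)
Lemma ridge_flows_lift F i s h : ridge_fields F i i s -> ridge_flows s h ->
  flow_hypothesis F (push i (fun x => h (x 0 i) - x 0 i)).
Proof.
move=> Fs; elim=> [|w b t Phi {}h HPhi _ IH].
  have -> : push i (fun x => id (x 0 i) - x 0 i) = id.
    by apply/funext => x; rewrite /push subrr scale0r addr0.
  exact: flow_hypothesis_id.
have -> : push i (fun x => (Phi t \o h) (x 0 i) - x 0 i) =
    push i (fun x => Phi t (x 0 i) - x 0 i) \o push i (fun x => h (x 0 i) - x 0 i).
  apply/funext => x /=; rewrite push_push; apply/rowP => j; rewrite !pushE.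
  have -> : x 0 i + (h (x 0 i) - x 0 i) *+ (i == i) = h (x 0 i).
    by rewrite eqxx mulr1n; ring.
  by congr (_ + _ *+ _); rewrite /=; ring.
apply: flow_hypothesis_trans IH; apply: flow_hypothesis_flow (Fs t w b) _.
move=> x0; exists (fun u => x0 + (Phi (u * t) (x0 0 i) - x0 0 i) *: delta_mx 0 i).
split; last by rewrite mul1r.
  by rewrite mul0r (flow0 HPhi) subrr scale0r addr0.
move=> u; apply: is_derive_along.
have D1 : is_derive u 1 (fun u => u * t) t.
  have := @is_deriveM _ _ id (cst t) u 1 _ _ (is_derive_id u 1) (is_derive_cst t u 1).
  by rewrite /GRing.scale/= mulr0 add0r mulr1.
have := @is_derive1_comp R (fun t => Phi t (x0 0 i)) _ u _ _
   (flow_derivative HPhi (x0 0 i) (u * t)) D1.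
move=> D2; have := is_deriveB D2 (is_derive_cst (x0 0 i) u 1).
by rewrite subr0 mulrC !mxE !eqxx/= mulr1 addrC subrK.
Qed.

Definition exact_shear F i j (g : R -> R) :=
  flow_hypothesis F (push i (fun x => g (x 0 j))).

Section Shears.
Variables (F : set ('rV[R]_d -> 'rV[R]_d)) (i j : 'I_d) (s : R -> R).
Hypotheses (ij : j != i) (Fs : ridge_fields F i j s).

(** As j <> i, the coordinate x_j is constant along the trajectories, which are
    therefore straight lines run at constant speed. *)
Lemma exact_shear_ridge c w b : exact_shear F i j (fun y => c * s (w * y + b)).
Proof.
apply: flow_hypothesis_flow (Fs c w b) _ => x0.
exists (fun u => x0 + (u * (c * s (w * x0 0 j + b))) *: delta_mx 0 i).
split; last by rewrite mul1r.
  by rewrite mul0r scale0r addr0.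
move=> u; apply: is_derive_along.
rewrite !mxE eqxx/= (negbTE ij) mulr0 addr0.
set a := c * _.
have := @is_deriveM _ _ id (cst a) u 1 _ _ (is_derive_id u 1) (is_derive_cst a u 1).
by rewrite /GRing.scale/= mulr0 add0r mulr1.
Qed.

Lemma exact_shear0 : exact_shear F i j (fun=> 0).
Proof.
rewrite /exact_shear; have -> : push i (fun=> 0) = id.
  by apply/funext => x; rewrite /push scale0r addr0.
exact: flow_hypothesis_id.
Qed.

Lemma exact_shearD g1 g2 : exact_shear F i j g1 -> exact_shear F i j g2 ->
  exact_shear F i j (fun y => g1 y + g2 y).
Proof.
move=> H1 H2; rewrite /exact_shear.
have -> : push i (fun x => g1 (x 0 j) + g2 (x 0 j)) =
    push i (fun x => g2 (x 0 j)) \o push i (fun x => g1 (x 0 j)).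
  apply/funext => x; apply/rowP => k /=.
  by rewrite [RHS]pushE (push_ne _ _ ij) !pushE -addrA -mulrnDl.
exact: flow_hypothesis_trans.
Qed.

Lemma exact_shear_sum n (g : 'I_n -> R -> R) : (forall k : 'I_n, exact_shear F i j (g k)) ->
  exact_shear F i j (fun y => \sum_k g k y).
Proof.
move=> Hg; elim: (index_enum _) => [|k r IH].
  have -> : (fun y => \sum_(k <- [::]) g k y) = (fun=> 0).
    by apply/funext => y; rewrite big_nil.
  exact: exact_shear0.
have -> : (fun y => \sum_(k <- k :: r) g k y) = (fun y => g k y + \sum_(k <- r) g k y).
  by apply/funext => y; rewrite big_cons.
exact: exact_shearD.
Qed.

Lemma exact_shear_interp K (ts : seq R) (G : R -> R) : lip K s -> nonaffine s ->
  exists2 g, exact_shear F i j g & forall y, y \in ts -> g y = G y.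
Proof.
move=> sK s_na; have [n [c [w [b H]]]] := ridge_interp sK s_na ts G.
exists (fun y => \sum_k c k * s (w k * y + b k)) => //.
by apply: exact_shear_sum => k; exact: exact_shear_ridge.
Qed.

(** Conjugation of the shear by a flow of coordinate j. *)
Lemma exact_shear_comp K (s' : R -> R) h g : lip K s' -> ridge_fields F j j s' ->
  ridge_flows s' h -> exact_shear F i j g -> exact_shear F i j (g \o h).
Proof.
move=> sK Fj Hh Hg; have [h' [Hh' hh' _]] := ridge_flows_inv sK Hh.
rewrite /exact_shear; have -> : push i (fun x => (g \o h) (x 0 j)) =
  push j (fun x => h' (x 0 j) - x 0 j) \o
    (push i (fun x => g (x 0 j)) \o push j (fun x => h (x 0 j) - x 0 j)).
  apply/funext => x /=; set y := push j _ x; set z := push i _ y.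
  have yj : y 0 j = h (x 0 j) by rewrite /y push_eq; ring.
  have zj : z 0 j = h (x 0 j) by rewrite /z push_ne.
  apply/rowP => k; rewrite [LHS]pushE [RHS]pushE zj hh'.
  have [->|kj] := eqVneq k j.
    by rewrite (negbTE ij) zj mulr0n mulr1n; ring.
  by rewrite mulr0n addr0 /z pushE yj /y push_ne.
apply: flow_hypothesis_trans; first exact: ridge_flows_lift Fj Hh'.
apply: flow_hypothesis_trans => //; exact: ridge_flows_lift Fj Hh.
Qed.

End Shears.

Definition ridge_rich F := forall i j, exists s K,
  [/\ lip K s, nonaffine s & ridge_fields F i j s].

End Push.

(** * Interpolation in R^d *)

Lemma poly_nonroot (R : numFieldType) (p : {poly R}) : p != 0 -> exists x, p.[x] != 0.
Proof.
move=> p0; apply: contrapT => H.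
have rt x : root p x by apply/rootP/eqP; apply: contraT => h; case: H; exists x.
have := max_poly_roots p0 (rs := [seq n%:R | n <- iota 0 (size p)]).
have -> : all (root p) [seq n%:R | n <- iota 0 (size p)] by apply/allP => x _; exact: rt.
rewrite size_map size_iota ltnn map_inj_uniq ?iota_uniq; first by move=> /(_ isT isT).
by move=> m n /eqP; rewrite eqr_nat => /eqP.
Qed.

Section Interpolation.
Variables (R : realType) (d : nat) (F : set ('rV[R]_d -> 'rV[R]_d)).
Hypothesis Frich : ridge_rich F.
Variable N : nat.
Implicit Types (X Y Z : 'I_N -> 'rV[R]_d) (i j : 'I_d).

Definition reaches X Y := exists2 phi, flow_hypothesis F phi & forall k, phi (X k) = Y k.

(** The hypothesis space is not known to be closed under inverses, so
    reachability is required in both directions. *)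
Definition linked X Y := reaches X Y /\ reaches Y X.

Lemma reaches_trans X Y Z : reaches X Y -> reaches Y Z -> reaches X Z.
Proof.
move=> [f Hf fE] [g Hg gE]; exists (g \o f); first exact: flow_hypothesis_trans.
by move=> k /=; rewrite fE gE.
Qed.

Lemma linked_trans X Y Z : linked X Y -> linked Y Z -> linked X Z.
Proof. by move=> [a b] [c e]; split; [exact: reaches_trans a c|exact: reaches_trans e b]. Qed.

Lemma linked_refl X : linked X X.
Proof. by split; exists id => //; exact: flow_hypothesis_id. Qed.

Lemma reaches_shear X i j (G : R -> R) : j != i ->
  reaches X (fun k => push i (fun x => G (x 0 j)) (X k)).
Proof.
move=> ij; have [s [K [sK s_na Fs]]] := Frich i j.
have [g Hg gE] := exact_shear_interp ij Fs [seq X k 0 j | k <- enum 'I_N] G sK s_na.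
exists (push i (fun x => g (x 0 j))) => // k.
by rewrite /push gE//; apply/mapP; exists k; rewrite ?mem_enum.
Qed.

Lemma linked_shear X i j (G : R -> R) : j != i ->
  linked X (fun k => push i (fun x => G (x 0 j)) (X k)).
Proof.
move=> ij; split; first exact: reaches_shear.
have := reaches_shear (fun k => push i (fun x => G (x 0 j)) (X k)) (fun y => - G y) ij.
congr reaches; apply/funext => k; apply/rowP => l.
by rewrite pushE (push_ne _ _ ij) pushE -addrA -mulrnDl subrr mul0rn addr0.
Qed.

Lemma linked_set X i j (z : 'I_N -> R) : j != i -> injective (fun k => X k 0 j) ->
  exists Y, [/\ linked X Y, forall k, Y k 0 i = z k &
    forall k l, l != i -> Y k 0 l = X k 0 l].
Proof.
move=> ij XI.
pose G y := oapp (fun k => z k - X k 0 i) 0 [pick k | X k 0 j == y].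
exists (fun k => push i (fun x => G (x 0 j)) (X k)); split.
- exact: linked_shear.
- move=> k; rewrite push_eq /G; case: pickP => [l /eqP/XI ->|/(_ k)].
    by rewrite /= addrC subrK.
  by rewrite eqxx.
- by move=> k l li; rewrite push_ne.
Qed.

(** The first coordinate becomes the value at s of the polynomial with
    coefficients x_0, x_1, ...; for distinct points these polynomials are distinct, and
    they take distinct values at a generic s. *)
Lemma linked_separate X (i0 : 'I_d) : val i0 = 0%N -> injective X ->
  exists Y, linked X Y /\ injective (fun k => Y k 0 i0).
Proof.
move=> i00 XI.
have [s Hs] : exists s, (\prod_(kl : 'I_N * 'I_N | kl.1 != kl.2)
   (rVpoly (X kl.1) - rVpoly (X kl.2))).[s] != 0.
  apply: poly_nonroot; rewrite prodf_seq_neq0; apply/allP => -[k l] _ /=.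
  apply/implyP => kl; rewrite subr_eq0; apply: contra kl => /eqP.
  by move=> /(can_inj rVpolyK)/XI ->.
pose Y (r : seq 'I_d) k := push i0 (fun x => \sum_(j <- r) x 0 j * s ^+ j) (X k).
have HY r : (forall j, j \in r -> j != i0) -> linked X (Y r).
  elim: r => [|j r IH] Hr.
    have -> : Y [::] = X; last exact: linked_refl.
    by apply/funext => k; rewrite /Y /push big_nil scale0r addr0.
  have ji : j != i0 by rewrite Hr// mem_head.
  apply: (linked_trans (IH _)); first by move=> l lr; rewrite Hr// inE lr orbT.
  have := linked_shear (Y r) (fun y => y * s ^+ j) ji.
  congr linked; apply/funext => k; apply/rowP => l.
  rewrite pushE /Y (push_ne _ _ ji) !pushE big_cons -addrA -mulrnDl.
  by rewrite [X in X *+ _]addrC.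
exists (Y (rem i0 (index_enum 'I_d))); split.
  apply: HY => j; rewrite mem_rem_uniq ?index_enum_uniq// inE.
  by case/andP.
have YE k : Y (rem i0 (index_enum 'I_d)) k 0 i0 = (rVpoly (X k)).[s].
  rewrite push_eq horner_poly [RHS](big_rem i0) ?mem_index_enum//=.
  rewrite valK i00 expr0 mulr1; congr (_ + _).
  by apply: eq_bigr => j _; rewrite valK.
move=> k l; rewrite !YE => E; apply/eqP; move: Hs; apply: contraR => kl.
rewrite horner_prod (bigD1 (k, l))//=.
by rewrite hornerD hornerN E subrr mul0r.
Qed.

(** Any two configurations of distinct points are thus linked to the same one,
    k |-> k e_{i1}. *)
Lemma linked_normal_form X (i0 i1 : 'I_d) : val i0 = 0%N -> i1 != i0 -> injective X ->
  linked X (fun k => (k%:R : R) *: delta_mx 0 i1).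
Proof.
move=> i00 i10 XI; have [X1 [L1 X1I]] := linked_separate i00 XI.
have i01 : i0 != i1 by rewrite eq_sym.
have [X2 [L2 X2E _]] := linked_set (fun k : 'I_N => k%:R) i01 X1I.
apply: linked_trans L1 _; apply: linked_trans L2 _.
have H (r : seq 'I_d) : (forall j, j \in r -> j != i1) -> exists Y, [/\ linked X2 Y,
    forall k, Y k 0 i1 = k%:R & forall k j, j \in r -> Y k 0 j = 0].
  elim: r => [|j r IH] Hr; first by exists X2; split=> //; exact: linked_refl.
  have [|Y [LY Y1 Y0]] := IH; first by move=> l lr; rewrite Hr// inE lr orbT.
  have ji : i1 != j by rewrite eq_sym Hr// mem_head.
  have YI : injective (fun k => Y k 0 i1).
    by move=> k l; rewrite !Y1 => /eqP; rewrite eqr_nat => /eqP/val_inj.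
  have [Z [LZ Zj Zl]] := linked_set (fun=> 0) ji YI.
  exists Z; split; first exact: linked_trans LY LZ.
    by move=> k; rewrite Zl.
  move=> k l; rewrite inE; have [->|lj] := eqVneq l j; first by rewrite Zj.
  by move=> /= lr; rewrite Zl// Y0.
have [|Y [LY Y1 Y0]] := H (rem i1 (index_enum 'I_d)).
  by move=> j; rewrite mem_rem_uniq ?index_enum_uniq// inE => /andP[].
have -> // : (fun k : 'I_N => (k%:R : R) *: delta_mx 0 i1) = Y.
apply/funext => k; apply/rowP => j; rewrite !mxE eqxx/=.
have [->|ji] := eqVneq j i1; first by rewrite Y1 mulr1.
by rewrite mulr0 Y0// mem_rem_uniq ?index_enum_uniq// inE ji mem_index_enum.
Qed.

End Interpolation.

(** In dimension 1 the order of the points is an invariant and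
    [ridge_flows_interp] applies; otherwise both configurations are linked to the same
    normal form. *)
Lemma ridge_rich_UIP (R : realType) (d : nat) (F : set ('rV[R]_d -> 'rV[R]_d)) :
  (0 < d)%N -> ridge_rich F -> UIP F.
Proof.
move=> d0 Frich N x y _ [xI xO] [yI yO].
have [d1|d1] := eqVneq d 1%N.
  pose i0 := Ordinal d0.
  have [s [K [sK s_na Fs]]] := Frich i0 i0.
  have [h Hh hE] := ridge_flows_interp sK s_na (fun i j => xO d1 i j i0) (fun i j => yO d1 i j i0).
  exists (push i0 (fun x => h (x 0 i0) - x 0 i0)); split.
    exact: ridge_flows_lift Fs Hh.
  move=> k; apply/rowP => j; have -> : j = i0.
    by apply/val_inj => /=; have := ltn_ord j; rewrite {2}d1; case: (val j).
  by rewrite push_eq hE addrC subrK.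
have d2 : (1 < d)%N by rewrite ltn_neqAle eq_sym d1.
pose i0 := Ordinal d0; pose i1 := Ordinal d2.
have [[f Hf fE] _] := linked_normal_form Frich (i0 := i0) (i1 := i1) erefl isT xI.
have [_ [g Hg gE]] := linked_normal_form Frich (i0 := i0) (i1 := i1) erefl isT yI.
exists (g \o f); split; first exact: flow_hypothesis_trans.
by move=> k /=; rewrite fE gE.
Qed.

(** * Approximable maps *)

Section LipOnBalls.
Variable R : realType.
Implicit Types U V W : normedModType R.

(** Lipschitz continuity on balls is preserved under composition and is all
    the regularity that the approximation of compositions uses. *)
Definition lip_on_balls V W (h : V -> W) := forall M : R, exists C : R,
  forall x y, `|x| <= M -> `|y| <= M -> `|h x - h y| <= C * `|x - y|.

Lemma lip_on_balls_pos V W (h : V -> W) M : lip_on_balls h -> exists2 C : R, 0 < C &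
  forall x y, `|x| <= M -> `|y| <= M -> `|h x - h y| <= C * `|x - y|.
Proof.
move=> /(_ M)[C HC]; exists (`|C| + 1); first by rewrite ltr_wpDl.
move=> x y xM yM; rewrite (le_trans (HC _ _ xM yM))// ler_wpM2r//.
by rewrite (le_trans (ler_norm _))// lerDl.
Qed.

Lemma lip_on_balls_bounded V W (h : V -> W) M : lip_on_balls h -> exists2 B : R, 0 <= B &
  forall x, `|x| <= M -> `|h x| <= B.
Proof.
move=> Hh; have [C C0 HC] := lip_on_balls_pos `|M| Hh.
exists (`|h 0| + C * `|M|); first by rewrite addr_ge0// mulr_ge0// ltW.
move=> x xM; have xM' := le_trans xM (ler_norm M).
have -> : h x = h 0 + (h x - h 0) by rewrite addrC subrK.
rewrite (le_trans (ler_normD _ _))// lerD2l (le_trans (HC _ _ _ _))// ?normr0//.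
by rewrite subr0 ler_pM2l.
Qed.

Lemma lip_on_balls_comp U V W (g : V -> W) (f : U -> V) : lip_on_balls g -> lip_on_balls f -> lip_on_balls (g \o f).
Proof.
move=> Hg Hf M; have [B B0 HB] := lip_on_balls_bounded M Hf.
have [C C0 HC] := lip_on_balls_pos B Hg; have [D HD] := Hf M.
exists (C * D) => x y xM yM /=.
rewrite (le_trans (HC _ _ _ _)) ?HB// -mulrA ler_pM2l//; exact: HD.
Qed.

Lemma lip_lip_on_balls V W (h : V -> W) (K : R) : lip K h -> lip_on_balls h.
Proof. by move=> H M; exists K => x y _ _. Qed.

Lemma lip_on_ballsD V W (f g : V -> W) : lip_on_balls f -> lip_on_balls g -> lip_on_balls (fun x => f x + g x).
Proof.
move=> Hf Hg M; have [C HC] := Hf M; have [D HD] := Hg M.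
exists (C + D) => x y xM yM; rewrite opprD addrACA mulrDl.
by rewrite (le_trans (ler_normD _ _))// lerD// ?HC ?HD.
Qed.

Lemma lip_on_ballsZ V W (f : V -> R) (e : W) : lip_on_balls f -> lip_on_balls (fun x => f x *: e).
Proof.
move=> Hf M; have [C HC] := Hf M; exists (`|e| * C) => x y xM yM.
by rewrite -scalerBl normrZ mulrC -mulrA ler_wpM2l// HC.
Qed.

Lemma lip_on_balls_id V : lip_on_balls (@id V).
Proof. by apply: (@lip_lip_on_balls _ _ _ 1) => x y; rewrite mul1r. Qed.

Lemma lip_on_balls_coord d (j : 'I_d) : lip_on_balls (fun x : 'rV[R]_d => x 0 j).
Proof.
apply: (@lip_lip_on_balls _ _ _ 1) => x y; rewrite mul1r.
exact: rv_dist_ge.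
Qed.

Lemma lip_on_balls_push d (k : 'I_d) (q : 'rV[R]_d -> R) : lip_on_balls q -> lip_on_balls (push k q).
Proof. by move=> Hq; apply: lip_on_ballsD; [exact: lip_on_balls_id|exact: lip_on_ballsZ]. Qed.

Lemma push_dist d (k : 'I_d) (q q' : 'rV[R]_d -> R) x :
  `|push k q x - push k q' x| <= `|q x - q' x|.
Proof.
apply: rv_norm_le => // j; rewrite mxE [X in _ + X]mxE !pushE opprD addrACA subrr add0r.
by rewrite -mulrnBl; case: (j == k); rewrite ?mulr1n ?mulr0n ?normr0.
Qed.

End LipOnBalls.

Section Approximable.
Variables (R : realType) (d : nat) (F : set ('rV[R]_d -> 'rV[R]_d)).
Implicit Types f g h : 'rV[R]_d -> 'rV[R]_d.

Definition approximable h := lip_on_balls h /\ forall (M e : R), 0 < e ->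
  exists2 phi, flow_hypothesis F phi & forall x, `|x| <= M -> `|h x - phi x| <= e.

Lemma approximable_exact h : lip_on_balls h -> flow_hypothesis F h -> approximable h.
Proof.
move=> Th Hh; split=> // M e e0; exists h => // x _.
by rewrite subrr normr0 ltW.
Qed.

Lemma approximable_id : approximable id.
Proof. by apply: approximable_exact; [exact: lip_on_balls_id|exact: flow_hypothesis_id]. Qed.

Lemma approximable_comp f g : approximable f -> approximable g -> approximable (f \o g).
Proof.
move=> [Tf Hf] [Tg Hg]; split; first exact: lip_on_balls_comp.
move=> M e e0; have e20 : 0 < e / 2 by rewrite divr_gt0.
have [B B0 HB] := lip_on_balls_bounded M Tg.
have [C C0 HC] := lip_on_balls_pos (B + 1) Tf.
(* The bound 1 keeps the approximations of g x in the ball of radius B + 1. *)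
pose e1 : R := Num.min 1 (e / 2 / C).
have e10 : 0 < e1 by rewrite lt_min ltr01 !divr_gt0.
have [psi Hpsi Epsi] := Hg M e1 e10.
have [phi Hphi Ephi] := Hf (B + 1) (e / 2) e20.
exists (phi \o psi); first exact: flow_hypothesis_trans.
move=> x xM /=; have gx := HB x xM; have E := Epsi x xM.
have E1 : `|g x - psi x| <= 1 by rewrite (le_trans E)// ge_min lexx.
have E2 : C * `|g x - psi x| <= e / 2.
  by rewrite mulrC -ler_pdivlMr// (le_trans E)// ge_min lexx orbT.
have px : `|psi x| <= B + 1.
  have -> : psi x = g x - (g x - psi x) by rewrite opprB addrC subrK.
  by rewrite (le_trans (ler_normB _ _))// lerD.
have gx' : `|g x| <= B + 1 by rewrite (le_trans gx)// lerDl.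
have -> : f (g x) - phi (psi x) = (f (g x) - f (psi x)) + (f (psi x) - phi (psi x)).
  by rewrite addrA subrK.
rewrite (le_trans (ler_normD _ _))// [e]splitr lerD// ?Ephi//.
by rewrite (le_trans _ E2)// HC.
Qed.

Lemma approximable_lim h : lip_on_balls h -> (forall M e : R, 0 < e ->
  exists2 g, approximable g & forall x, `|x| <= M -> `|h x - g x| <= e) -> approximable h.
Proof.
move=> Th H; split=> // M e e0; have e20 : 0 < e / 2 by rewrite divr_gt0.
have [g [_ Hg] E] := H M (e / 2) e20.
have [phi Hphi E'] := Hg M (e / 2) e20.
exists phi => // x xM; have -> : h x - phi x = (h x - g x) + (g x - phi x).
  by rewrite addrA subrK.
by rewrite (le_trans (ler_normD _ _))// [e]splitr lerD ?E ?E'.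
Qed.

End Approximable.

(** * Approximation of monotone maps and shears *)

Section Elementary.
Variables (R : realType).

Lemma grid_cell (u : nat -> R) (t : R) n : (0 < n)%N -> u 0%N <= t <= u n ->
  exists2 l, (l < n)%N & u l <= t <= u l.+1.
Proof.
elim: n => [//|n IH] _ /andP[u0 un].
have [h|h] := leP (u n) t; first by exists n => //; rewrite h un.
case: n IH un h => [|n] IH un h; first by exists 0%N => //; rewrite u0 un.
have [|l ln E] := IH isT; first by rewrite u0 ltW.
by exists l => //; rewrite ltnW.
Qed.

Lemma fine_grid (M c e : R) : 0 < M -> 0 < c -> 0 < e ->
  exists n, (0 < n)%N /\ c * (2 * M / n%:R) <= e.
Proof.
move=> M0 c0 e0; have x0 : 0 <= c * (2 * M) / e.
  by rewrite divr_ge0 ?mulr_ge0// ltW.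
exists (Num.bound (c * (2 * M) / e)).+1; split=> //.
have := archi_boundP x0; set n := Num.bound _ => Hn.
rewrite mulrA ler_pdivrMr ?ltr0n// mulrC [leRHS]mulrC -ler_pdivrMr// mulrC.
by rewrite (le_trans (ltW Hn))// ler_nat.
Qed.

Variables (d : nat) (F : set ('rV[R]_d -> 'rV[R]_d)).
Hypothesis Frich : ridge_rich F.
Implicit Types (i j : 'I_d).

(** If h agrees with m on a grid and both increase, they differ by at most the
    oscillation of m on a cell. *)
Lemma approximable_monotone i (m : R -> R) : {homo m : x y / x < y} -> lip_on_balls m ->
  approximable F (push i (fun x => m (x 0 i) - x 0 i)).
Proof.
move=> mi Tm; have [s [K [sK s_na Fs]]] := Frich i i.
split.
  apply: lip_on_balls_push; apply: lip_on_ballsD.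
    exact: (@lip_on_balls_comp _ _ _ _ m (fun x : 'rV[R]_d => x 0 i) Tm (lip_on_balls_coord i)).
  apply: (@lip_lip_on_balls _ _ _ _ 1) => x y; rewrite mul1r -opprD normrN.
  exact: rv_dist_ge.
move=> M0 e e0; pose M : R := `|M0| + 1.
have Mp : 0 < M by rewrite ltr_wpDl.
have [C C0 HC] := lip_on_balls_pos M Tm.
have [n [n0 ne]] := fine_grid Mp C0 e0.
pose u (l : nat) : R := - M + l%:R * (2 * M / n%:R).
have n0' : 0 < n%:R :> R by rewrite ltr0n.
have dp : 0 < 2 * M / n%:R by rewrite divr_gt0// mulr_gt0.
have ulu (k l : nat) : (k < l)%N -> u k < u l.
  by move=> kl; rewrite /u ltrD2l ltr_pM2r// ltr_nat.
have un : u n = M by rewrite /u; field; rewrite gt_eqF.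
have u0 : u 0%N = - M by rewrite /u mul0r addr0.
have [h Hh hE] := ridge_flows_interp sK s_na (N := n.+1) (x := fun k => u k)
   (y := fun k => m (u k)) (fun k l kl => ulu k l kl) (fun k l kl => mi _ _ (ulu k l kl)).
exists (push i (fun x => h (x 0 i) - x 0 i)); first exact: ridge_flows_lift Fs Hh.
move=> x xM; apply: le_trans (push_dist _ _ _ _) _.
have -> : m (x 0 i) - x 0 i - (h (x 0 i) - x 0 i) = m (x 0 i) - h (x 0 i) by ring.
set t := x 0 i.
have tM : `|t| <= M.
  rewrite (le_trans (rv_norm_ge x i))// (le_trans xM)//.
  by rewrite (le_trans (ler_norm _))// lerDl.
have [|l ln /andP[ul tl]] := grid_cell (u := u) (t := t) n0.
  by rewrite u0 un -ler_norml.
have ub k : (k <= n)%N -> `|u k| <= M.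
  move=> kn; rewrite ler_norml -{1}u0 -un.
  have mono a b : (a <= b)%N -> u a <= u b.
    by rewrite leq_eqVlt => /orP[/eqP -> //|/ulu/ltW].
  by rewrite !mono.
have hl : h (u l) = m (u l) by exact: (hE (Ordinal (leqW ln))).
have hl1 : h (u l.+1) = m (u l.+1) by exact: (hE (Ordinal (ln : l.+1 < n.+1)%N)).
have h1 := ridge_flows_homo_le sK Hh ul; have h2 := ridge_flows_homo_le sK Hh tl.
have mle : {homo m : x y / x <= y}.
  by move=> a b; rewrite le_eqVlt => /orP[/eqP -> //|/mi/ltW].
have m1 := mle _ _ ul; have m2 := mle _ _ tl.
rewrite hl in h1; rewrite hl1 in h2.
have := HC _ _ (ub l.+1 ln) (ub l (ltnW ln)).
have -> : u l.+1 - u l = 2 * M / n%:R by rewrite /u -natr1; ring.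
rewrite (gtr0_norm dp) => /le_trans/(_ ne) h3.
have := le_trans (ler_norm _) h3 => h4.
rewrite ler_norml; apply/andP; split; lra.
Qed.

Lemma exact_shear_const i j a : j != i -> exact_shear F i j (fun=> a).
Proof.
move=> ij; have [s [K [sK s_na Fs]]] := Frich i j.
have [t st] : exists t, s t != 0.
  apply: contrapT => H; apply: s_na; exists 0, 0 => x.
  by rewrite mulr0 addr0; apply/eqP; apply: contraT => h; case: H; exists x.
have := exact_shear_ridge ij Fs (a / s t) 0 t.
by congr exact_shear; apply/funext => y; rewrite mul0r add0r divfK.
Qed.

(** Take a < b with s(a) <> s(b), and a flow h of coordinate j sending -M, c to
    values near a and c', M to values near b.  Then s(h(t)), normalized, is close to 0
    up to c and to 1 from c' on.  In between it is only bounded, by a constant B that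
    does not depend on how small c' - c is. *)
Lemma exact_shear_step i j : j != i -> exists2 B : R, 0 <= B &
  forall M c c' kap : R, - M < c -> c < c' -> c' < M -> 0 < kap ->
  exists2 S, forall a, exact_shear F i j (fun t => a * S t) &
   [/\ forall t, - M <= t <= c -> `|S t| <= kap,
       forall t, c' <= t <= M -> `|S t - 1| <= kap &
       forall t, - M <= t <= M -> `|S t| <= B].
Proof.
move=> ij; have [s [K0 [sK0 s_na Fs]]] := Frich i j.
have [s' [K' [sK' s_na' Fs']]] := Frich j j.
have [K Kp sK] := lip_pos sK0.
have [a [b [ab sab]]] : exists a b, a < b /\ s a != s b.
  apply: contrapT => H; apply: s_na; exists 0, (s 0) => x.
  rewrite mulr0 add0r; apply/eqP; apply: contraT => h; case: H.
  have [x0|x0|x0] := ltgtP x 0; [by exists x, 0|by exists 0, x; rewrite eq_sym|].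
  by rewrite x0 eqxx in h.
pose D : R := s b - s a.
have D0 : D != 0 by rewrite subr_eq0 eq_sym.
have Dn : 0 < `|D| by rewrite normr_gt0.
exists (K * (b - a) / `|D|).
  by rewrite divr_ge0// mulr_ge0 ?(ltW Kp)// subr_ge0 ltW.
move=> M c c' kap Mc cc' cM kap0.
have ba : 0 < b - a by rewrite subr_gt0.
(* Small enough for the four values to be increasing, and for s to vary by at
   most kap |D| on intervals of length mu. *)
pose mu : R := Num.min ((b - a) / 3) (kap * `|D| / K).
have mu0 : 0 < mu by rewrite lt_min !divr_gt0// mulr_gt0.
have mu1 : mu <= (b - a) / 3 by rewrite ge_min lexx.
have mu2 : K * mu / `|D| <= kap.
  by rewrite ler_pdivrMr// mulrC -ler_pdivlMr// ge_min lexx orbT.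
pose xs := [:: - M; c; c'; M]; pose ys := [:: a; a + mu; b - mu; b].
have xs_lt (k l : 'I_4) : (k < l)%N -> xs`_k < xs`_l.
  move=> kl; apply: (sorted_ltn_nth lt_trans) => //.
  - by rewrite /= Mc cc' cM.
  - exact: ltn_ord.
  - exact: ltn_ord.
have ys_lt (k l : 'I_4) : (k < l)%N -> ys`_k < ys`_l.
  move=> kl; apply: (sorted_ltn_nth lt_trans) => //=.
  - by apply/and4P; split=> //; lra.
  - exact: ltn_ord.
  - exact: ltn_ord.
have [h Hh hE] := ridge_flows_interp sK' s_na' xs_lt ys_lt.
have h0 : h (- M) = a := hE (Ordinal (isT : 0 < 4)%N).
have h1 : h c = a + mu := hE (Ordinal (isT : 1 < 4)%N).
have h2 : h c' = b - mu := hE (Ordinal (isT : 2 < 4)%N).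
have h3 : h M = b := hE (Ordinal (isT : 3 < 4)%N).
have hle := ridge_flows_homo_le sK' Hh.
exists (fun t => D^-1 * s (1 * h t + 0) + - (s a / D)).
  move=> r.
  have := exact_shearD ij
    (exact_shear_comp ij sK' Fs' Hh (exact_shear_ridge ij Fs (r / D) 1 0))
    (exact_shear_const (- (r * (s a / D))) ij).
  by congr exact_shear; apply/funext => t /=; ring.
have SE t : D^-1 * s (1 * h t + 0) + - (s a / D) = (s (h t) - s a) / D.
  by rewrite mul1r addr0; field.
have Sb t x : `|h t - x| <= mu -> `|s (h t) - s x| / `|D| <= kap.
  move=> H; rewrite (le_trans _ mu2)// ler_wpM2r ?invr_ge0//.
  by rewrite (le_trans (sK _ _))// ler_pM2l.
split=> t /andP[t1 t2]; rewrite SE.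
- rewrite normrM normfV; apply: Sb.
  have := hle _ _ t1; have := hle _ _ t2; rewrite h0 h1 => H1 H2.
  rewrite ger0_norm; lra.
- have -> : (s (h t) - s a) / D - 1 = (s (h t) - s b) / D by rewrite /D; field.
  rewrite normrM normfV; apply: Sb.
  have := hle _ _ t1; have := hle _ _ t2; rewrite h2 h3 => H1 H2.
  rewrite ler0_norm; lra.
- rewrite normrM normfV ler_wpM2r ?invr_ge0// (le_trans (sK _ _))// ler_pM2l//.
  have := hle _ _ t1; have := hle _ _ t2; rewrite h0 h3 => H1 H2.
  rewrite ger0_norm; lra.
Qed.

(** G is approximated on a grid by the sum of its increments times steps.  In a
    cell only one step is neither near 0 nor near 1, and it contributes a multiple of one
    increment. *)
Lemma approximable_shear i j (G : R -> R) : j != i -> lip_on_balls G ->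
  approximable F (push i (fun x => G (x 0 j))).
Proof.
move=> ij TG; split.
  apply: lip_on_balls_push.
  exact: (@lip_on_balls_comp _ _ _ _ G (fun x : 'rV[R]_d => x 0 j) TG (lip_on_balls_coord j)).
move=> M0 e e0; pose M : R := `|M0| + 1.
have Mp : 0 < M by rewrite ltr_wpDl.
have e20 : 0 < e / 2 by rewrite divr_gt0.
have [C C0 HC] := lip_on_balls_pos M TG.
have [B B0 HB] := exact_shear_step ij.
have CB : 0 < C * (1 + (B + 1)) by rewrite mulr_gt0//; lra.
have [n [n0 ne]] := fine_grid Mp CB e20.
pose dl : R := 2 * M / n%:R.
have n0' : 0 < n%:R :> R by rewrite ltr0n.
have dp : 0 < dl by rewrite divr_gt0// mulr_gt0.
pose u (l : nat) : R := - M + l%:R * dl.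
have ulu (k l : nat) : (k < l)%N -> u k < u l.
  by move=> kl; rewrite /u ltrD2l ltr_pM2r// ltr_nat.
have mono k l : (k <= l)%N -> u k <= u l.
  by rewrite leq_eqVlt => /orP[/eqP -> //|/ulu/ltW].
have un : u n = M by rewrite /u /dl; field; rewrite gt_eqF.
have u0 : u 0%N = - M by rewrite /u mul0r addr0.
have ub k : (k <= n)%N -> `|u k| <= M.
  by move=> kn; rewrite ler_norml -{1}u0 -un !mono.
pose kap : R := e / 2 / (C * (2 * M)).
have kap0 : 0 < kap by rewrite !divr_gt0// !mulr_gt0.
have /choice[S HS] (l : 'I_n) : exists S, (forall a, exact_shear F i j (fun t => a * S t)) /\
   [/\ forall t, - (M + 1) <= t <= u l -> `|S t| <= kap,
       forall t, u l.+1 <= t <= M + 1 -> `|S t - 1| <= kap &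
       forall t, - (M + 1) <= t <= M + 1 -> `|S t| <= B].
  have := ub l (ltnW (ltn_ord l)); have := ub l.+1 (ltn_ord l).
  rewrite !ler_norml => /andP[a1 a2] /andP[a3 a4].
  have [|||S HS1 HS2] := HB (M + 1) (u l) (u l.+1) kap _ _ _ kap0; try lra.
    exact: ulu.
  by exists S.
pose dG l : R := G (u l.+1) - G (u l).
have dGb l : (l < n)%N -> `|dG l| <= C * dl.
  move=> ln; rewrite (le_trans (HC _ _ (ub _ ln) (ub _ (ltnW ln))))//.
  have -> : u l.+1 - u l = dl by rewrite /u -natr1; ring.
  by rewrite gtr0_norm.
exists (push i (fun x => (fun t => G (u 0%N) + \sum_(l < n) dG l * S l t) (x 0 j))).
  apply: (exact_shearD ij (exact_shear_const (G (u 0%N)) ij) (g2 := fun t => \sum_(l < n) dG l * S l t)).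
  by apply: (exact_shear_sum ij) => l; case: (HS l).
move=> x xM; apply: le_trans (push_dist _ _ _ _) _ => /=.
set t := x 0 j.
have tM : `|t| <= M.
  rewrite (le_trans (rv_norm_ge x j))// (le_trans xM)//.
  by rewrite (le_trans (ler_norm _))// lerDl.
have [|p pn /andP[up tp]] := grid_cell (u := u) (t := t) n0.
  by rewrite u0 un -ler_norml.
(* With ideal steps, the sum telescopes to G (u p) for points of the cell p. *)
have tel : \sum_(l < n) dG l * (l < p)%:R = G (u p) - G (u 0%N).
  rewrite -(big_mkord xpredT (fun l => dG l * (l < p)%:R)).
  rewrite (big_cat_nat (n := p)) ?(ltnW pn)//= [X in _ + X]big1_seq ?addr0; last first.
    by move=> l /=; rewrite mem_index_iota => /andP[pl _]; rewrite ltnNge pl mulr0.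
  rewrite -(@telescope_sumr _ 0%N p (fun l => G (u l)))//; apply: eq_big_nat => l /andP[_ ->].
  by rewrite mulr1.
have -> : G t - (G (u 0%N) + \sum_(l < n) dG l * S l t) =
    (G t - G (u p)) - \sum_(l < n) dG l * (S l t - (l < p)%:R).
  rewrite [in RHS](eq_bigr (fun l : 'I_n => dG l * S l t - dG l * (l < p)%:R)); last first.
    by move=> l _; rewrite mulrBr.
  by rewrite sumrB tel; ring.
have tM1 : - (M + 1) <= t <= M + 1.
  move: tM; rewrite ler_norml => /andP[a1 a2]; apply/andP; split; lra.
have [tM2 tM3] := andP tM1.
have E1 : `|G t - G (u p)| <= C * dl.
  rewrite (le_trans (HC _ _ tM (ub _ (ltnW pn))))// ler_pM2l//.
  rewrite ger0_norm ?subr_ge0//; move: tp; rewrite /u -natr1; lra.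
have E2 : `|\sum_(l < n) dG l * (S l t - (l < p)%:R)| <=
    \sum_(l < n) C * dl * (kap + (l == p :> nat)%:R * (B + 1)).
  rewrite (le_trans (ler_norm_sum _ _ _))//; apply: ler_sum => l _.
  rewrite normrM ler_pM// ?dGb//.
  have [_ [S0 S1 SB]] := HS l.
  case: (ltngtP l p) => lp.
  - rewrite mul0r addr0; apply: S1; rewrite tM3 andbT (le_trans _ up)//.
    exact: mono.
  - rewrite mul0r addr0 subr0; apply: S0; rewrite tM2/= (le_trans tp)//.
    exact: mono.
  - rewrite mul1r subr0 (le_trans (SB _ tM1))//; lra.
rewrite (le_trans (ler_normB _ _))// (le_trans (lerD E1 E2))//.
rewrite -mulr_sumr big_split/= sumr_const card_ord -mulr_suml.
have -> : \sum_(l < n) ((l == p :> nat)%:R : R) = 1.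
  rewrite (bigD1 (Ordinal pn))//= eqxx big1 ?addr0// => l lp.
  by rewrite (_ : (l == p :> nat) = false)//; apply: negbTE.
have -> : kap *+ n = kap * n%:R by rewrite mulr_natr.
have k1 : C * dl * (kap * n%:R) = e / 2.
  rewrite /kap /dl; field; rewrite !gt_eqF//.
rewrite mulrDr k1 mul1r; move: ne; rewrite -/dl; lra.
Qed.

End Elementary.

(** * Perturbations of one coordinate *)

Section OneCoordinate.
Variables (R : realType) (d : nat).
Implicit Types (x y z : 'rV[R]_d) (i j k : 'I_d) (q : 'rV[R]_d -> R).

(** The fixed points of z |-> x - p(z) are the solutions of z + p(z) = x, and
    z |-> z + p(z) expands distances by at least 1 - th. *)
Lemma near_identity_inverse (p : 'rV[R]_d -> 'rV[R]_d) (th : R) :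
  0 <= th < 1 -> (forall x y, `|p x - p y| <= th * `|x - y|) ->
  exists g, [/\ forall x, g x + p (g x) = x, forall x z, z + p z = x -> z = g x &
    forall x y, `|g x - g y| <= (1 - th)^-1 * `|x - y|].
Proof.
move=> /andP[th0 th1] pth.
have expand z w : (1 - th) * `|z - w| <= `|(z + p z) - (w + p w)|.
  have E : z - w = (z + p z - (w + p w)) - (p z - p w).
    by rewrite opprD addrACA addrK.
  have := ler_normB (z + p z - (w + p w)) (p z - p w); rewrite -E.
  have := pth z w; lra.
have inj z w : z + p z = w + p w -> z = w.
  move=> E; have := expand z w; rewrite E subrr normr0.
  rewrite pmulr_rle0 ?subr_gt0// normr_le0 subr_eq0 => /eqP //.
have /choice[g Hg] : forall x, exists z, z + p z = x.
  move=> x; have [|||//||z _ zE] := @banach_fixpoint _ _ setT (fun z => x - p z) th.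
  - by rewrite th0 th1.
  - exact: closedT.
  - by exists 0.
  - by move=> y z _ _; rewrite opprD addrACA subrr add0r -opprD normrN pth.
  - by exists z; rewrite -[X in X + _]zE subrK.
exists g; split=> //.
  by move=> x z E; apply: inj; rewrite E Hg.
move=> x y; rewrite mulrC ler_pdivlMr ?subr_gt0// mulrC.
by have := expand (g x) (g y); rewrite !Hg.
Qed.

Definition set_coord j c x : 'rV[R]_d := push j (fun x => c - x 0 j) x.

Lemma set_coordE j c x i : set_coord j c x 0 i = if i == j then c else x 0 i.
Proof.
rewrite /set_coord pushE; case: eqP => [->|_]; last by rewrite mulr0n addr0.
by rewrite mulr1n addrC subrK.
Qed.

Lemma set_coord_lip j c x y : `|set_coord j c x - set_coord j c y| <= `|x - y|.
Proof.
apply: rv_norm_le => // i; have := rv_norm_ge (x - y) i.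
rewrite mxE [X in _ + X]mxE => h.
rewrite mxE [X in _ + X]mxE !set_coordE.
by case: eqP => //; rewrite subrr normr0.
Qed.

Lemma set_coord_dist j c c' x : `|set_coord j c x - set_coord j c' x| <= `|c - c'|.
Proof.
apply: rv_norm_le => // i.
rewrite mxE [X in _ + X]mxE !set_coordE; case: eqP => // _; by rewrite subrr normr0.
Qed.

Lemma set_coord_norm j c x M : `|c| <= M -> `|x| <= M -> `|set_coord j c x| <= M.
Proof.
move=> cM xM; apply: rv_norm_le => [|i]; first exact: le_trans cM.
by rewrite set_coordE; case: eqP => // _; exact: le_trans (rv_norm_ge _ _) xM.
Qed.

Lemma set_coord_id j x : set_coord j (x 0 j) x = x.
Proof. by apply/rowP => i; rewrite set_coordE; case: eqP => // ->. Qed.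

(** The support is bounded in x_k, so that the push by q can be switched off by first
    moving x_k out of the slab; n is the parameter of the induction that adds the
    coordinates on which q depends one by one. *)
Definition perturbation (n : nat) k (L th : R) q :=
  [/\ forall x y, `|q x - q y| <= th * `|x - y|,
      forall x, L <= `|x 0 k| -> q x = 0 &
      forall x y, (forall j, (j < n)%N || (j == k) -> x 0 j = y 0 j) -> q x = q y].

Lemma perturbation_slice n k L th q j c : val j = n -> j != k ->
  perturbation n.+1 k L th q -> 0 <= th ->
  perturbation n k L th (q \o set_coord j c).
Proof.
move=> jn jk [q1 q2 q3] th0; split=> [x y|x xk|x y H] /=.
- by rewrite (le_trans (q1 _ _))// ler_wpM2l// set_coord_lip.
- by apply: q2; rewrite set_coordE eq_sym (negbTE jk).
- apply: q3 => i h; rewrite !set_coordE; have [//|ij] := eqVneq i j.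
  apply: H; case/orP: h => [|->]; last by rewrite orbT.
  rewrite ltnS  leq_eqVlt => /orP[/eqP h|->//].
  by rewrite -val_eqE/= h -jn eqxx in ij.
Qed.

(** The map from one perturbation to the next, (id + q' e_k) (id + q e_k)^-1, is again
    a perturbation of the same kind, by (q' - q) (id + q e_k)^-1, with a Lipschitz
    constant at most 4 times as large. *)
Lemma perturbation_transition n k L (th : R) q q' : 0 <= th <= 1 / 2 ->
  perturbation n k L th q -> perturbation n k L th q' ->
  exists r, [/\ perturbation n k L (4 * th) r,
    forall x, push k r (push k q x) = push k q' x &
    forall e, (forall x, `|q' x - q x| <= e) -> forall x, `|r x| <= e].
Proof.
move=> /andP[th0 th2] [q1 q2 q3] [q1' q2' q3'].
have th1 : th < 1 by lra.
pose e : 'rV[R]_d := delta_mx 0 k.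
have pth x y : `|q x *: e - q y *: e| <= th * `|x - y|.
  rewrite -scalerBl normrZ (le_trans _ (q1 x y))// ler_piMr//.
  apply: rv_norm_le => // i; rewrite mxE eqxx/=; case: (i == k).
    by rewrite normr1.
  by rewrite normr0.
have [|g [g1 g2 g3]] := near_identity_inverse _ pth; first by rewrite th0 th1.
exists (fun x => q' (g x) - q (g x)); split.
- split=> [x y|x xk|x y xy].
  + have -> : q' (g x) - q (g x) - (q' (g y) - q (g y)) =
      (q' (g x) - q' (g y)) - (q (g x) - q (g y)) by ring.
    rewrite (le_trans (ler_normB _ _))//.
    have h := g3 x y; have h1 := q1 (g x) (g y); have h2 := q1' (g x) (g y).
    have i2 : (1 - th)^-1 <= 2.
      rewrite -[leRHS]invrK lef_pV2 ?posrE; lra.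
    have h3 : `|g x - g y| <= 2 * `|x - y| by rewrite (le_trans h)// ler_wpM2r.
    have h4 := ler_wpM2l th0 h3; lra.
  + have -> : g x = x by apply/esym/g2; rewrite q2// scale0r addr0.
    by rewrite q2// q2'// subrr.
  + have ne i : i != k -> g x 0 i = x 0 i /\ g y 0 i = y 0 i.
      move=> ik; split.
        rewrite -[in RHS](g1 x) !mxE eqxx/= (negbTE ik) mulr0 addr0 //.
      by rewrite -[in RHS](g1 y) !mxE eqxx/= (negbTE ik) mulr0 addr0.
    have gk z : z 0 k = g z 0 k + q (g z).
      by rewrite -[in LHS](g1 z) !mxE !eqxx/= mulr1.
    (* w agrees with g x in all coordinates on which q depends. *)
pose w := set_coord k (g x 0 k) (g y).
    have wE : q w = q (g x).
      apply: q3 => i Hi; rewrite set_coordE; case: eqP => [->//|/eqP ik].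
      have [-> ->] := ne _ ik; apply/esym; exact: xy.
    have E : g x 0 k - g y 0 k = q (g y) - q (g x).
      have := xy k; rewrite eqxx orbT => /(_ isT); rewrite (gk x) (gk y); lra.
    have E2 : g x 0 k = g y 0 k.
      apply/eqP; rewrite -subr_eq0 -normr_le0.
      have : `|g x 0 k - g y 0 k| <= th * `|g x 0 k - g y 0 k|.
        rewrite {1}E -wE (le_trans (q1 _ _))// ler_wpM2l//.
        rewrite /w -{1}(set_coord_id k (g y)) distrC; exact: set_coord_dist.
      have := normr_ge0 (g x 0 k - g y 0 k); nra.
    have gxy i : (i < n)%N || (i == k) -> g x 0 i = g y 0 i.
      move=> Hi; have [->//|ik] := eqVneq i k.
      by have [-> ->] := ne _ ik; exact: xy.
    by rewrite (q3 _ _ gxy) (q3' _ _ gxy).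
- move=> x; set y := push k q x; have yx : g y = x by apply/esym/g2.
  by rewrite {1}/push yx /y /push -addrA -scalerDl [q x + _]addrC subrK.
- by move=> e' H x; exact: H.
Qed.

Variable F : set ('rV[R]_d -> 'rV[R]_d).
Hypothesis Frich : ridge_rich F.

(** A perturbation depending on x_k alone is an increasing map of x_k. *)
Lemma approximable_perturbation0 k L (th : R) q : 0 <= th <= 1 / 2 ->
  perturbation 0 k L th q -> approximable F (push k q).
Proof.
move=> /andP[th0 th2] [q1 q2 q3].
pose m (t : R) : R := t + q (t *: delta_mx 0 k).
have qm t u : `|q (t *: delta_mx 0 k) - q (u *: delta_mx 0 k)| <= th * `|t - u|.
  rewrite (le_trans (q1 _ _))// ler_wpM2l//.
  apply: rv_norm_le => // i; rewrite -scalerBl !mxE eqxx/=.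
  by case: (i == k); rewrite ?mulr1 ?mulr0 ?normr0.
have -> : push k q = push k (fun x => m (x 0 k) - x 0 k).
  apply/funext => x; rewrite /push; congr (_ + _ *: _).
  rewrite /m addrAC subrr add0r; apply: q3 => j /=; rewrite !mxE => /eqP ->.
  by rewrite !eqxx mulr1.
apply: approximable_monotone => //.
  move=> t u tu; have := qm u t; rewrite ler_norml gtr0_norm ?subr_gt0//.
  move=> /andP[h _]; rewrite /m.
  have : th * (u - t) < u - t by rewrite gtr_pMl ?subr_gt0//; lra.
  lra.
move=> M; exists (1 + th) => t u _ _; rewrite /m opprD addrACA mulrDl mul1r.
by rewrite (le_trans (ler_normD _ _))// lerD2l.
Qed.

(** A continuous switch between displacement by G, for y <= a, and none, for y >= b. *)
Definition ramp (a b G : R) (y : R) : R := G * Num.min 1 (Num.max 0 ((b - y) / (b - a))).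

Lemma maxr_lip (c a b : R) : `|Num.max c a - Num.max c b| <= `|a - b|.
Proof.
wlog ab : a b / a <= b.
  move=> W; case/orP: (le_total a b) => h; first exact: W.
  by rewrite distrC [leRHS]distrC W.
case: (leP c a) => ha; case: (leP c b) => hb; rewrite ?subrr ?normr0//; first lra.
by rewrite !ler0_norm; lra.
Qed.

Lemma minr_lip (c a b : R) : `|Num.min c a - Num.min c b| <= `|a - b|.
Proof.
have E t : Num.min c t = - Num.max (- c) (- t) by rewrite oppr_max !opprK.
by rewrite !E -opprD normrN (le_trans (maxr_lip _ _ _))// -opprD normrN.
Qed.

Lemma minmax_lip (a b : R) :
  `|Num.min 1 (Num.max 0 a) - Num.min 1 (Num.max 0 b)| <= `|a - b|.
Proof. exact: le_trans (minr_lip _ _ _) (maxr_lip _ _ _). Qed.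

Lemma ramp_lip_on_balls (a b G : R) : a < b -> lip_on_balls (ramp a b G).
Proof.
move=> ab; apply: (@lip_lip_on_balls _ _ _ _ (`|G| / (b - a))) => y z.
rewrite /ramp -mulrBr normrM -mulrA ler_wpM2l// (le_trans (minmax_lip _ _))//.
rewrite -mulrBl normrM mulrC normfV (gtr0_norm (_ : 0 < b - a)) ?subr_gt0//.
rewrite ler_wpM2l ?invr_ge0 ?subr_ge0 ?(ltW ab)//.
have -> : b - y - (b - z) = - (y - z) by ring.
by rewrite normrN.
Qed.

Lemma ramp_left (a b G y : R) : a < b -> y <= a -> ramp a b G y = G.
Proof.
move=> ab ya; rewrite /ramp min_l ?mulr1// le_max ler_pdivlMr ?subr_gt0//.
by rewrite mul1r lerD2l lerN2 ya orbT.
Qed.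

Lemma ramp_right (a b G y : R) : a < b -> b <= y -> ramp a b G y = 0.
Proof.
move=> ab by_; rewrite /ramp max_l ?min_r ?mulr0//.
by rewrite pmulr_lle0 ?invr_gt0 ?subr_gt0// subr_le0.
Qed.

(** Conjugation of the push by the shear x_k |-> x_k - G(x_j). *)
Lemma approximable_ramped_push k j (r : 'rV[R]_d -> R) a b G : j != k -> a < b ->
  approximable F (push k r) ->
  approximable F (push k (fun x => r (x - ramp a b G (x 0 j) *: delta_mx 0 k))).
Proof.
move=> jk ab Hr.
have -> : push k (fun x => r (x - ramp a b G (x 0 j) *: delta_mx 0 k)) =
  push k (fun x => ramp a b G (x 0 j)) \o
    (push k r \o push k (fun x => (fun t => -1 * ramp a b G t) (x 0 j))).
  apply/funext => x; pose y := push k (fun x => -1 * ramp a b G (x 0 j)) x.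
  have yE : y = x - ramp a b G (x 0 j) *: delta_mx 0 k by rewrite /y /push mulN1r scaleNr.
  apply/rowP => i; rewrite [LHS]pushE /= [RHS]pushE !(push_ne _ _ jk) -/y [in RHS]pushE.
  rewrite [in X in _ = X + _ + _]/y pushE yE.
  by case: (i == k); rewrite ?mulr0n ?mulr1n; ring.
have T := ramp_lip_on_balls G ab.
apply: approximable_comp; first exact: approximable_shear.
apply: approximable_comp => //; apply: (approximable_shear Frich jk (G := fun t => -1 * ramp a b G t)).
by move=> M; have [C HC] := T M; exists C => x y xM yM;
  rewrite -mulrBr normrM normrN1 mul1r; exact: HC.
Qed.

(** Cut the range of x_n into thin cells with ends u_l, and freeze x_n at u_l: by
    induction the frozen maps and the transitions r_l from one to the next are
    approximable.  A transition is switched off for x_n < u_l by conjugation with a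
    shear that carries the point out of the slab |x_k| < L.  The product of the switched
    transitions applies exactly r_0, ..., r_{p-1} to the points of the cell p; the
    p-th one is in the middle of being switched on there, but it moves points by at
    most th times the width of a cell, however partially it acts. *)
Lemma approximable_perturbation n k L (th : R) q : 0 <= th <= 1 / 2 / 4 ^+ n ->
  perturbation n k L th q -> approximable F (push k q).
Proof.
elim: n th q => [|n IH] th q.
  by rewrite expr0 divr1; exact: approximable_perturbation0.
move=> /andP[th0 thn] Hq.
have p4 : 1 <= 4 ^+ n :> R by rewrite exprn_ege1// ler1n.
have thn' : 4 * th <= 1 / 2 / 4 ^+ n.
  have E : (1 / 2 / 4 ^+ n.+1 : R) = 1 / 2 / 4 ^+ n / 4.
    by rewrite exprS; field; rewrite expf_neq0.
  by move: thn; rewrite E; lra.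
have half : 1 / 2 / 4 ^+ n <= 1 / 2 :> R.
  by rewrite ler_pdivrMr ?exprn_gt0// ler_peMr.
case: (boolP [exists j : 'I_d, (val j == n) && (j != k)]) => [|nex]; last first.
  apply: (IH th); first by rewrite th0/=; lra.
  case: Hq => q1 q2 q3; split=> // x y H; apply: q3 => j.
  have [->|jk] := eqVneq j k; first by move=> _; apply: H; rewrite eqxx orbT.
  rewrite orbF ltnS leq_eqVlt => /orP[jn|jn]; last by apply: H; rewrite jn.
  by exfalso; move/negP: nex; apply; apply/existsP; exists j; rewrite jn.
case/existsP => j /andP[/eqP jn jk].
have [q1 q2 q3] := Hq.
have Tq : lip_on_balls q by exact: lip_lip_on_balls q1.
have Hs c : perturbation n k L th (q \o set_coord j c) by exact: perturbation_slice.
have th01 : 0 <= th <= 1 / 2 by rewrite th0/=; lra.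
have th4 : 0 <= 4 * th <= 1 / 2 / 4 ^+ n by rewrite thn' mulr_ge0.
have thn0 : 0 <= th <= 1 / 2 / 4 ^+ n by rewrite th0/=; lra.
have sl c c' x : `|q (set_coord j c' x) - q (set_coord j c x)| <= th * `|c' - c|.
  by rewrite (le_trans (q1 _ _))// ler_wpM2l// set_coord_dist.
apply: approximable_lim; first exact: lip_on_balls_push.
move=> M0 e e0; pose M : R := `|M0| + 1.
have Mp : 0 < M by rewrite ltr_wpDl.
have th21 : 0 < 2 * th + 1 by lra.
have [N [N0 Ne]] := fine_grid Mp th21 e0.
pose dl : R := 2 * M / N%:R.
have N0' : 0 < N%:R :> R by rewrite ltr0n.
have dp : 0 < dl by rewrite divr_gt0// mulr_gt0.
pose u (l : nat) : R := - M + l%:R * dl.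
have ulu (a b : nat) : (a < b)%N -> u a < u b.
  by move=> ab; rewrite /u ltrD2l ltr_pM2r// ltr_nat.
have mono a b : (a <= b)%N -> u a <= u b.
  by rewrite leq_eqVlt => /orP[/eqP -> //|/ulu/ltW].
have uS l : u l.+1 - u l = dl by rewrite /u -natr1; ring.
have uN : u N = M by rewrite /u /dl; field; rewrite gt_eqF.
have u0 : u 0%N = - M by rewrite /u mul0r addr0.
have ub l : (l <= N)%N -> `|u l| <= M.
  by move=> lN; rewrite ler_norml -{1}u0 -uN !mono.
have [B B0 HB] := lip_on_balls_bounded M Tq.
have thd : 0 <= th * dl by rewrite mulr_ge0// ltW.
(* A shift by Gam carries every point met below out of the slab. *)
pose Gam : R := `|L| + M + B + th * dl.
have /choice[r Hr] : forall l, exists r, [/\ perturbation n k L (4 * th) r,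
    forall x, push k r (push k (q \o set_coord j (u l)) x) = push k (q \o set_coord j (u l.+1)) x &
    forall x, `|r x| <= th * dl].
  move=> l; have [r [r1 r2 r3]] := perturbation_transition th01 (Hs (u l)) (Hs (u l.+1)).
  exists r; split=> //; apply: r3 => x /=.
  by rewrite (le_trans (sl _ _ _))// uS gtr0_norm.
pose C l := push k (fun x => r l (x - ramp (u l) (u l.+1) Gam (x 0 j) *: delta_mx 0 k)).
pose Psi := fix Psi l := if l is l'.+1 then C l' \o Psi l' else push k (q \o set_coord j (u 0%N)).
exists (Psi N).
  have : forall l, approximable F (Psi l); last exact.
  elim=> [|l IHl] /=; first exact: IH thn0 (Hs _).
  apply: approximable_comp IHl; apply: approximable_ramped_push => //; first exact: ulu.
  by case: (Hr l) => r1 _ _; exact: IH th4 r1.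
move=> x xM0.
have xM : `|x| <= M by rewrite (le_trans xM0)// (le_trans (ler_norm _))// lerDl.
have xjM : `|x 0 j| <= M by rewrite (le_trans (rv_norm_ge _ _)).
have [|p pN /andP[up tp]] := grid_cell (u := u) (t := x 0 j) N0.
  by rewrite u0 uN -ler_norml.
have CE l y : C l y 0 j = y 0 j by rewrite /C push_ne.
have PsiE l : Psi l x 0 j = x 0 j.
  by elim: l => [|l IHl] /=; rewrite ?push_ne// CE.
have early l : (l <= p)%N -> Psi l x = push k (q \o set_coord j (u l)) x.
  elim: l => [//|l IHl] lp /=.
  have [_ r2 _] := Hr l; rewrite -r2 -IHl ?(ltnW lp)//.
  rewrite /C /push PsiE ramp_right ?scale0r ?subr0//; first exact: ulu.
  by rewrite (le_trans _ up)// mono.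
have mid : `|Psi p.+1 x - push k (q \o set_coord j (u p)) x| <= th * dl.
  rewrite /= early// /C; set y := push k (q \o _) x.
  rewrite {1}/push addrAC subrr add0r normrZ.
  have [_ _ r3] := Hr p; rewrite (le_trans _ (r3 (y - ramp (u p) (u p.+1) Gam (y 0 j) *: delta_mx 0 k)))//.
  rewrite ler_piMr//; apply: rv_norm_le => // i; rewrite mxE eqxx/=.
  by case: (i == k); rewrite ?normr1 ?normr0.
have midk : Psi p.+1 x 0 k <= Gam - `|L|.
  have h1 := rv_dist_ge (Psi p.+1 x) (push k (q \o set_coord j (u p)) x) k.
  have h2 : `|push k (q \o set_coord j (u p)) x 0 k| <= M + B.
    rewrite push_eq (le_trans (ler_normD _ _))// lerD//.
      by rewrite (le_trans (rv_norm_ge _ _)).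
    by apply: HB; apply: set_coord_norm => //; exact: ub (ltnW pN).
  have h3 := le_trans h1 mid.
  have := le_trans (ler_norm _) h3; have := le_trans (ler_norm _) h2.
  rewrite /Gam; lra.
have PsiS l : Psi l.+1 x = C l (Psi l x) by [].
have late l : Psi (p.+1 + l)%N x = Psi p.+1 x.
  elim: l => [|l IHl]; first by rewrite addn0.
  rewrite addnS PsiS IHl.
  have yj := PsiE p.+1; move: (Psi p.+1 x) midk yj => y yk yj.
  rewrite {1}/C /push yj ramp_left; [|exact: ulu|].
    case: (Hr (p.+1 + l)%N) => -[_ r2 _] _ _; rewrite r2 ?scale0r ?addr0//.
    rewrite !mxE !eqxx/= mulr1 ler_normr; apply/orP; right.
    have := ler_norm L; lra.
  by rewrite (le_trans tp)// mono// leq_addr.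
have -> : Psi N x = Psi p.+1 x by rewrite -(subnKC pN) late.
have -> : push k q x - Psi p.+1 x = (push k q x - push k (q \o set_coord j (u p)) x) -
   (Psi p.+1 x - push k (q \o set_coord j (u p)) x) by rewrite opprB addrA subrK.
rewrite (le_trans (ler_normB _ _))//.
have h : `|push k q x - push k (q \o set_coord j (u p)) x| <= th * dl.
  rewrite (le_trans (push_dist _ _ _ _))// -{1}(set_coord_id j x) /=.
  rewrite (le_trans (sl _ _ _))// ler_wpM2l// ger0_norm ?subr_ge0//.
  by rewrite -(uS p) lerD2r.
rewrite (le_trans (lerD h mid))// (le_trans _ Ne)// -/dl; lra.
Qed.

End OneCoordinate.

(** * Maps close to the identity *)

Section NearIdentity.
Variables (R : realType) (d : nat) (F : set ('rV[R]_d -> 'rV[R]_d)).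
Hypothesis Frich : ridge_rich F.
Implicit Types (x y z : 'rV[R]_d).

(** With G_n = id + (p_0, ..., p_{n-1}, 0, ..., 0), the map G_{n+1} G_n^-1 changes only
    coordinate n. *)
Lemma approximable_near_identity (p : 'rV[R]_d -> 'rV[R]_d) (th L : R) :
  0 <= th <= 1 / 4 / 4 ^+ d ->
  (forall x y, `|p x - p y| <= th * `|x - y|) ->
  (forall x, L <= `|x| -> p x = 0) -> approximable F (fun x => x + p x).
Proof.
move=> /andP[th0 thd] pth pL.
have p4 : 1 <= 4 ^+ d :> R by rewrite exprn_ege1// ler1n.
have th4 : th <= 1 / 4.
  by rewrite (le_trans thd)// ler_pdivrMr ?exprn_gt0// ler_peMr.
have th2 : 0 <= 2 * th <= 1 / 2 / 4 ^+ d.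
  have E : (1 / 2 / 4 ^+ d : R) = 2 * (1 / 4 / 4 ^+ d) by field; rewrite expf_neq0.
  by rewrite E; lra.
pose pn n x : 'rV[R]_d := \row_j (if (j < n)%N then p x 0 j else 0).
have pnth n x y : `|pn n x - pn n y| <= th * `|x - y|.
  rewrite (le_trans _ (pth x y))//; apply: rv_norm_le => // j.
  rewrite !mxE; case: ifP => _; first exact: rv_dist_ge.
  by rewrite subrr normr0.
have th1 : 0 <= th < 1 by rewrite th0/=; lra.
suff H n : (n <= d)%N -> approximable F (fun x => x + pn n x).
  have := H d (leqnn d); congr approximable; apply/funext => x; congr (_ + _).
  by apply/rowP => j; rewrite !mxE ltn_ord.
elim: n => [_|n IH nd].
  have -> : (fun x => x + pn 0%N x) = id; last exact: approximable_id.
  by apply/funext => x; apply/rowP => j; rewrite !mxE addr0.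
have [g [g1 g2 g3]] := near_identity_inverse th1 (pnth n).
pose k := Ordinal nd; pose q z := p (g z) 0 k.
have -> : (fun x => x + pn n.+1 x) = push k q \o (fun x => x + pn n x).
  apply/funext => x /=; have gx : g (x + pn n x) = x by apply/esym/g2.
  apply/rowP => j; rewrite pushE /q gx !mxE -addrA ltnS; congr (_ + _).
  rewrite leq_eqVlt -[j == k]val_eqE/=; case: eqP => [jn|_] /=; last by rewrite addr0.
  have -> : j = k by apply/val_inj.
  by rewrite /= ltnn add0r.
apply: approximable_comp; last exact: IH (ltnW nd).
apply: (approximable_perturbation Frich th2 (L := L)); split.
- move=> x y; rewrite (le_trans (rv_dist_ge _ _ _))// (le_trans (pth _ _))//.
  have i2 : (1 - th)^-1 <= 2.
    rewrite -[leRHS]invrK lef_pV2 ?posrE; lra.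
  have h3 : `|g x - g y| <= 2 * `|x - y| by rewrite (le_trans (g3 _ _))// ler_wpM2r.
  by have := ler_wpM2l th0 h3; lra.
- move=> x xk; have px : p x = 0 by apply: pL; rewrite (le_trans xk)// rv_norm_ge.
  have gx : x = g x.
    by apply: g2; apply/rowP => j; rewrite !mxE px mxE if_same addr0.
  by rewrite /q -gx px mxE.
- by move=> x y H; congr q; apply/rowP => j; apply: H; rewrite ltn_ord.
Qed.

Definition clamp (r : R) x : 'rV[R]_d := \row_j Num.max (- r) (Num.min r (x 0 j)).

Lemma clamp_id r x : `|x| <= r -> clamp r x = x.
Proof.
move=> xr; apply/rowP => j; rewrite !mxE.
have := le_trans (rv_norm_ge x j) xr; rewrite ler_norml => /andP[h1 h2].
by rewrite min_r// max_r.
Qed.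

Lemma clamp_norm r x : 0 <= r -> `|clamp r x| <= r.
Proof.
move=> r0; apply: rv_norm_le => // j; rewrite !mxE ler_norml le_max lexx/=.
by rewrite ge_max ge_min lexx/= andbT; lra.
Qed.

Lemma clamp_lip r x y : 0 <= r -> `|clamp r x - clamp r y| <= `|x - y|.
Proof.
move=> r0; apply: rv_norm_le => // j; rewrite (le_trans _ (rv_dist_ge x y j))//.
rewrite !mxE; exact: le_trans (maxr_lip _ _ _) (minr_lip _ _ _).
Qed.

(** p is extended from the ball of radius r by the coordinatewise clamp, which
    does not increase sup norm distances, and multiplied by a cutoff. *)
Lemma approximable_near_identity_local (p : 'rV[R]_d -> 'rV[R]_d) (th r : R) :
  0 <= th -> 0 < r -> th * (1 + r) <= 1 / 4 / 4 ^+ d -> p 0 = 0 ->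
  (forall x y, `|x| <= r -> `|y| <= r -> `|p x - p y| <= th * `|x - y|) ->
  exists2 psi, approximable F psi & forall x, `|x| <= r -> psi x = x + p x.
Proof.
move=> th0 r0 thr p0 pth.
pose chi x : R := Num.min 1 (Num.max 0 (r + 1 - `|x|)).
have chi_lip x y : `|chi x - chi y| <= `|x - y|.
  rewrite (le_trans (minmax_lip _ _))//.
  have -> : r + 1 - `|x| - (r + 1 - `|y|) = `|y| - `|x| by ring.
  by rewrite [leRHS]distrC; exact: ler_dist_dist.
have chi0 x : 0 <= chi x <= 1.
  by rewrite /chi le_min ler01 le_max lexx/= ge_min lexx.
pose P x := chi x *: p (clamp r x).
exists (fun x => x + P x); last first.
  move=> x xr; rewrite /P clamp_id// /chi min_l ?scale1r// le_max.
  by apply/orP; right; lra.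
apply: (@approximable_near_identity _ (th * (1 + r)) (r + 1)).
- by rewrite thr andbT mulr_ge0//; lra.
- move=> x y; have -> : P x - P y = chi x *: (p (clamp r x) - p (clamp r y)) +
     (chi x - chi y) *: p (clamp r y).
    by rewrite /P scalerBr scalerBl addrA subrK.
  rewrite (le_trans (ler_normD _ _))// !normrZ.
  have /andP[c0 c1] := chi0 x; rewrite (ger0_norm c0).
  have cx := clamp_norm x (ltW r0); have cy := clamp_norm y (ltW r0).
  have h1 : `|p (clamp r x) - p (clamp r y)| <= th * `|x - y|.
    by rewrite (le_trans (pth _ _ cx cy))// ler_wpM2l// clamp_lip// ltW.
  have h2 : `|p (clamp r y)| <= th * r.
    have := pth _ 0 cy; rewrite p0 !subr0 normr0 => /(_ (ltW r0))/le_trans; apply.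
    by rewrite ler_wpM2l.
  have h3 : chi x * `|p (clamp r x) - p (clamp r y)| <= th * `|x - y|.
    by rewrite (le_trans _ h1)// ler_piMl.
  have h4 : `|chi x - chi y| * `|p (clamp r y)| <= `|x - y| * (th * r).
    by rewrite ler_pM.
  lra.
- move=> x xr; rewrite /P /chi max_l; last by lra.
  by rewrite min_r ?ler01// scale0r.
Qed.

End NearIdentity.

(** * Matrices with positive determinant *)

Section Generation.
Variable R : realFieldType.

Lemma det_transvection n (i j : 'I_n) (c : R) : i != j ->
  \det (1%:M + c *: delta_mx i j) = 1.
Proof.
have tr (a b : 'I_n) : (b < a)%N -> \det (1%:M + c *: delta_mx a b) = 1.
  move=> ba; rewrite det_trig.
    apply: big1 => k _; rewrite !mxE eqxx; case: (eqVneq k a) => [->|_].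
      by case: eqVneq => [E|_]; [rewrite E ltnn in ba|rewrite mulr0 addr0].
    by rewrite mulr0 addr0.
  apply/is_trig_mxP => k l kl; rewrite !mxE.
  have -> : (k == l) = false by apply/negbTE; rewrite -val_eqE/= ltn_eqF.
  case: (eqVneq k a) => [ka|_]; last by rewrite mulr0 addr0.
  case: (eqVneq l b) => [lb|_]; last by rewrite mulr0 addr0.
  by move: kl; rewrite ka lb ltnNge ltnW.
move=> ij; case: (ltngtP i j) => [h|h|h]; last by rewrite (val_inj h) eqxx in ij.
  by rewrite -det_tr linearD/= linearZ/= trmx1 trmx_delta tr.
exact: tr.
Qed.

Lemma transvectionK n (i j : 'I_n) (c : R) (J : 'M[R]_n) : i != j ->
  J = (1%:M + - c *: delta_mx i j) *m ((1%:M + c *: delta_mx i j) *m J).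
Proof.
move=> ij; rewrite mulmxA mulmxDl mul1mx mulmxDr mulmx1 -scalemxAl -scalemxAr.
rewrite mul_delta_mx_0 1?eq_sym// !scaler0 addr0.
by rewrite scaleNr addrK mul1mx.
Qed.

Lemma transvectionE n (i j k l : 'I_n) (c : R) (J : 'M[R]_n) :
  ((1%:M + c *: delta_mx i j) *m J) k l = J k l + c * J j l *+ (k == i).
Proof.
rewrite mulmxDl mul1mx -scalemxAl mxE [X in _ + X]mxE; congr (_ + _).
rewrite mxE (bigD1 j)//= big1 ?addr0.
  by rewrite mxE eqxx andbT; case: (k == i); rewrite ?mul1r ?mul0r ?mulr0.
by move=> m mj; rewrite mxE (negbTE mj) andbF mul0r.
Qed.

Definition generating n (P : 'M[R]_n -> Prop) :=
  [/\ P 1%:M, forall A B, P A -> P B -> P (A *m B),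
    forall i j c, i != j -> P (1%:M + c *: delta_mx i j) &
    forall i a, 0 < a -> P (1%:M + (a - 1) *: delta_mx i i)].

Lemma generating_sum n (P : 'M[R]_n -> Prop) (T : Type) (r : seq T) (c : T -> R)
    (a b : T -> 'I_n) : generating P -> (forall k l, b k != a l) ->
  P (1%:M + \sum_(k <- r) c k *: delta_mx (a k) (b k)).
Proof.
move=> [P1 PM Pt _] ab; elim: r => [|k r IH]; first by rewrite big_nil addr0.
rewrite big_cons.
have -> : 1%:M + (c k *: delta_mx (a k) (b k) + \sum_(j <- r) c j *: delta_mx (a j) (b j)) =
   (1%:M + c k *: delta_mx (a k) (b k)) *m
   (1%:M + \sum_(j <- r) c j *: delta_mx (a j) (b j)).
  have E0 : delta_mx (a k) (b k) *m (\sum_(j <- r) c j *: delta_mx (a j) (b j)) = 0.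
    by rewrite mulmx_sumr big1// => j _; rewrite -scalemxAr mul_delta_mx_0// scaler0.
  rewrite mulmxDl mul1mx mulmxDr mulmx1 -scalemxAl E0 scaler0 addr0 -addrA.
  by congr (_ + _); exact: addrC.
by apply: PM => //; apply: Pt; rewrite eq_sym.
Qed.

(** Gauss elimination.  Once the corner entry is 1, the matrix is a product of a
    lower unipotent, a block diagonal and an upper unipotent matrix, and the induction
    applies to the lower right block.  The corner is made 1 by adding to the first row
    a multiple of another row with a nonzero first entry. *)
Lemma det_pos_generation n (P : 'M[R]_n -> Prop) : generating P ->
  forall J, 0 < \det J -> P J.
Proof.
elim: n P => [|n IH] P Pgen J J0.
  by have [P1 _ _ _] := Pgen; rewrite (_ : J = 1%:M)//; apply/matrixP => -[].
have [P1 PM Pt Pd] := Pgen.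
have normalized (A : 'M[R]_(1 + n)) : A 0 0 = 1 -> 0 < \det A -> P A.
  move=> A00 A0; pose u := ursubmx A; pose v := dlsubmx A; pose B := drsubmx A.
  have AE : A = block_mx 1%:M 0 v 1%:M *m (block_mx 1%:M 0 0 (B - v *m u) *m
        block_mx 1%:M u 0 1%:M).
    rewrite !mulmx_block !mul1mx !mulmx1 !mul0mx !mulmx0 !addr0 !add0r addrCA subrr addr0.
    rewrite -[LHS]submxK; congr block_mx.
      by apply/matrixP => i j; rewrite !ord1 !mxE !lshift0 A00.
    by rewrite mulmx1.
  have dB : \det A = \det (B - v *m u).
    rewrite [in LHS]AE !det_mulmx det_lblock det_ublock !det_ublock det1 !mul1r.
    by rewrite !det1 !mul1r mulr1.
  rewrite AE; apply: (PM _ _) => //; last apply: (PM _ _) => //.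
  - have -> : block_mx 1%:M 0 v 1%:M =
      1%:M + \sum_i v i 0 *: delta_mx (rshift 1 i) (lshift n 0) :> 'M[R]_(1 + n).
      rewrite (scalar_mx_block 1 n 1).
      apply/matrixP => i j; rewrite [RHS]mxE summxE.
      rewrite -[i]splitK -[j]splitK.
      case: (fintype.split i) => i' /=; case: (fintype.split j) => j' /=.
      + rewrite !block_mxEul big1 ?addr0// => k _; rewrite !mxE.
        by rewrite eq_lrshift mulr0.
      + rewrite !block_mxEur big1 ?addr0// => k _; rewrite !mxE.
        by rewrite eq_lrshift mulr0.
      + rewrite !block_mxEdl (bigD1 i')//= big1 ?addr0.
          by rewrite !mxE !eqxx !ord1 eqxx mulr1 add0r.
        by move=> k ki; rewrite !mxE eq_rshift eq_sym (negbTE ki) mulr0.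
      + rewrite !block_mxEdr big1 ?addr0// => k _; rewrite !mxE.
        by rewrite eq_rlshift andbF mulr0.
    by apply: generating_sum => // k l; rewrite eq_lrshift.
  - apply: (IH (fun X : 'M[R]_n => P (block_mx (1%:M : 'M[R]_1) 0 0 X)) _ (B - v *m u)); last by rewrite -dB.
    have sh (i j : 'I_n) c : block_mx 1%:M 0 0 (1%:M + c *: delta_mx i j) =
        1%:M + c *: delta_mx (rshift 1 i) (rshift 1 j) :> 'M[R]_(1 + n).
      rewrite (scalar_mx_block 1 n 1).
      apply/matrixP => k l; rewrite -[k]splitK -[l]splitK.
      case: (fintype.split k) => k' /=; case: (fintype.split l) => l' /=; rewrite [RHS]mxE.
      + by rewrite !block_mxEul !mxE eq_lrshift mulr0 addr0.
      + by rewrite !block_mxEur !mxE eq_lrshift mulr0 addr0.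
      + by rewrite !block_mxEdl !mxE eq_lrshift andbF mulr0 addr0.
      + by rewrite !block_mxEdr !mxE !eq_rshift.
    split=> [|A' B' HA HB|i j c ij|i a a0].
    + by rewrite -(scalar_mx_block 1 n 1).
    + have <- : block_mx (1%:M : 'M[R]_1) 0 0 A' *m block_mx 1%:M 0 0 B' =
          block_mx 1%:M 0 0 (A' *m B').
        by rewrite mulmx_block !mul1mx !mulmx0 !mul0mx !addr0 add0r.
      exact: PM.
    + by rewrite sh; apply: Pt; apply: contra_neq ij => /(congr1 val)/addnI/val_inj.
    + by rewrite sh; apply: Pd.
  - have -> : block_mx 1%:M u 0 1%:M =
      1%:M + \sum_i u 0 i *: delta_mx (lshift n 0) (rshift 1 i) :> 'M[R]_(1 + n).
      rewrite (scalar_mx_block 1 n 1).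
      apply/matrixP => i j; rewrite [RHS]mxE summxE.
      rewrite -[i]splitK -[j]splitK.
      case: (fintype.split i) => i' /=; case: (fintype.split j) => j' /=.
      + rewrite !block_mxEul big1 ?addr0// => k _; rewrite !mxE.
        by rewrite eq_lrshift andbF mulr0.
      + rewrite !block_mxEur (bigD1 j')//= big1 ?addr0.
          by rewrite !mxE !eqxx !ord1 eqxx mulr1 add0r.
        by move=> k ki; rewrite !mxE eq_rshift [j' == k]eq_sym (negbTE ki) andbF mulr0.
      + rewrite !block_mxEdl big1 ?addr0// => k _; rewrite !mxE.
        by rewrite eq_rlshift mulr0.
      + rewrite !block_mxEdr big1 ?addr0// => k _; rewrite !mxE.
        by rewrite eq_rlshift mulr0.
    by apply: generating_sum => // k l; rewrite eq_rlshift.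
have offdiag (A : 'M[R]_(1 + n)) i : i != 0 -> A i 0 != 0 -> 0 < \det A -> P A.
  move=> i0 Ai A0; pose c := (1 - A 0 0) / A i 0.
  have i0' : 0 != i by rewrite eq_sym.
  rewrite (transvectionK c A i0'); apply: PM; first exact: Pt.
  apply: normalized; last by rewrite det_mulmx det_transvection// mul1r.
  by rewrite transvectionE eqxx mulr1n /c divfK// addrC subrK.
case: n IH P J J0 Pgen P1 PM Pt Pd normalized offdiag => [|n] IH P J J0 Pgen P1 PM Pt Pd normalized offdiag.
  rewrite det_mx11 in J0; have -> : J = 1%:M + (J 0 0 - 1) *: delta_mx 0 0.
    by apply/matrixP => i j; rewrite !ord1 !mxE !eqxx/= mulr1 addrC subrK.
  exact: Pd.
case: (boolP [exists i, (i != 0) && (J i 0 != 0)]) => [/existsP[i /andP[i0 Ji]]|H].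
  exact: offdiag i0 Ji J0.
have Hi i : i != 0 -> J i 0 = 0.
  move=> i0; apply/eqP; apply: contraT => Ji; move/negP: H => [].
  by apply/existsP; exists i; rewrite i0 Ji.
have J00 : J 0 0 != 0.
  apply: contraTneq J0 => J00; rewrite (expand_det_col J 0) big1 ?ltxx// => i _.
  by have [->|i0] := eqVneq i 0; rewrite ?J00 ?Hi// mul0r.
pose i1 : 'I_n.+2 := lift ord0 ord0.
have i10 : i1 != 0 by [].
rewrite (transvectionK 1 J i10); apply: PM; first exact: Pt.
apply: (offdiag _ i1) => //; last by rewrite det_mulmx det_transvection// mul1r.
by rewrite transvectionE eqxx mulr1n mul1r Hi// add0r.
Qed.

End Generation.

(** * Affine maps *)

Section Affine.
Variables (R : realType) (d : nat) (F : set ('rV[R]_d -> 'rV[R]_d)).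
Hypothesis Frich : ridge_rich F.

Lemma mul_row_delta (x : 'rV[R]_d) (i j : 'I_d) :
  x *m delta_mx i j = x 0 i *: delta_mx 0 j.
Proof.
apply/rowP => k; rewrite !mxE (bigD1 i)//= big1 ?addr0.
  by rewrite mxE !eqxx.
by move=> m mi; rewrite mxE (negbTE mi) mulr0.
Qed.

Lemma approximable_linear (J : 'M[R]_d) : 0 < \det J -> approximable F (fun x => x *m J).
Proof.
apply: (det_pos_generation (P := fun J => approximable F (fun x => x *m J))); split.
- have -> : (fun x : 'rV[R]_d => x *m 1%:M) = id; last exact: approximable_id.
  by apply/funext => x; rewrite mulmx1.
- move=> A B HA HB; have := approximable_comp HB HA; congr approximable.
  by apply/funext => x /=; rewrite mulmxA.
- move=> i j c ij; have := approximable_shear Frich (i := j) (j := i) (G := fun t => c * t) ij.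
  have -> : push j (fun x : 'rV[R]_d => c * x 0 i) = (fun x => x *m (1%:M + c *: delta_mx i j)).
    apply/funext => x; rewrite mulmxDr mulmx1 -scalemxAr /push -scalerA; congr (_ + _ *: _).
    by rewrite mul_row_delta.
  apply; apply: (@lip_lip_on_balls _ _ _ _ `|c|) => x y; by rewrite -mulrBr normrM.
- move=> i a a0; have := approximable_monotone Frich i (m := fun t => a * t).
  have -> : push i (fun x : 'rV[R]_d => a * x 0 i - x 0 i) =
     (fun x => x *m (1%:M + (a - 1) *: delta_mx i i)).
    apply/funext => x; rewrite mulmxDr mulmx1 -scalemxAr /push.
    have -> : a * x 0 i - x 0 i = (a - 1) * x 0 i by ring.
    rewrite -scalerA; congr (_ + _ *: _).
    by rewrite mul_row_delta.
  apply; first by move=> x y xy; rewrite ltr_pM2l.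
  apply: (@lip_lip_on_balls _ _ _ _ `|a|) => x y; by rewrite -mulrBr normrM.
Qed.

Lemma approximable_translation (a : 'rV[R]_d) : approximable F (fun x => x + a).
Proof.
rewrite [a]row_sum_delta; elim: (index_enum _) => [|i r IH].
  have -> : (fun x : 'rV[R]_d => x + \sum_(j <- [::]) a 0 j *: delta_mx 0 j) = id; last exact: approximable_id.
  by apply/funext => x; rewrite big_nil addr0.
have -> : (fun x : 'rV[R]_d => x + \sum_(j <- i :: r) a 0 j *: delta_mx 0 j) =
   (fun x : 'rV[R]_d => x + \sum_(j <- r) a 0 j *: delta_mx 0 j) \o
   push i (fun x => x 0 i + a 0 i - x 0 i).
  apply/funext => x /=; rewrite big_cons /push addrA; congr (_ + _ *: _ + _).
  by ring.
apply: approximable_comp IH _; apply: (approximable_monotone Frich i (m := fun t => t + a 0 i)).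
  by move=> x y xy; rewrite ltrD2r.
by apply: (@lip_lip_on_balls _ _ _ _ 1) => x y; rewrite mul1r opprD addrACA subrr addr0.
Qed.

End Affine.

(** * C1 maps and their dilations *)

Section C1Maps.
Variables (R : realType) (d : nat).
Implicit Types (g : 'rV[R]_d -> 'rV[R]_d) (x y z : 'rV[R]_d).

Lemma closed_ball_compact (M : R) : compact [set x : 'rV[R]_d | `|x| <= M].
Proof.
apply: bounded_closed_compact; last exact: closed_norm_le.
exists M; split; first exact: num_real.
by move=> N MN x /= xM; rewrite (le_trans xM)// ltW.
Qed.

(** Uniform continuity at the points of a compact set, with the second point
    arbitrary. *)
Lemma heine_cantor_norm (V W : normedModType R) (J : V -> W) (K : set V) (e : R) :
  compact K -> continuous J -> 0 < e ->
  exists2 dl : R, 0 < dl & forall x y : V, K x -> `|x - y| <= dl -> `|J x - J y| <= e.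
Proof.
move=> cK cJ e0.
have /compact_near_coveringP H := cK.
pose P (dl : R) (x : V) := forall y : V, `|x - y| <= dl -> `|J x - J y| <= e.
have := H R (0^'+) P _.
have near_loc : forall x : V, K x -> \forall x' \near x & dl \near 0^'+, P dl x'.
  move=> x Kx; have e20 : 0 < e / 2 by rewrite divr_gt0.
  have /cvgrPdist_le/(_ _ e20)/nbhs_ballP[r /= r0 Hr] := cJ x.
  have Hr' (y : V) : `|x - y| < r -> `|J x - J y| <= e / 2.
    by move=> xy; apply: Hr; rewrite -ball_normE.
  exists ([set x' | `|x - x'| < r / 2], [set dl | dl < r / 2]).
    split; last by apply: nbhs_right_lt; rewrite divr_gt0.
    apply/nbhs_ballP; exists (r / 2); first by rewrite /= divr_gt0.
    by move=> y; rewrite -ball_normE.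
  move=> [x' dl] /= [xx' dlr] y x'y.
  have h1 : `|J x - J x'| <= e / 2 by apply: Hr'; lra.
  have h2 : `|J x - J y| <= e / 2.
    apply: Hr'; have -> : x - y = (x - x') + (x' - y) by rewrite addrA subrK.
    by rewrite (le_lt_trans (ler_normD _ _))//; lra.
  have -> : J x' - J y = (J x - J y) - (J x - J x') by rewrite opprB [RHS]addrC addrA subrK.
  by rewrite (le_trans (ler_normB _ _))//; lra.
move=> /(_ _ near_loc) Hn.
near (0 : R)^'+ => dl.
exists dl; first by near: dl; exact: nbhs_right_gt.
have Kdl : K `<=` P dl by near: dl; exact: Hn.
by move=> x y Kx; exact: Kdl.
Unshelve. all: by end_near. Qed.

Lemma is_derive_component (h : R -> 'rV[R]_d) (t : R) (dh : 'rV[R]_d) k :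
  is_derive t 1 h dh -> is_derive t 1 (fun t => h t 0 k) (dh 0 k).
Proof.
move=> [Dh Eh]; apply: DeriveDef.
  by move/derivable_mxP: Dh => /(_ 0 k).
by rewrite -Eh derive_mx// mxE.
Qed.

Lemma row_mean_value (h dh : R -> 'rV[R]_d) (M : R) :
  (forall t : R, is_derive t 1 h (dh t)) -> 0 <= M ->
  (forall t, 0 <= t <= 1 -> `|dh t| <= M) -> `|h 1 - h 0| <= M.
Proof.
move=> Hh M0 HM; apply: rv_norm_le => // k; rewrite mxE [X in _ + X]mxE.
have D : has_derivative (fun t => h t 0 k) (fun t => dh t 0 k).
  by move=> t; exact: is_derive_component.
have := has_derivative_bound (a := 0) (b := 1) (M := M) D.
rewrite subr0 normr1 mulr1; apply => t; rewrite min_l ?max_r// => t01.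
by rewrite (le_trans (rv_norm_ge _ _))// HM.
Qed.

Lemma is_derive_path g (phi : R -> 'rV[R]_d) (t : R) (w : 'rV[R]_d) :
  is_derive t 1 phi w -> differentiable g (phi t) ->
  is_derive t 1 (g \o phi) (w *m jacobian g (phi t)).
Proof.
move=> [Dphi Ephi] Dg.
have Dphi' : differentiable phi t by apply/derivable1_diffP.
have Dc : differentiable (g \o phi) t by exact: differentiable_comp.
apply: DeriveDef; first exact: diff_derivable.
rewrite (deriveE _ Dc) diff_comp//= -(deriveE _ Dphi') Ephi.
by rewrite -deriveEjacobian// deriveE.
Qed.

(** The difference quotients of g at 0, extended to t = 0 by the derivative. *)
Definition dilation g (t : R) x : 'rV[R]_d :=
  if t == 0 then x *m jacobian g 0 else t^-1 *: (g (t *: x) - g 0).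

Section Dilation.
Variable g : 'rV[R]_d -> 'rV[R]_d.
Hypothesis gC1 : C1_map g.

Lemma dilation0 t : dilation g t 0 = 0.
Proof. by rewrite /dilation; case: ifP => _; rewrite ?mul0mx// scaler0 subrr scaler0. Qed.

(** One formula for all t, including t = 0: estimates on the Jacobian thus pass
    to the whole isotopy, uniformly in t. *)
Lemma dilation_derive (t : R) x z (u : R) :
  is_derive u 1 (fun u => dilation g t (x + u *: z))
    (z *m jacobian g (t *: (x + u *: z))).
Proof.
have [Dg _] := gC1; rewrite /dilation; case: eqP => [->|/eqP t0].
  rewrite scale0r.
  have -> : (fun u => (x + u *: z) *m jacobian g 0) =
      (fun u => x *m jacobian g 0 + (id u) *: (z *m jacobian g 0)).
    by apply/funext => v; rewrite mulmxDl -scalemxAl.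
  by rewrite -[X in is_derive _ _ _ X]scale1r; apply: is_derive_along; exact: is_derive_id.
have H : is_derive u 1 (fun u => t *: x + u *: (t *: z)) (t *: z).
  by rewrite -[X in is_derive _ _ _ X]scale1r; apply: is_derive_along; exact: is_derive_id.
have E v : t *: (x + v *: z) = t *: x + v *: (t *: z).
  by rewrite scalerDr !scalerA mulrC.
have D1 := is_derive_path H (Dg _).
have := is_deriveZ t^-1 (is_deriveB D1 (is_derive_cst (g 0) u 1)).
have cancel_t (A : 'M[R]_d) : t^-1 *: ((t *: z) *m A) = z *m A.
  by rewrite -scalemxAl scalerA mulVf// scale1r.
rewrite subr0 cancel_t E.
by congr is_derive; apply/funext => v /=; rewrite E.
Qed.

Lemma segment_norm x y (M t : R) : `|x| <= M -> `|y| <= M -> 0 <= t <= 1 ->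
  `|x + t *: (y - x)| <= M.
Proof.
move=> xM yM /andP[t0 t1].
have -> : x + t *: (y - x) = (1 - t) *: x + t *: y.
  by apply/rowP => j; rewrite !mxE; ring.
rewrite (le_trans (ler_normD _ _))// !normrZ (ger0_norm t0) ger0_norm ?subr_ge0//.
have h1 : (1 - t) * `|x| <= (1 - t) * M by rewrite ler_wpM2l// subr_ge0.
have h2 : t * `|y| <= t * M by rewrite ler_wpM2l.
lra.
Qed.

Lemma dilation_lip (M : R) : exists2 C : R, 0 <= C & forall t x y, 0 <= t <= 1 ->
  `|x| <= M -> `|y| <= M -> `|dilation g t x - dilation g t y| <= C * `|x - y|.
Proof.
have [_ cJ] := gC1.
have [B0 [_ HB0]] : bounded_set (jacobian g @` [set x | `|x| <= M]).
  apply: compact_bounded; apply: continuous_compact; last exact: closed_ball_compact.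
  exact: continuous_subspaceT.
pose B : R := `|B0| + 1.
have HB x : `|x| <= M -> `|jacobian g x| <= B.
  by move=> xM; apply: (HB0 B); [rewrite /B (le_lt_trans (ler_norm _))// ltrDl|exists x].
have B00 : 0 <= B by rewrite addr_ge0.
exists (d%:R * B); first by rewrite mulr_ge0.
move=> t x y t01 xM yM; have [t0 t1] := andP t01.
have := @row_mean_value _ _ (d%:R * B * `|x - y|) (fun u => dilation_derive t y (x - y) u).
rewrite scale1r scale0r addr0 [y + (x - y)]addrC subrK; apply.
  by rewrite !mulr_ge0.
move=> u u01; rewrite (le_trans (mulmx_norm _ _))// ler_wpM2r// ler_wpM2l//.
apply: HB; rewrite normrZ (ger0_norm t0) (le_trans _ (segment_norm yM xM u01))//.
by rewrite ler_piMl.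
Qed.

Lemma C1_lip_on_balls : lip_on_balls g.
Proof.
move=> M; have [C _ HC] := dilation_lip M; exists C => x y xM yM.
have := HC 1 x y; rewrite ler01 lexx => /(_ isT xM yM).
by rewrite /dilation oner_eq0 invr1 !scale1r opprB addrA subrK.
Qed.

(** The derivatives at x of the dilations of parameters s and t are the Jacobians
    at s x and t x, which are uniformly close. *)
Lemma dilation_equicontinuous (M e : R) : 0 < e ->
  exists2 dl : R, 0 < dl & forall s t, 0 <= s <= 1 -> 0 <= t <= 1 -> `|s - t| <= dl ->
    forall x y, `|x| <= M -> `|y| <= M ->
    `|(dilation g s x - dilation g t x) - (dilation g s y - dilation g t y)|
      <= e * `|x - y|.
Proof.
move=> e0; have [_ cJ] := gC1.
pose e1 : R := e / (d%:R + 1).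
have d1 : 0 < d%:R + 1 :> R by rewrite ltr_wpDl.
have e10 : 0 < e1 by rewrite divr_gt0.
have de : d%:R * e1 <= e.
  by rewrite /e1 mulrCA ger_pMr// ler_pdivrMr// mul1r lerDl.
have [dl dl0 Hdl] := heine_cantor_norm (@closed_ball_compact M) cJ e10.
pose M1 : R := `|M| + 1.
have M10 : 0 < M1 by rewrite ltr_wpDl.
exists (dl / M1); first by rewrite divr_gt0.
move=> s t s01 t01; rewrite ler_pdivlMr// => st x y xM yM.
pose h u := dilation g s (y + u *: (x - y)) - dilation g t (y + u *: (x - y)).
have Hh (u : R) : is_derive u 1 h ((x - y) *m jacobian g (s *: (y + u *: (x - y))) -
     (x - y) *m jacobian g (t *: (y + u *: (x - y)))).
  exact: is_deriveB (dilation_derive s y (x - y) u) (dilation_derive t y (x - y) u).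
have := @row_mean_value h _ (e * `|x - y|) Hh.
rewrite /h scale1r scale0r addr0 [y + (x - y)]addrC subrK; apply.
  by rewrite mulr_ge0// ltW.
move=> u u01; rewrite -mulmxBr (le_trans (mulmx_norm _ _))// ler_wpM2r//.
rewrite (le_trans _ de)// ler_wpM2l//.
have pM := segment_norm yM xM u01; have [s0 s1] := andP s01.
apply: Hdl.
  by rewrite /= normrZ (ger0_norm s0) (le_trans _ pM)// ler_piMl.
rewrite -scalerBl normrZ (le_trans _ st)// ler_wpM2l//.
by rewrite (le_trans pM)// (le_trans (ler_norm _))// lerDl.
Qed.

End Dilation.
End C1Maps.

(** * Diffeomorphisms *)

Section Diffeomorphisms.
Variables (R : realType) (d : nat) (F : set ('rV[R]_d -> 'rV[R]_d)).
Hypothesis Frich : ridge_rich F.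

Variables (g g' : 'rV[R]_d -> 'rV[R]_d).
Hypotheses (gC1 : C1_map g) (g'C1 : C1_map g') (gK : cancel g g') (g'K : cancel g' g).
Let J0 := jacobian g 0.
Hypothesis J0u : J0 \in unitmx.

(** An isotopy from the identity to g, up to an affine map. *)
Definition normalized (t : R) x := dilation g t x *m invmx J0.

Lemma normalized_start x : normalized 0 x = x.
Proof. by rewrite /normalized /dilation eqxx mulmxK. Qed.

Lemma normalized_origin t : normalized t 0 = 0.
Proof. by rewrite /normalized dilation0 mul0mx. Qed.

Lemma normalized_end x : normalized 1 x *m J0 + g 0 = g x.
Proof.
by rewrite /normalized mulmxKV// /dilation oner_eq0 invr1 !scale1r subrK.
Qed.

Lemma normalized_surj t y : exists x, normalized t x = y.
Proof.
have [->|t0] := eqVneq t 0; first by exists y; rewrite normalized_start.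
exists (t^-1 *: g' (t *: (y *m J0) + g 0)).
rewrite /normalized /dilation (negbTE t0) scalerA divff// scale1r g'K addrK.
by rewrite scalerA mulVf// scale1r mulmxK.
Qed.

(** The inverse of the map of parameter t is the similarly rescaled inverse
    of g, so it is Lipschitz on balls with a constant that does not depend on t. *)
Lemma normalized_expand (M : R) : exists2 C : R, 0 < C & forall t x y, 0 <= t <= 1 ->
  `|normalized t x| <= M -> `|normalized t y| <= M ->
  `|x - y| <= C * `|normalized t x - normalized t y|.
Proof.
pose c : R := d%:R * `|J0|; have c0 : 0 <= c by rewrite mulr_ge0.
have Hc z : `|z *m J0| <= c * `|z| := mulmx_norm z J0.
have [D D0 HD] := lip_on_balls_pos (c * `|M| + `|g 0|) (C1_lip_on_balls g'C1).
have cD : 0 <= D * c by rewrite mulr_ge0// ltW.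
exists (D * c + 1); first by lra.
move=> t x y /andP[t0 t1] xM yM.
have [->|tn0] := eqVneq t 0.
  by rewrite !normalized_start ler_peMl//; lra.
have tp : 0 < t by rewrite lt_neqAle eq_sym tn0.
have E z : t *: z = g' (t *: (normalized t z *m J0) + g 0).
  rewrite /normalized mulmxKV// /dilation (negbTE tn0) scalerA divff// scale1r.
  by rewrite subrK gK.
have bd z : `|normalized t z| <= M -> `|t *: (normalized t z *m J0) + g 0| <= c * `|M| + `|g 0|.
  move=> zM; rewrite (le_trans (ler_normD _ _))// lerD2r normrZ (ger0_norm t0).
  rewrite (le_trans (y := `|normalized t z *m J0|)) ?ler_piMl//.
  by rewrite (le_trans (Hc _))// ler_wpM2l// (le_trans zM)// ler_norm.
have := HD _ _ (bd _ xM) (bd _ yM); rewrite -!E.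
have -> : t *: (normalized t x *m J0) + g 0 - (t *: (normalized t y *m J0) + g 0) =
    t *: ((normalized t x - normalized t y) *m J0).
  by rewrite opprD addrACA subrr addr0 -scalerBr mulmxBl.
rewrite -scalerBr !normrZ (ger0_norm t0) mulrCA ler_pM2l// => /le_trans; apply.
rewrite mulrDl mul1r -mulrA (le_trans (ler_wpM2l (ltW D0) (Hc _)))//.
by rewrite lerDl.
Qed.

(** [0, 1] is cut into n steps such that each transition from time t to time s is
    id + p on a ball containing all trajectories, with p as small as
    [approximable_near_identity_local] requires. *)
Lemma approximable_normalized (M : R) : exists2 psi, approximable F psi &
  forall x, `|x| <= M -> psi x = normalized 1 x.
Proof.
pose c : R := d%:R * `|invmx J0| + 1; have cp : 0 < c by rewrite ltr_wpDl// mulr_ge0.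
have Hc (z : 'rV[R]_d) : `|z *m invmx J0| <= c * `|z|.
  by rewrite (le_trans (mulmx_norm _ _))// ler_wpM2r// lerDl.
pose M0 : R := `|M|; have M00 : 0 <= M0 := normr_ge0 _.
have [C1 C10 HC1] := dilation_lip gC1 M0.
pose r : R := c * (C1 * M0) + 1.
have r0 : 0 < r by rewrite ltr_wpDl// mulr_ge0 ?(ltW cp)// mulr_ge0.
have Gr t x : 0 <= t <= 1 -> `|x| <= M0 -> `|normalized t x| <= r.
  move=> t01 xM; rewrite (le_trans (Hc _))//.
  have := HC1 t x 0 t01 xM; rewrite normr0 dilation0 !subr0 => /(_ M00) h.
  have : C1 * `|x| <= C1 * M0 by rewrite ler_wpM2l.
  move=> /(le_trans h) h2; have := ler_wpM2l (ltW cp) h2; rewrite /r; lra.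
have [C C0 HC] := normalized_expand r.
pose M2 : R := C * r.
pose thr : R := 1 / 4 / 4 ^+ d.
have thr0 : 0 < thr by rewrite !divr_gt0// exprn_gt0.
have r1 : 0 < 1 + r by rewrite addr_gt0.
(* C and c are the Lipschitz constants of the two maps composed with the
   difference of dilations in p. *)
pose e : R := thr / (1 + r) / C / c.
have e0 : 0 < e by rewrite !divr_gt0.
have [dl dl0 Hdl] := dilation_equicontinuous gC1 M2 e0.
have [n [n0 nd]] := fine_grid (ltr01 : 0 < 1 :> R) (ltr01 : 0 < 1 :> R) dl0.
have n0' : 0 < n%:R :> R by rewrite ltr0n.
have H l : (l <= n)%N -> exists2 psi, approximable F psi &
    forall x, `|x| <= M0 -> psi x = normalized (l%:R / n%:R) x.
  elim: l => [_|l IH ln].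
    by exists id; [exact: approximable_id|move=> x _; rewrite mul0r normalized_start].
  have [psi Gpsi Epsi] := IH (ltnW ln).
  pose t := l%:R / n%:R : R; pose s := l.+1%:R / n%:R : R.
  have t01 : 0 <= t <= 1.
    by rewrite divr_ge0//= ler_pdivrMr// mul1r ler_nat ltnW.
  have s01 : 0 <= s <= 1.
    by rewrite divr_ge0//= ler_pdivrMr// mul1r ler_nat.
  have st : `|s - t| <= dl.
    rewrite /s /t -mulrBl -natr1 addrAC subrr add0r ger0_norm.
      by have : 0 <= 1 / n%:R :> R by []; move: nd; lra.
    by rewrite divr_ge0.
  have /choice[inv Hinv] y := normalized_surj t y.
  have inv_lip x y : `|x| <= r -> `|y| <= r -> `|inv x - inv y| <= C * `|x - y|.
    by move=> xr yr; have := HC t (inv x) (inv y) t01; rewrite !Hinv; apply.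
  have inv0 : inv 0 = 0.
    apply/eqP; rewrite -subr_eq0 -normr_le0.
    have := HC t (inv 0) 0 t01; rewrite Hinv normalized_origin subrr normr0 mulr0.
    by apply; exact: ltW.
  have inv_norm x : `|x| <= r -> `|inv x| <= M2.
    move=> xr; have := inv_lip x 0 xr; rewrite normr0 inv0 !subr0 => /(_ (ltW r0)).
    by move=> /le_trans; apply; rewrite ler_pM2l.
  pose p y := normalized s (inv y) - y.
  have [||||chi Gchi Echi] := @approximable_near_identity_local R d F Frich p (thr / (1 + r)) r _ r0.
  - by rewrite divr_ge0// ltW.
  - by rewrite divfK// gt_eqF.
  - by rewrite /p inv0 normalized_origin subrr.
  - move=> x y xr yr.
    have E : p x - p y = ((dilation g s (inv x) - dilation g t (inv x)) -
        (dilation g s (inv y) - dilation g t (inv y))) *m invmx J0.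
      by rewrite /p -{2}(Hinv x) -{2}(Hinv y) /normalized !mulmxBl.
    rewrite E (le_trans (Hc _))//.
    have h1 := Hdl s t s01 t01 st _ _ (inv_norm x xr) (inv_norm y yr).
    have h2 := ler_wpM2l (ltW e0) (inv_lip x y xr yr).
    have h3 := ler_wpM2l (ltW cp) (le_trans h1 h2).
    rewrite (le_trans h3)// le_eqVlt; apply/orP; left; apply/eqP.
    by rewrite /e; field; rewrite !gt_eqF.
  exists (chi \o psi); first exact: approximable_comp.
  move=> x xM /=; rewrite Epsi// -/t Echi; last exact: Gr.
  rewrite /p addrC subrK -/s; congr normalized.
  have xr := Gr t x t01 xM.
  apply/eqP; rewrite -subr_eq0 -normr_le0.
  have := HC t (inv (normalized t x)) x t01; rewrite Hinv subrr normr0 mulr0.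
  by apply.
have [psi Gpsi Epsi] := H n (leqnn n).
exists psi => // x xM; rewrite Epsi ?divff ?gt_eqF//.
exact: le_trans xM (ler_norm _).
Qed.

End Diffeomorphisms.

Lemma ridge_rich_UAP (R : realType) (d : nat) (F : set ('rV[R]_d -> 'rV[R]_d)) :
  ridge_rich F -> UAP F.
Proof.
move=> Frich Omega g e cO [gC1 [g' [g'C1 gK g'K]] gdet] e0.
have J0u : jacobian g 0 \in unitmx by rewrite unitmxE unitfE gt_eqF.
have [M0 [_ HM0]] := compact_bounded cO.
have OM x : Omega x -> `|x| <= `|M0| + 1.
  move=> Ox; have M1 : M0 < `|M0| + 1 by rewrite (le_lt_trans (ler_norm _))// ltrDl.
  exact: (HM0 _ M1).
have [psi Gpsi Epsi] := approximable_normalized Frich gC1 g'C1 gK g'K J0u (`|M0| + 1).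
have [_ H] := approximable_comp (approximable_translation Frich (g 0))
  (approximable_comp (approximable_linear Frich (gdet 0)) Gpsi).
have [phi Hphi Ephi] := H (`|M0| + 1) e e0.
exists phi; split=> // x Ox; have := Ephi x (OM x Ox).
rewrite /= Epsi; last exact: OM.
by rewrite (normalized_end J0u).
Qed.

(** * The families generated by f *)

Section Reduction.
Variable R : realType.

(** E = u - u(0) is homogeneous by the lines through 0 and respects midpoints
    by the others, hence is additive. *)
Lemma affine_of_lines (V : lmodType R) (u : V -> R) :
  (forall a c : V, exists p q, forall t : R, u (t *: a + c) = t * p + q) -> affine_fun u.
Proof.
move=> H; pose E (x : V) : R := u x - u 0.
have EZ t x : E (t *: x) = t * E x.
  have [p [q Hpq]] := H x 0; rewrite /E.
  have := Hpq t; have := Hpq 1; have := Hpq 0.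
  rewrite !addr0 scale0r scale1r => -> -> ->; ring.
have Emid x y : E x + E y = 2 * E (2^-1 *: (x + y)).
  have [p [q Hpq]] := H (y - x) x; rewrite /E.
  have := Hpq 0; have := Hpq 1; have := Hpq 2^-1.
  rewrite scale0r add0r scale1r subrK.
  have -> : 2^-1 *: (y - x) + x = 2^-1 *: (x + y).
    rewrite [in X in _ + X = _](_ : x = 2^-1 *: (x + x)); last first.
      by rewrite scalerDr -scalerDl -[LHS]scale1r; congr (_ *: _); field.
    by rewrite -scalerDr addrACA addNr addr0 addrC.
  by move=> -> -> ->; field.
have lin : GRing.linear_for *%R E.
  move=> t x y; rewrite -[t * E x]EZ Emid EZ; by field.
pose l : {scalar V} := HB.pack E (GRing.isLinear.Build R V R *%R E lin).
by exists l, (u 0) => x; rewrite /= /E subrK.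
Qed.

Lemma nonlinear_nonaffine (s : R -> R) : nonlinear_fun (s : R^o -> R) -> nonaffine s.
Proof.
move=> sn [a [c E]]; apply: sn; apply: affine_of_lines => a' c'.
exists (a' * a), (c' * a + c) => t; rewrite E /GRing.scale/=; ring.
Qed.

Lemma nonlinear_line d (u : 'rV[R]_d -> R) : nonlinear_fun u ->
  exists a b, nonaffine (fun t : R => u (t *: a + b)).
Proof.
move=> un; apply: contrapT => H; apply: un; apply: affine_of_lines => a b.
apply: contrapT => Hab; apply: H; exists a, b => -[p [q E]].
by apply: Hab; exists p, q.
Qed.

Variables (d : nat) (f : 'rV[R]_d -> 'rV[R]_d).
Hypothesis f_lip : lipschitz f.

Lemma component_line_lip i (a b : 'rV[R]_d) : exists K,
  lip K (fun t : R => component f i (t *: a + b)).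
Proof.
have [M [_ HM]] := f_lip.
have M1 : M < `|M| + 1 by rewrite (le_lt_trans (ler_norm _))// ltrDl.
have fK x y : `|f x - f y| <= (`|M| + 1) * `|x - y|.
  by have := HM _ M1 (x, y); apply.
exists ((`|M| + 1) * `|a|) => t u; rewrite /component.
rewrite (le_trans (rv_dist_ge _ _ _))// (le_trans (fK _ _))//.
by rewrite opprD addrACA subrr addr0 -scalerBl normrZ -mulrA [X in _ * X]mulrC.
Qed.

Lemma ridge_rich_F_aff : nonlinear_field f -> ridge_rich (F_aff f).
Proof.
move=> [i0 /nonlinear_line[a [b s_na]]] i j.
have [K sK] := component_line_lip i0 a b.
exists (fun t => component f i0 (t *: a + b)), K; split=> // c w b0.
exists ((c *: delta_mx i0 i)^T), ((w *: (delta_mx j 0 *m a))^T), (b0 *: a + b).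
apply/funext => x; rewrite !trmxK -!scalemxAr mul_row_delta scalerA; congr (_ * f _ 0 i0 *: _).
rewrite scalerDl -addrA; congr (_ + _); rewrite -scalerA; congr (_ *: _).
rewrite mulmxA; apply/rowP => k; rewrite !mxE big_ord1 mxE (bigD1 j)//= big1 ?addr0.
  by rewrite mxE !eqxx mulr1.
by move=> l lj; rewrite mxE (negbTE lj) mulr0.
Qed.

Lemma diag_scaled_delta (c : R) (i : 'I_d) : is_diag_mx (c *: delta_mx i i).
Proof.
apply/is_diag_mxP => k l kl; rewrite !mxE.
case: (eqVneq k i) => [ki|_]; last by rewrite mulr0.
by case: (eqVneq l i) => [li|_]; [rewrite ki li eqxx in kl|rewrite mulr0].
Qed.

Lemma ridge_rich_F_diag : fully_coordinate_nonlinear f -> ridge_rich (F_diag f).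
Proof.
move=> fn i j; have [b /nonlinear_nonaffine s_na] := fn i j.
have [K sK] := component_line_lip i (delta_mx 0 j) b.
exists (fun t => component f i (t *: delta_mx 0 j + b)), K; split=> // c w b0.
exists (c *: delta_mx i i), (w *: delta_mx j j), (b0 *: delta_mx 0 j + b).
split; try exact: diag_scaled_delta.
apply/funext => x; rewrite !linearZ/= !trmx_delta -?scalemxAr !mul_row_delta scalerA.
congr (_ * f _ 0 i *: _).
by rewrite scalerDl -addrA scalerA.
Qed.

End Reduction.

Theorem theorem2p9 (R : realType) (d : nat) (hd : (0 < d)%N)
    (f : 'rV[R]_d -> 'rV[R]_d) (f_lip : lipschitz f) :
  (nonlinear_field f -> UAP (F_aff f) /\ UIP (F_aff f)) /\
  (fully_coordinate_nonlinear f -> UAP (F_diag f) /\ UIP (F_diag f)).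
Proof.
split=> [/(ridge_rich_F_aff f_lip)|/(ridge_rich_F_diag f_lip)] Frich.
  by split; [exact: ridge_rich_UAP|exact: ridge_rich_UIP].
by split; [exact: ridge_rich_UAP|exact: ridge_rich_UIP].
Qed.
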